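(* Let $c_1\in[1,2)$ and $c_2\in[1,6/5)$, let $h_1\in\mathcal R_{c_1}$ and $h_2\in\mathcal R_{c_2}$, let $\varphi_1,\varphi_2,\psi$ be associated with $h_1,h_2$ as in the context, let $\mathbf B_N^{\pm}=\mathbf B_{\pm}\cap[1,N]$, and let $$p(c_1,c_2)=\frac{2/c_1-6/c_2+6}{1/c_1+3/c_2-3}=2+\frac{12-12/c_2}{1/c_1+3/c_2-3}.$$ Then for every $p\ge p(c_1,c_2)$ there exists a constant $\mathbf C_p>0$ such that for every $N\in\mathbb N$ and any sequence of complex numbers $(a_n:n\in\mathbb N)$ satisfying $\sup_{n\in\mathbb N}|a_n|\le 1$ we have $$\Big\|\sum_{n\in\mathbf B_N^{\pm}}a_ne^{2\pi i n\xi}\Big\|_{L^p(\mathbb T,\mathrm d\xi)}\le \mathbf C_p\Big\|\sum_{n\in\mathbf B_N^{\pm}}e^{2\pi i n\xi}\Big\|_{L^p(\mathbb T,\mathrm d\xi)}.$$ The inequality is asserted for each of the two choices of sign (the same sign on both sides).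
   Context: $\mathbb T=\mathbb R/\mathbb Z$ with normalized Lebesgue measure; $\lfloor x\rfloor$ is the integer part and $\{x\}=x-\lfloor x\rfloor$ the fractional part of a real number $x$. Throughout $x_0>0$ denotes a starting point of a half-line. Class $\mathcal L$: all functions $\ell:[x_0,\infty)\to(0,\infty)$ of the form $\ell(x)=\exp\big(\int_{x_0}^x\frac{\vartheta(t)}{t}\,\mathrm dt\big)$, where $\vartheta\in\mathcal C^2([x_0,\infty))$ is real-valued with $\lim_{x\to\infty}\vartheta(x)=0$, $\lim_{x\to\infty}x\vartheta'(x)=0$, $\lim_{x\to\infty}x^2\vartheta''(x)=0$. Class $\mathcal L_0$: all functions $\ell:[x_0,\infty)\to(0,\infty)$ of the form $\ell(x)=\exp\big(\int_{x_0}^x\frac{\vartheta(t)}{t}\,\mathrm dt\big)$ with $\lim_{x\to\infty}\ell(x)=\infty$, where $\vartheta\in\mathcal C^2([x_0,\infty))$ is positive, decreasing, with $\lim_{x\to\infty}\vartheta(x)=0$, $\lim_{x\to\infty}\frac{x\vartheta'(x)}{\vartheta(x)}=0$, $\lim_{x\to\infty}\frac{x^2\vartheta''(x)}{\vartheta(x)}=0$, and for every $\varepsilon>0$ there is $C_\varepsilon>0$ such that $1\le C_\varepsilon\vartheta(x)x^{\varepsilon}$. Class $\mathcal R_c$: for $c\in(0,2)\setminus\{1\}$, all increasing, convex functions $h:[x_0,\infty)\to[1,\infty)$ of the form $h(x)=x^cL(x)$ with $L\in\mathcal L$; for $c=1$ the same but with $L\in\mathcal L_0$. Given $h_1\in\mathcal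 R_{c_1}$ and $h_2\in\mathcal R_{c_2}$, $\varphi_1$ and $\varphi_2$ denote the inverse functions of $h_1$ and $h_2$. The function $\psi:[x_0,\infty)\to(0,\infty)$ is twice differentiable, satisfies $\psi(x)\le 1/2$ for all $x\ge x_0$, and $$\lim_{x\to\infty}\frac{\psi(x)}{\varphi_2'(x)}=1,\quad \lim_{x\to\infty}\frac{\psi'(x)}{\varphi_2''(x)}=1,\quad \lim_{x\to\infty}\frac{\psi''(x)}{\varphi_2'''(x)}=1.$$ Define $$\mathbf B_+=\{n\in\mathbb N:\{\varphi_1(n)\}<\psi(n)\},\qquad \mathbf B_-=\{n\in\mathbb N:\{-\varphi_1(n)\}<\psi(n)\},$$ where only those $n\in\mathbb N$ at which both $\varphi_1$ and $\psi$ are defined are considered. The constant $\mathbf C_p$ may depend on $p,h_1,h_2,\psi$. *)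

(* Defs.v *)
From HB Require Import structures.
From mathcomp Require Import all_boot all_order all_algebra.
From mathcomp Require Import complex.
From mathcomp Require Import all_classical all_reals all_analysis.

Set Implicit Arguments.
Unset Strict Implicit.
Unset Printing Implicit Defensive.

Import Order.TTheory GRing.Theory Num.Theory.
Import numFieldNormedType.Exports.
Import Normc.

Local Open Scope classical_set_scope.
Local Open Scope ring_scope.

(* Functions on a half-line [x0, +oo) are total functions R -> R whose values
   outside the half-line are irrelevant. *)

Section Regularity.
Variable R : realType.
Implicit Types (D : set R) (f : R -> R).

(* The difference quotients are taken inside D, so the derivative at the left
   end point of a half-line is the one-sided one, whereas at interior points
   this is the usual derivative. *)
Definition derivative_on D f (f1 : R -> R) : Prop :=
  forall x, D x ->
    (f y - f x) / (y - x) @[y --> within D x^'] --> f1 x.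

Definition twice_differentiable_on D f : Prop :=
  exists f1 f2, derivative_on D f f1 /\ derivative_on D f1 f2.

Definition C2_on D f : Prop :=
  exists f1 f2, [/\ derivative_on D f f1, derivative_on D f1 f2 &
                    {within D, continuous f2}].

End Regularity.

Section Classes.
Variable R : realType.
Implicit Types (c : R) (theta l h phi : R -> R).

Definition exp_integral_rep (x0 : R) theta l : Prop :=
  forall x, x0 <= x ->
    l x = expR (\int[lebesgue_measure]_(t in `[x0, x]) (theta t / t)).

(* The derivatives of theta only enter through limits at +oo, where the
   library's two-sided derivatives agree with those on [x0, +oo). *)
Definition class_L (x0 : R) l : Prop :=
  exists theta,
    [/\ C2_on `[x0, +oo[ theta,
        exp_integral_rep x0 theta l,
        theta x @[x --> +oo] --> (0 : R),
        x * derive1 theta x @[x --> +oo] --> (0 : R) &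
        x ^+ 2 * derive1n 2 theta x @[x --> +oo] --> (0 : R)].

Definition class_L0 (x0 : R) l : Prop :=
  l x @[x --> +oo] --> +oo /\
  exists theta,
    [/\ C2_on `[x0, +oo[ theta,
        exp_integral_rep x0 theta l,
        (forall x, x0 <= x -> 0 < theta x) &
        (forall x y, x0 <= x -> x <= y -> theta y <= theta x)] /\
    [/\ theta x @[x --> +oo] --> (0 : R),
        x * derive1 theta x / theta x @[x --> +oo] --> (0 : R),
        x ^+ 2 * derive1n 2 theta x / theta x @[x --> +oo] --> (0 : R) &
        forall eps : R, 0 < eps -> exists2 C : R, 0 < C &
          forall x, x0 <= x -> 1 <= C * theta x * x `^ eps].

Definition class_Rc c (x0 : R) h : Prop :=
  [/\ 0 < c < 2,
      (forall x, x0 <= x -> 1 <= h x),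
      (forall x y, x0 <= x -> x < y -> h x < h y),
      @convex_function R R^o `[x0, +oo[ h &
      exists l, (if c == 1 then class_L0 x0 l else class_L x0 l) /\
        forall x, x0 <= x -> h x = x `^ c * l x].

(* Functions h in class_Rc are continuous and unbounded, so that
   h @` [x0, +oo) = [h x0, +oo) is the domain of the inverse phi. *)
Definition inverse_on (x0 : R) h phi : Prop :=
  (forall x, x0 <= x -> phi (h x) = x) /\
  (forall y, h x0 <= y -> x0 <= phi y /\ h (phi y) = y).

End Classes.

Section Majorant.
Variable R : realType.

Definition frac (x : R) : R := x - (Num.floor x)%:~R.

(* B_+ for s = false and B_- for s = true. The inverse phi1 is defined on
   [y1, +oo) and psi on [x3, +oo). *)
Definition Bset (s : bool) (y1 x3 : R) (phi1 psi : R -> R) : pred nat :=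
  fun n => [&& (0 < n)%N, y1 <= n%:R, x3 <= n%:R &
               frac ((-1) ^+ s * phi1 n%:R) < psi n%:R].

(* exp (2 pi i t) *)
Definition e2pi (t : R) : R[i] :=
  Complex (cos (2 * pi * t)) (sin (2 * pi * t)).

Definition expsum (B : pred nat) (N : nat) (a : nat -> R[i]) (xi : R) : R[i] :=
  \sum_(1 <= n < N.+1 | B n) a n * e2pi (n%:R * xi).

(* The circle R/Z is identified with the fundamental domain [0, 1). *)
Definition circle_measure : {measure set (measurableTypeR R) -> \bar R} :=
  mrestr (@lebesgue_measure R) (measurable_itv `[0%R, 1%R[).

Definition circle_Lnorm (p : R) (F : R -> R[i]) : \bar R :=
  Lnorm circle_measure p%:E (fun xi => (normc (F xi))%:E).

Definition p_crit (c1 c2 : R) : R :=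
  (2 / c1 - 6 / c2 + 6) / (1 / c1 + 3 / c2 - 3).

End Majorant.

(* Main.v *)
(* Write b = |B_N| and let F be the exponential sum with coefficients a_n.  Near
   0 the unweighted sum has modulus at least b / 2, so its L^p norm is at least a
   constant times b / N^(1/p), and it suffices to bound the integral of |F|^p by
   C b^p / N.  Averaging over the translates by j / N reduces this to sums over
   the grid j / N.  If E is a level set {|F| > lambda} on that grid, duality and
   Cauchy-Schwarz give lambda^2 |E|^2 <= b sum_(n in B_N) |G(n)|^2 with
   G(n) = sum_(j in E) u_j e(n j / N).  On a dyadic block n ~ X the indicator of
   B is majorized by the Fejer-type kernel (4 / J^2) |sum_(k < J) e(k phi1(n))|^2
   with J ~ 1 / psi(X): its diagonal contributes psi(X) sum |G|^2, estimated by
   Bessel's inequality, and the rest is bounded by the exponential sums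
   sum_n e(m phi1(n) + n xi), which van der Corput's second difference test makes
   O(X^sigma).  Only a majorant of B is needed here; a trigonometric minorant
   shows that b is at least a constant times phi2(N).  The resulting level set
   estimate controls the large values of F, Plancherel the small ones, and the
   condition p >= p_crit is what makes the small values affordable.  When
   p_crit = p = 2, Plancherel alone suffices. *)

Require Import Defs.
From HB Require Import structures.
From mathcomp Require Import all_boot all_order all_algebra.
From mathcomp Require Import complex.
From mathcomp Require Import all_classical all_reals all_analysis.
From mathcomp Require Import measurable_realfun.
From mathcomp Require Import ring lra zify.

Set Implicit Arguments.
Unset Strict Implicit.
Unset Printing Implicit Defensive.

Import Order.TTheory GRing.Theory Num.Theory.
Import numFieldNormedType.Exports.
Import Normc.

Local Open Scope classical_set_scope.
Local Open Scope ring_scope.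

(** * Complex exponentials *)

(** Put g1 = 1/c1 and g2 = 1/c2. Up to arbitrarily small powers b is N^g2, and the small values of F
    are affordable when sigma (p - 2) / 2 + 1 <= g2 p / 2. At p = p_crit this is an equality for
    sigma = 1/2 + g2/2 - g1/6. Van der Corput gives the exponent max(1 - g1/2, (1 - g2 + g1) / 2),
    whose entries come from the extreme frequencies m = 1 and m ~ X / phi2(X); for c1 < 2 and c2 <
    6/5 it is strictly smaller. This surplus pays for all slowly varying factors, so regularity
    enters only through power bounds with a small loss eta. It also absorbs the degenerate case c1 =
    1, where x^2 h''/h tends to 0 and is bounded below only by a multiple of x^(-eta). For the large
    values, the interpolation exponent beta must lie below g2, so that dyadic blocks sum
    geometrically, and above 2/p, so that the level sets are summable; there is room because g2 p >
    2 once p > 2 and p >= p_crit. *)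

Section ComplexModulus.
Variable R : realType.
Implicit Types (z w : R[i]) (t : R).

Lemma normc_sqr z : normc z ^+ 2 = complex.Re z ^+ 2 + complex.Im z ^+ 2.
Proof. by case: z => a b /=; rewrite sqr_sqrtr// addr_ge0 ?sqr_ge0. Qed.

Lemma normc_ge0 z : 0 <= normc z.
Proof. by case: z => a b; exact: sqrtr_ge0. Qed.

Lemma normc_conj z : normc z^*%C = normc z.
Proof. by case: z => a b /=; rewrite sqrrN. Qed.

Lemma ler_normc_sum (I : Type) (r : seq I) (P : pred I) (F : I -> R[i]) :
  normc (\sum_(i <- r | P i) F i) <= \sum_(i <- r | P i) normc (F i).
Proof.
apply: (big_ind2 (fun z t => normc z <= t)) => //; first by rewrite normc0.
by move=> z t w s hz hw; rewrite (le_trans (le_normcD _ _))// lerD.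
Qed.

Lemma Re_le_normc z : `|complex.Re z| <= normc z.
Proof.
by rewrite -ler_sqr ?nnegrE ?normc_ge0// real_normK ?num_real// normc_sqr lerDl sqr_ge0.
Qed.

Lemma mul_conjc_normc z : z * z^*%C = (normc z ^+ 2)%:C%C.
Proof.
rewrite normc_sqr; case: z => a b /=; apply/eqP; rewrite eq_complex /=.
by apply/andP; split; apply/eqP; ring.
Qed.

Lemma normc_real t : normc t%:C%C = `|t|.
Proof. by rewrite /= expr0n/= addr0 sqrtr_sqr. Qed.

Lemma Re_sum (I : Type) (r : seq I) (P : pred I) (F : I -> R[i]) :
  complex.Re (\sum_(i <- r | P i) F i) = \sum_(i <- r | P i) complex.Re (F i).
Proof. by apply: (big_morph (@complex.Re R)) => // -[a b] [c d]. Qed.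

Lemma conjc_sum (I : Type) (r : seq I) (P : pred I) (F : I -> R[i]) :
  (\sum_(i <- r | P i) F i)^*%C = \sum_(i <- r | P i) (F i)^*%C.
Proof. exact: rmorph_sum. Qed.

Lemma conjcM z w : (z * w)^*%C = z^*%C * w^*%C.
Proof. exact: rmorphM. Qed.

Lemma realcM (s t : R) : (s * t)%:C%C = s%:C%C * t%:C%C.
Proof. exact: rmorphM. Qed.

Lemma realcB (s t : R) : (s - t)%:C%C = s%:C%C - t%:C%C.
Proof. exact: rmorphB. Qed.

Lemma realc_sum (I : Type) (r : seq I) (P : pred I) (F : I -> R) :
  (\sum_(i <- r | P i) F i)%:C%C = \sum_(i <- r | P i) (F i)%:C%C.
Proof. exact: rmorph_sum. Qed.

Lemma normc_sqr_sum (I : finType) (F : I -> R[i]) :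
  (normc (\sum_i F i) ^+ 2)%:C%C = \sum_i \sum_j F i * (F j)^*%C.
Proof.
rewrite -mul_conjc_normc conjc_sum mulr_suml.
by apply: eq_bigr => i _; rewrite mulr_sumr.
Qed.

End ComplexModulus.

Section Exponential.
Variable R : realType.
Implicit Types (x t : R).
Local Notation e := (@e2pi R).

Lemma e2piD x t : e (x + t) = e x * e t.
Proof.
by rewrite /e2pi mulrDr cosD sinD; apply/eqP; rewrite eq_complex /= eqxx/= addrC mulrC.
Qed.

Lemma e2pi0 : e 0 = 1.
Proof. by rewrite /e2pi mulr0 cos0 sin0. Qed.

Lemma e2piN x : e (- x) = (e x)^*%C.
Proof. by rewrite /e2pi mulrN cosN sinN. Qed.

Lemma normc_e2pi x : normc (e x) = 1.
Proof. by rewrite /= cos2Dsin2 sqrtr1. Qed.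

Lemma e2pi1 : e 1 = 1.
Proof. by rewrite /e2pi mulr1 mulr_natl cos2pi sin2pi. Qed.

Lemma e2pi_nat (n : nat) : e n%:R = 1.
Proof. by elim: n => [|n IH]; rewrite ?e2pi0// -natr1 e2piD IH e2pi1 mulr1. Qed.

Lemma e2pi_int (m : int) : e m%:~R = 1.
Proof.
case: m => n; first by rewrite -pmulrn e2pi_nat.
by rewrite NegzE mulrNz -pmulrn e2piN e2pi_nat conjc1.
Qed.

Lemma e2piDint x (m : int) : e (x + m%:~R) = e x.
Proof. by rewrite e2piD e2pi_int mulr1. Qed.

Lemma e2piMn x (n : nat) : e (n%:R * x) = e x ^+ n.
Proof.
elim: n => [|n IH]; first by rewrite mul0r e2pi0 expr0.
by rewrite -natr1 mulrDl mul1r e2piD IH exprSr.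
Qed.

Lemma cos_piquarter_sqr : cos (pi / 4) ^+ 2 = 1 / 2 :> R.
Proof.
have : cos (pi / 4 *+ 2) = 0 :> R.
  by rewrite -[RHS]cos_pihalf; congr cos; rewrite mulr2n; lra.
by rewrite cos_mulr2n; lra.
Qed.

Lemma cos_piquarter_ge : 1 / 2 <= cos (pi / 4) :> R.
Proof.
have h := cos_piquarter_sqr.
have : 0 <= cos (pi / 4) :> R.
  by apply: cos_ge0_pihalf; have := @pi_gt0 R; lra.
by nra.
Qed.

Lemma sin_piquarter_ge : 1 / 2 <= sin (pi / 4) :> R.
Proof.
rewrite -cosBpihalf -cosN (_ : - _ = pi / 4); last by lra.
exact: cos_piquarter_ge.
Qed.

Lemma cos_ge_half x : `|x| <= pi / 4 -> 1 / 2 <= cos x.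
Proof.
move=> hx; apply: (le_trans cos_piquarter_ge); rewrite -[leRHS]cos_norm.
have p0 := @pi_gt0 R.
have x0 := normr_ge0 x.
have [->//|ne] := eqVneq `|x| (pi / 4).
by apply: ltW; rewrite ltr_cos ?in_itv/= ?lt_neqAle ?ne//; lra.
Qed.

(** On [0, pi/4] the mean value theorem with cos >= 1/2 gives slope at least 1/2; on the rest sin is
    at least 1/2, which exceeds x/4 because pi < 4. *)
Lemma sin_ge_quarter x : 0 <= x <= pi / 2 -> x / 4 <= sin x.
Proof.
move=> /andP[x0 xp].
have pi2 := @pihalf_lt2 R; have pi1 := @pihalf_ge1 R.
have [hx|hx] := leP x (pi / 4); last first.
  apply: (@le_trans _ _ (1 / 2)); first by lra.
  apply: (le_trans sin_piquarter_ge).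
  by apply: ltW; rewrite ltr_sin ?in_itv/=; lra.
have [x00|x00] := eqVneq x 0; first by rewrite x00 sin0 mul0r.
have xpos : 0 < x by rewrite lt_neqAle eq_sym x00.
have cs (t : R) : t \in `]0, x[ -> is_derive t 1 (@sin R) (cos t).
  by move=> _; exact: is_derive_sin.
have [|c] := MVT xpos cs.
  by apply: continuous_subspaceT => t; exact: continuous_sin.
rewrite in_itv/= sin0 !subr0 => /andP[c0 cx] ->.
rewrite mulrC ler_pM2r//.
suff : 1 / 2 <= cos c by lra.
by apply: cos_ge_half; rewrite gtr0_norm//; lra.
Qed.

Lemma sinpi_ge x : 0 <= x <= 1 / 2 -> x / 2 <= sin (pi * x).
Proof.
move=> /andP[x0 x1]; have p2 := @pi_ge2 R.
by apply: (@le_trans _ _ (pi * x / 4)); [nra | apply: sin_ge_quarter; apply/andP; split; nra].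
Qed.

Lemma sinpi_ge_itv x (d : R) : 0 < d <= 1 / 2 -> d <= x <= 1 - d -> d / 2 <= sin (pi * x).
Proof.
move=> /andP[d0 d1] /andP[x0 x1].
have [hx|hx] := leP x (1 / 2).
  by apply: (le_trans _ (sinpi_ge _)); [lra | apply/andP; split; lra].
have -> : sin (pi * x) = sin (pi * (1 - x)).
  rewrite (_ : pi * (1 - x) = - (pi * x) + pi); last by ring.
  by rewrite sinDpi sinN opprK.
by apply: (le_trans _ (sinpi_ge _)); [lra | apply/andP; split; lra].
Qed.

Lemma Re_e2pi_ge x : `|x| <= 1 / 8 -> 1 / 2 <= complex.Re (e x).
Proof.
move=> hx; apply: cos_ge_half; rewrite normrM gtr0_norm ?mulr_gt0 ?pi_gt0//.
by have := @pi_gt0 R; nra.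
Qed.

Lemma e2pi_subr1 x : e x - 1 = Complex (- 2 * sin (pi * x) ^+ 2) (2 * sin (pi * x) * cos (pi * x)).
Proof.
rewrite /e2pi (_ : 2 * pi * x = (pi * x) *+ 2); last by rewrite mulr2n; ring.
rewrite cos_mulr2n sin_mulr2n; apply/eqP; rewrite eq_complex /=.
have := cos2Dsin2 (pi * x); set c := cos _; set s := sin _ => h.
by apply/andP; split; apply/eqP; rewrite ?mulr2n; lra.
Qed.

Lemma normc_e2pi_subr1_sqr x : normc (e x - 1) ^+ 2 = 4 * sin (pi * x) ^+ 2.
Proof.
rewrite e2pi_subr1 normc_sqr /=.
have := cos2Dsin2 (pi * x); set c := cos _; set s := sin _ => h.
rewrite !exprMn (_ : c ^+ 2 = 1 - s ^+ 2); [by ring | by lra].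
Qed.

End Exponential.

(** * Van der Corput's second difference test *)

Section VanDerCorput.
Variable R : realType.
Local Notation e := (@e2pi R).

(* [c (e g - 1) = 1], with [c] having constant real part: along a monotone
   sequence of arguments its variation telescopes. *)
Let c (x : R) : R[i] := Complex (- (1 / 2)) (- (cos (pi * x) / sin (pi * x)) / 2).

Let cK (x : R) : 0 < sin (pi * x) -> c x * (e x - 1) = 1.
Proof.
move=> s0; rewrite e2pi_subr1 /c; apply/eqP; rewrite eq_complex /=.
have := cos2Dsin2 (pi * x); move: s0; set k := cos _; set s := sin _ => s0 h.
have sn0 : s != 0 by rewrite gt_eqF.
apply/andP; split; apply/eqP.
  by rewrite -[RHS]h; field.
by field.
Qed.

Let normc_c (x : R) : 0 < sin (pi * x) -> normc (c x) = 1 / (2 * sin (pi * x)).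
Proof.
move=> s0; apply/eqP; rewrite -(@eqrXn2 _ 2) ?normc_ge0 ?divr_ge0 ?mulr_ge0 ?(ltW s0)//.
rewrite normc_sqr /=.
have := cos2Dsin2 (pi * x); move: s0; set k := cos _; set s := sin _ => s0 h.
have sn0 : s != 0 by rewrite gt_eqF.
have -> : (- (1 / 2)) ^+ 2 + (- (k / s) / 2) ^+ 2 = (k ^+ 2 + s ^+ 2) / (2 * s) ^+ 2 by field.
by rewrite h expr_div_n expr1n.
Qed.

Let cot_decr (x y : R) : 0 < sin (pi * x) -> 0 < sin (pi * y) -> x <= y <= x + 1 ->
  cos (pi * y) / sin (pi * y) <= cos (pi * x) / sin (pi * x).
Proof.
move=> sx sy /andP[xy yx]; rewrite ler_pdivrMr// mulrAC ler_pdivlMr//.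
rewrite -subr_ge0 (mulrC (cos _) (sin _)) -sinB -mulrBr.
by apply: sin_ge0_pi; have := @pi_gt0 R; nra.
Qed.

(** Kusmin-Landau inequality. Each term is [c (g n)] times a difference of consecutive exponentials;
    partial summation leaves two boundary values of [c], at most 1/d each, and half the total drop
    of the cotangent, at most (2/d + 2/d) / 2. *)
Lemma kusmin_landau_unit (f : nat -> R) (d : R) (a b : nat) :
    0 < d <= 1 / 2 ->
    (forall n, (a <= n < b)%N -> d <= f n.+1 - f n <= 1 - d) ->
    (forall n, (a <= n)%N -> (n.+1 < b)%N -> f n.+1 - f n <= f n.+2 - f n.+1) ->
  normc (\sum_(a <= n < b) e (f n)) <= 4 / d.
Proof.
move=> hd hg gm; have /andP[d0 d1] := hd; pose g n := f n.+1 - f n.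
have [ba|ab] := leqP b a; first by rewrite big_geq// normc0 divr_ge0// ltW.
have hs n : (a <= n < b)%N -> d / 2 <= sin (pi * g n).
  by move=> hn; apply: sinpi_ge_itv => //; exact: hg.
have s0 n : (a <= n < b)%N -> 0 < sin (pi * g n).
  by move=> /hs; apply: lt_le_trans; rewrite divr_gt0.
have eE n : (a <= n < b)%N -> e (f n) = c (g n) * (e (f n.+1) - e (f n)).
  move=> hn; have -> : f n.+1 = f n + g n by rewrite /g; ring.
  by rewrite e2piD -{3}[e (f n)]mulr1 -mulrBr mulrCA cK ?mulr1// s0.
pose ct x : R := cos (pi * x) / sin (pi * x).
(* Keeping the boundary term inside the norm lets the induction close: each step then adds only half
   the drop of the cotangent. *)
suff key m : (a <= m < b)%N -> normc (\sum_(a <= n < m.+1) e (f n) - c (g m) * e (f m.+1)) <=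
    normc (c (g a)) + (ct (g a) - ct (g m)) / 2.
  have hb : (a <= b.-1 < b)%N by case: (b) ab => // b'; rewrite ltnS leqnn => ->.
  have ha : (a <= a < b)%N by rewrite leqnn.
  have := key _ hb; rewrite prednK ?(leq_ltn_trans _ ab)// => h.
  have cb n : (a <= n < b)%N -> normc (c (g n)) <= 1 / d.
    move=> hn; rewrite normc_c ?s0// ler_pM2l// lef_pV2 ?posrE ?mulr_gt0 ?s0//.
    by have := hs _ hn; lra.
  have ctb n : (a <= n < b)%N -> `|ct (g n)| <= 2 / d.
    move=> hn; rewrite /ct normrM normfV (gtr0_norm (s0 _ hn)).
    apply: (@le_trans _ _ (1 / sin (pi * g n))).
      by rewrite ler_pM2r ?invr_gt0 ?s0// cos_max.
    rewrite (_ : 2 / d = 1 / (d / 2)); last by field; rewrite gt_eqF.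
    by rewrite ler_pM2l// lef_pV2 ?posrE ?s0 ?divr_gt0// hs.
  have e1 : normc (\sum_(a <= n < b) e (f n)) <=
     normc (\sum_(a <= n < b) e (f n) - c (g b.-1) * e (f b)) + normc (c (g b.-1)).
    rewrite -[X in normc X](subrK (c (g b.-1) * e (f b))).
    by rewrite (le_trans (le_normcD _ _))// normcM normc_e2pi mulr1.
  have := cb _ ha; have := cb _ hb.
  have := ctb _ ha; have := ctb _ hb; rewrite !ler_norml.
  have -> : 4 / d = 4 * (1 / d) by rewrite mulrA mulr1.
  have -> : 2 / d = 2 * (1 / d) by rewrite mulrA mulr1.
  by move=> /andP[? ?] /andP[? ?] ? ?; lra.
elim: m => [|m IH] hm.
  move: hm; rewrite leqn0 => /andP[/eqP a0 b0].
  rewrite a0 big_nat1 eE ?a0 ?leqnn// mulrBr addrAC subrr sub0r normcN normcM.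
  by rewrite normc_e2pi mulr1 subrr mul0r addr0.
have [am|ma] := leqP a m; last first.
  have -> : a = m.+1 by apply/eqP; rewrite eqn_leq ma (andP hm).1.
  rewrite big_nat1 eE ?hm// mulrBr addrAC subrr sub0r normcN normcM.
  by rewrite normc_e2pi mulr1 subrr mul0r addr0.
have hm' : (a <= m < b)%N by rewrite am ltnW// (andP hm).2.
rewrite big_nat_recr ?(andP hm).1//.
rewrite [X in normc (X - _)]/= {1}(eE _ hm) (_ : _ - _ = (\sum_(a <= n < m.+1) e (f n) - c (g m) * e (f m.+1)) +
  (c (g m) - c (g m.+1)) * e (f m.+1)); last by ring.
rewrite (le_trans (le_normcD _ _))//.
have gmm : g m <= g m.+1 by apply: gm; rewrite // (andP hm).2.
have ctm : ct (g m.+1) <= ct (g m).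
  apply: cot_decr; rewrite ?s0// gmm/=.
  by move: (hg _ hm) (hg _ hm'); rewrite -/(g m) -/(g m.+1); lra.
have -> : normc ((c (g m) - c (g m.+1)) * e (f m.+1)) = (ct (g m) - ct (g m.+1)) / 2.
  rewrite normcM normc_e2pi mulr1 (_ : _ - _ = Complex 0 (- (ct (g m) - ct (g m.+1)) / 2)).
    rewrite /= expr0n add0r sqrtr_sqr mulNr normrN ger0_norm//.
    by rewrite divr_ge0// subr_ge0.
  by rewrite /c /ct; apply/eqP; rewrite eq_complex/=; apply/andP; split; apply/eqP; lra.
by apply: (le_trans (lerD (IH hm') (lexx _))); lra.
Qed.

Lemma kusmin_landau (f : nat -> R) (d : R) (k : int) (a b : nat) :
    0 < d <= 1 / 2 ->
    (forall n, (a <= n < b)%N -> k%:~R + d <= f n.+1 - f n <= k%:~R + 1 - d) ->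
    (forall n, (a <= n)%N -> (n.+1 < b)%N -> f n.+1 - f n <= f n.+2 - f n.+1) ->
  normc (\sum_(a <= n < b) e (f n)) <= 4 / d.
Proof.
move=> hd hg gm.
rewrite (eq_bigr (fun n : nat => e (f n - k%:~R * n%:R))); last first.
  move=> n _; rewrite -mulNr -(mulrNz (1 : R)).
  by rewrite (_ : (- k)%:~R * n%:R = (- k * n)%:~R) ?e2piDint// intrM pmulrn.
apply: kusmin_landau_unit => // n.
  by move=> /hg; rewrite -natr1; lra.
by move=> h1 h2; have := gm n h1 h2; rewrite -!natr1; lra.
Qed.

Lemma monotone_threshold (g : nat -> R) (t : R) (a b : nat) : (a <= b)%N ->
    (forall n, (a <= n)%N -> (n.+1 < b)%N -> g n <= g n.+1) ->
  exists m, [/\ (a <= m <= b)%N, forall n, (a <= n < m)%N -> g n < t &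
    forall n, (m <= n < b)%N -> t <= g n].
Proof.
elim: b => [|b IH] ab gm.
  by exists a; split=> [|n|n]; lia.
have [ab'|ba] := leqP a b; last first.
  exists a; split; first by rewrite leqnn.
    by move=> n; lia.
  by move=> n /andP[h1 h2]; have := leq_ltn_trans h1 h2; rewrite ltnS leqNgt ba.
have [n h1 h2|m [/andP[am mb] h1 h2]] := IH ab'; first by apply: gm => //; exact: ltnW.
have [hb|hb] := ltP (g b) t.
  exists b.+1; split; rewrite ?ab ?leqnn//; last by move=> n; lia.
  suff all n : (n <= b)%N -> (a <= b - n)%N -> g (b - n)%N < t.
    by move=> n /andP[an nb]; rewrite -(subKn (nb : (n <= b)%N)); apply: all; rewrite ?leq_subr// subKn.
  elim: n => [|n IHn] nb an; first by rewrite subn0.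
  apply: le_lt_trans (IHn (ltnW nb) _); last by rewrite (leq_trans an)// leq_sub2l.
  by rewrite subnS in an *; rewrite -[in leRHS](@prednK (b - n)) ?subn_gt0//; apply: gm => //;
    rewrite prednK ?subn_gt0// ltnS leq_subr.
exists m; split; rewrite ?am ?(leqW mb)// => n /andP[mn]; rewrite ltnS leq_eqVlt => /orP[/eqP->//|nb].
by apply: h2; rewrite mn.
Qed.

Let trivial_bound (f : nat -> R) a b : normc (\sum_(a <= n < b) e (f n)) <= (b - a)%:R.
Proof.
apply: (le_trans (ler_normc_sum _ _ _)).
by rewrite (eq_bigr (fun=> 1)) ?sumr_const_nat// => n _; rewrite normc_e2pi.
Qed.

Let growth (g : nat -> R) (l : R) a n : (forall i, (a <= i < a + n)%N -> l <= g i.+1 - g i) ->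
  l * n%:R <= g (a + n)%N - g a.
Proof.
elim: n => [|n IH] h; first by rewrite addn0 mulr0 subrr.
have := IH _; rewrite -natr1 addnS => h1.
have := h (a + n)%N; rewrite leq_addr addnS ltnS leqnn => /(_ isT).
have : l * n%:R <= g (a + n)%N - g a.
  by apply: h1 => i /andP[ai ib]; apply: h; rewrite ai addnS ltnW.
by lra.
Qed.

(** The slopes grow by at least [l] at each step and stay in a window of length [d], so there are at
    most d/l + 1 terms. *)
Let narrow (f : nat -> R) (l t d : R) a b : 0 < l -> 0 <= d ->
    (forall n, (a <= n)%N -> (n.+1 < b)%N -> l <= (f n.+2 - f n.+1) - (f n.+1 - f n)) ->
    (forall n, (a <= n < b)%N -> t <= f n.+1 - f n <= t + d) ->
  normc (\sum_(a <= n < b) e (f n)) <= d / l + 1.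
Proof.
move=> l0 d0 hl hg; apply: (le_trans (trivial_bound _ _ _)).
have [ba|ab] := leqP b a.
  by rewrite (eqP (_ : b - a == 0)%N) ?subn_eq0// addr_ge0// divr_ge0// ltW.
have /(growth (g := fun n => f n.+1 - f n)) : forall i, (a <= i < a + (b - a).-1)%N -> l <= (f i.+2 - f i.+1) - (f i.+1 - f i).
  move=> i /andP[ai ib]; apply: hl => //.
  by lia.
have -> : (a + (b - a).-1 = b.-1)%N by lia.
move=> h.
have := hg b.-1; have := hg a; rewrite leqnn ab => /(_ isT) h1 h2.
have {h2}h2 : t <= f b.-1.+1 - f b.-1 <= t + d by apply: h2; lia.
have -> : (b - a = (b - a).-1.+1)%N by lia.
by rewrite -natr1 lerD2r ler_pdivlMr// mulrC (le_trans h)//; lra.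
Qed.

Let unit_piece (f : nat -> R) (l : R) (k : int) a b : 0 < l <= 1 -> (a <= b)%N ->
    (forall n, (a <= n)%N -> (n.+1 < b)%N -> l <= (f n.+2 - f n.+1) - (f n.+1 - f n)) ->
    (forall n, (a <= n < b)%N -> k%:~R <= f n.+1 - f n <= k%:~R + 1) ->
  normc (\sum_(a <= n < b) e (f n)) <= 11 / Num.sqrt l.
Proof.
move=> /andP[l0 l1] ab hl hg; pose s := Num.sqrt l.
have s0 : 0 < s by rewrite sqrtr_gt0.
have s1 : s <= 1 by rewrite -[leRHS]sqrtr1 ler_sqrt.
have sl : l = s ^+ 2 by rewrite sqr_sqrtr// ltW.
have hlo n : (a <= n < b)%N -> k%:~R <= f n.+1 - f n by move=> /hg/andP[].
have hup n : (a <= n < b)%N -> f n.+1 - f n <= k%:~R + 1 by move=> /hg/andP[].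
have gm n : (a <= n)%N -> (n.+1 < b)%N -> f n.+1 - f n <= f n.+2 - f n.+1.
  by move=> h1 h2; have := hl n h1 h2; lra.
(* The slopes within s/2 of an end point form two narrow pieces of cost 1/(2s) + 1 each; the middle
   costs 8/s by Kusmin-Landau with d = s/2. Since s <= 1, the total is at most 11/s. *)
have [c1 [/andP[ac cb] lo1 hi1]] := monotone_threshold (g := fun n => f n.+1 - f n) (k%:~R + s / 2) ab gm.
have [c2 [/andP[cc cb2] lo2 hi2]] : exists c2, [/\ (c1 <= c2 <= b)%N,
    forall n, (c1 <= n < c2)%N -> f n.+1 - f n < k%:~R + 1 - s / 2 &
    forall n, (c2 <= n < b)%N -> k%:~R + 1 - s / 2 <= f n.+1 - f n].
  apply: (monotone_threshold (g := fun n => f n.+1 - f n)) => // n h1 h2.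
  by apply: gm => //; exact: leq_trans h1.
rewrite (big_cat_nat ac cb)// (big_cat_nat cc cb2)//=.
rewrite (le_trans (le_normcD _ _))//.
have n1 : normc (\sum_(a <= n < c1) e (f n)) <= (s / 2) / l + 1.
  apply: (@narrow _ _ k%:~R) => //; first by rewrite divr_ge0// ltW.
    by move=> n h1 h2; apply: hl => //; exact: leq_trans h2 cb.
  move=> n /andP[h1 h2]; rewrite (ltW (lo1 _ _)) ?h1// andbT.
  by apply: hlo; rewrite h1 (leq_trans h2).
have n2 : normc (\sum_(c1 <= n < c2) e (f n)) <= 4 / (s / 2).
  apply: (@kusmin_landau _ _ k).
  - by lra.
  - move=> n /andP[h1 h2]; rewrite hi1 ?h1 ?(leq_trans h2)//=.
    by rewrite (ltW (lo2 _ _))// h1.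
  - move=> n h1 h2; apply: gm; first exact: leq_trans h1.
    exact: leq_trans h2 cb2.
have n3 : normc (\sum_(c2 <= n < b) e (f n)) <= (s / 2) / l + 1.
  apply: (@narrow _ _ (k%:~R + 1 - s / 2)) => //; first by rewrite divr_ge0// ltW.
    by move=> n h1 h2; apply: hl => //; rewrite (leq_trans ac)// (leq_trans cc).
  move=> n /andP[h1 h2]; rewrite hi2 ?h1//= subrK.
  by apply: hup; rewrite h2 andbT (leq_trans ac)// (leq_trans cc).
have -> : 11 / Num.sqrt l = (s / 2) / l + 4 / (s / 2) + (s / 2) / l + 2 / s.
  by rewrite -/s sl; field; rewrite gt_eqF.
have s2 : 2 <= 2 / s by rewrite ler_pdivlMr//; lra.
have := le_normcD (\sum_(c1 <= n < c2) e (f n)) (\sum_(c2 <= n < b) e (f n)).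
by lra.
Qed.

Let unit_pieces (f : nat -> R) (l : R) (K : nat) (k : int) a b : 0 < l <= 1 -> (a <= b)%N ->
    (forall n, (a <= n)%N -> (n.+1 < b)%N -> l <= (f n.+2 - f n.+1) - (f n.+1 - f n)) ->
    (forall n, (a <= n < b)%N -> k%:~R <= f n.+1 - f n <= k%:~R + K.+1%:R) ->
  normc (\sum_(a <= n < b) e (f n)) <= K.+1%:R * (11 / Num.sqrt l).
Proof.
move=> hl01; elim: K k a => [|K IH] k a ab hl hg.
  by rewrite mul1r; apply: (@unit_piece _ _ k).
have [l0 l1] := andP hl01.
have gm n : (a <= n)%N -> (n.+1 < b)%N -> f n.+1 - f n <= f n.+2 - f n.+1.
  by move=> h1 h2; have := hl n h1 h2; lra.
have [c1 [/andP[ac cb] lo1 hi1]] := monotone_threshold (g := fun n => f n.+1 - f n) (k%:~R + 1) ab gm.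
rewrite (big_cat_nat ac cb)//= (le_trans (le_normcD _ _))//.
rewrite -natr1 mulrDl mul1r addrC lerD//.
  apply: (IH (k + 1)) => //.
    by move=> n h1 h2; apply: hl => //; exact: leq_trans h1.
  move=> n /andP[h1 h2]; rewrite intrD hi1 ?h1//=.
  have /andP[_] : k%:~R <= f n.+1 - f n <= k%:~R + K.+2%:R by apply: hg; rewrite (leq_trans ac h1).
  by rewrite -[K.+2%:R]natr1; lra.
apply: (@unit_piece _ _ k) => //.
  by move=> n h1 h2; apply: hl => //; exact: leq_trans h2 cb.
move=> n /andP[h1 h2]; rewrite (ltW (lo1 _ _)) ?h1// andbT.
by have /andP[-> _] : k%:~R <= f n.+1 - f n <= k%:~R + K.+2%:R by apply: hg; rewrite h1 (leq_trans h2).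
Qed.

Lemma second_difference_test (f : nat -> R) (l L : R) a b : 0 < l <= 1 -> (a <= b)%N ->
    (forall n, (a <= n)%N -> (n.+1 < b)%N ->
       l <= (f n.+2 - f n.+1) - (f n.+1 - f n) <= L) ->
    0 <= L ->
  normc (\sum_(a <= n < b) e (f n)) <= (L * (b - a)%:R + 3) * (11 / Num.sqrt l).
Proof.
move=> hl ab hd L0; have /andP[l0 l1] := hl.
have Lba : 0 <= L * (b - a)%:R by rewrite mulr_ge0.
have s0 : 0 <= 11 / Num.sqrt l by rewrite divr_ge0// sqrtr_ge0.
have [ba|ab'] := leqP b a.
  by rewrite big_geq// normc0 mulr_ge0// addr_ge0.
(* The slopes start in [k, k + 1), with k the floor of the first one, and increase by at most L (b -
   a), so they stay within K + 1 consecutive unit intervals. *)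
pose K := (Num.truncn (L * (b - a)%:R)).+1.
have Kl : K.+1%:R <= L * (b - a)%:R + 2.
  rewrite /K -addn2 natrD lerD2r.
  by have := @truncn_le R (L * (b - a)%:R); rewrite Lba.
have Ku : L * (b - a)%:R <= K%:R by apply: ltW; rewrite /K truncnS_gt.
apply: (@le_trans _ _ (K.+1%:R * (11 / Num.sqrt l))); last first.
  by apply: ler_wpM2r => //; lra.
have glo n : (a <= n < b)%N -> f a.+1 - f a <= f n.+1 - f n <= f a.+1 - f a + L * (n - a)%:R.
  elim: n => [|n IH]; first by case: a {ab hd Lba ab' K Kl Ku} => //; rewrite mulr0 addr0 lexx.
  move=> /andP[an nb]; have [an'|na] := leqP a n; last first.
    have -> : a = n.+1 by lia.
    by rewrite subnn mulr0 addr0 lexx.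
  have /IH : (a <= n < b)%N by rewrite an' ltnW.
  have := hd n an' nb; rewrite subSn// -natr1.
  by lra.
apply: (@unit_pieces _ _ _ (Num.floor (f a.+1 - f a))) => //.
  by move=> n h1 h2; have /andP[] := hd n h1 h2.
move=> n hn; have /andP[g1 g2] := glo n hn.
have f1 := @floor_le_tmp R (f a.+1 - f a); have := @floorD1_gt R (f a.+1 - f a); rewrite intrD => f2.
have : L * (n - a)%:R <= L * (b - a)%:R.
  by rewrite ler_wpM2l// ler_nat leq_sub2r// ltnW// (andP hn).2.
by rewrite -natr1; lra.
Qed.

End VanDerCorput.

(** * Sieve weights *)

Section Sieve.
Variable R : realType.
Local Notation e := (@e2pi R).
Local Notation frac := (@Defs.frac R).

Lemma cauchy_schwarz_sum (I : Type) (r : seq I) (P : pred I) (f g : I -> R) :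
  (\sum_(i <- r | P i) f i * g i) ^+ 2 <=
    (\sum_(i <- r | P i) f i ^+ 2) * (\sum_(i <- r | P i) g i ^+ 2).
Proof.
set A := \sum_(i <- r | P i) f i ^+ 2; set B := \sum_(i <- r | P i) g i ^+ 2.
set D := \sum_(i <- r | P i) f i * g i.
have A0 : 0 <= A by apply: sumr_ge0 => i _; exact: sqr_ge0.
have key (t : R) : 0 <= A * t ^+ 2 - 2 * D * t + B.
  rewrite /A /B /D mulr_suml mulr_sumr mulr_suml -sumrB -big_split/=.
  apply: sumr_ge0 => i _; rewrite (_ : _ + _ = (f i * t - g i) ^+ 2); first exact: sqr_ge0.
  by ring.
have [A00|A00] := eqVneq A 0.
  have D0 : D = 0.
    (* For A = 0 the quadratic form is affine in t, and this t would give it the value -1. *)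
    have := key ((B + 1) / (2 * D)); rewrite A00 mul0r sub0r.
    have [//|D0] := eqVneq D 0.
    by rewrite mulrC divfK ?mulf_neq0//; lra.
  by rewrite D0 A00 expr0n/= mul0r.
have := key (D / A).
rewrite (_ : _ + B = (A * B - D ^+ 2) / A); last by field.
by rewrite pmulr_lge0 ?invr_gt0 ?lt_neqAle ?A0 ?andbT 1?eq_sym// subr_ge0.
Qed.

Lemma geometric_sum_e2pi (x : R) (n : nat) :
  (e x - 1) * (\sum_(k < n) e (k%:R * x)) = e (n%:R * x) - 1.
Proof.
elim: n => [|n IH]; first by rewrite big_ord0 mulr0 mul0r e2pi0 subrr.
by rewrite big_ord_recr/= mulrDr IH -natr1 [(_ + 1) * x]mulrDl mul1r e2piD; ring.
Qed.

Lemma sum_roots_of_unity (M k l : nat) : (0 < M)%N -> (k < M)%N -> (l < M)%N ->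
  \sum_(i < M) e (i%:R * ((k%:R - l%:R) / M%:R)) = if k == l then M%:R else 0.
Proof.
move=> M0 kM lM; have [->|kl] := eqVneq k l.
  rewrite subrr mul0r (eq_bigr (fun=> 1)) => [|i _]; last by rewrite mulr0 e2pi0.
  by rewrite sumr_const card_ord.
have MR : 0 < M%:R :> R by rewrite ltr0n.
set r := (_ - _) / _.
have r0 : r != 0 by rewrite mulf_neq0 ?subr_eq0 ?eqr_nat// invr_neq0// gt_eqF.
have w1 : e r - 1 != 0.
  apply/eqP => /(congr1 (fun z => normc z ^+ 2)); rewrite normc_e2pi_subr1_sqr normc0 expr0n/=.
  suff : sin (pi * r) != 0 by move=> h /eqP; rewrite mulf_eq0 expf_eq0/= (negPf h) orbF pnatr_eq0.
  have -> : pi * r = Num.sg r * (pi * `|r|) by rewrite [RHS]mulrCA -numEsg.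
  rewrite sin_sg.
  rewrite mulf_neq0 ?sgr_eq0// gt_eqF// sin_gt0_pi// mulr_gt0 ?pi_gt0 ?normr_gt0//=.
  rewrite -[ltRHS]mulr1 ltr_pM2l ?pi_gt0// normrM normfV (gtr0_norm MR) ltr_pdivrMr// mul1r.
  rewrite ltr_norml ltrBlDr ltrNl opprB ltrBlDr.
  rewrite -!natrD !ltr_nat; lia.
have Mr : M%:R * r = (k%:Z - l%:Z)%:~R.
  by rewrite intrB -!pmulrn mulrC divfK// gt_eqF.
have := geometric_sum_e2pi r M; rewrite Mr e2pi_int subrr => /eqP.
by rewrite mulf_eq0 (negPf w1) => /eqP.
Qed.

Lemma sum_roots_of_unity_shift (M a k l : nat) : (0 < M)%N -> (k < M)%N -> (l < M)%N ->
  \sum_(a <= n < a + M) e (n%:R * ((k%:R - l%:R) / M%:R)) = if k == l then M%:R else 0.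
Proof.
move=> M0 kM lM; rewrite -{1}[a]add0n big_addn addnC addnK big_mkord.
under eq_bigr do rewrite natrD mulrDl e2piD.
rewrite -mulr_suml sum_roots_of_unity//; case: eqP => [->|_]; last by rewrite mul0r.
by rewrite subrr mul0r mulr0 e2pi0 mulr1.
Qed.

Section Weighted.
Variables (x z : nat -> R) (a b D : nat) (S : R).
Hypothesis zS : forall m, (0 < m <= D)%N ->
  normc (\sum_(a <= n < b) (z n)%:C%C * e (m%:R * x n)) <= S.

(** Expanding the square, the pairs with equal frequencies contribute the main term, and every other
    pair has a nonzero frequency of modulus at most [D], negative ones being reduced to positive
    ones by conjugation. It is used with d the identity on an initial segment and with d the sum of
    two indices, which produces a fourth power. *)
Lemma diagonal_sum (I : finType) (d : I -> nat) : 0 <= S -> (forall i, (d i <= D)%N) ->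
  `|\sum_(a <= n < b) z n * normc (\sum_i e ((d i)%:R * x n)) ^+ 2 -
      #|[pred p : I * I | d p.1 == d p.2]|%:R * \sum_(a <= n < b) z n| <= #|I|%:R ^+ 2 * S.
Proof.
move=> S0 dD.
pose T (p : I * I) := \sum_(a <= n < b) (z n)%:C%C * e (((d p.1)%:R - (d p.2)%:R) * x n).
have TS p : d p.1 != d p.2 -> normc (T p) <= S.
  rewrite /T; move: p.1 p.2 => i j ij.
  wlog lij : i j ij / (d j < d i)%N.
    move=> H; move: (ij); rewrite neq_ltn => /orP[ji|]; last exact: H.
    rewrite -normc_conj conjc_sum.
    rewrite (eq_bigr (fun n => (z n)%:C%C * e (((d j)%:R - (d i)%:R) * x n))); last first.
      by move=> n _; rewrite conjcM conjc_real -e2piN -mulNr opprB.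
    by apply: H => //; rewrite eq_sym.
  rewrite -natrB ?(ltnW lij)//; apply: zS.
  by rewrite subn_gt0 lij/= (leq_trans (leq_subr _ _))// dD.
have Tdiag p : d p.1 = d p.2 -> T p = (\sum_(a <= n < b) z n)%:C%C.
  move=> dp; rewrite /T dp realc_sum; apply: eq_bigr => n _.
  by rewrite subrr mul0r e2pi0 mulr1.
have E : (\sum_(a <= n < b) z n * normc (\sum_i e ((d i)%:R * x n)) ^+ 2)%:C%C = \sum_p T p.
  rewrite realc_sum exchange_big; apply: eq_bigr => n _.
  rewrite realcM normc_sqr_sum -mulr_sumr; congr (_ * _).
  rewrite (pair_big xpredT xpredT (fun i j => e ((d i)%:R * x n) * (e ((d j)%:R * x n))^*%C)).
  by apply: eq_bigr => p _; rewrite -e2piN -e2piD mulrBl.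
rewrite -normc_real realcB realcM E.
rewrite (bigID (fun p : I * I => d p.1 == d p.2))/=.
rewrite (eq_bigr (fun=> (\sum_(a <= n < b) z n)%:C%C)) => [|p /eqP]; last exact: Tdiag.
rewrite sumr_const rmorph_nat mulr_natl addrAC subrr add0r.
apply: (le_trans (ler_normc_sum _ _ _)).
apply: (@le_trans _ _ (\sum_(p : I * I) S)).
  rewrite big_mkcond/=; apply: ler_sum => p _.
  by case: ifPn => // h; exact: TS.
by rewrite sumr_const card_prod -[S *+ _]mulr_natl natrM expr2.
Qed.

End Weighted.

Section ArcMajorant.
Implicit Types (x t : R).

Lemma frac_ge0 x : 0 <= frac x.
Proof. by rewrite subr_ge0 floor_le_tmp. Qed.

Lemma frac_lt1 x : frac x < 1.
Proof. by rewrite /Defs.frac ltrBlDl; have := floorD1_gt x; rewrite intrD. Qed.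

Lemma e2piM_frac (k : nat) x : e (k%:R * x) = e (k%:R * frac x).
Proof. by rewrite /Defs.frac !e2piMn -[in LHS](subrK (Num.floor x)%:~R x) e2piDint. Qed.

Definition dirichlet (J : nat) x : R[i] := \sum_(k < J) e (k%:R * x).

Lemma normc_dirichlet_le (J : nat) x : normc (dirichlet J x) <= J%:R.
Proof.
apply: (le_trans (ler_normc_sum _ _ _)).
by rewrite (eq_bigr (fun=> 1)) => [|k _]; rewrite ?sumr_const ?card_ord// normc_e2pi.
Qed.

(** On the arc all J + 1 phases lie in [0, 1/8] modulo 1, so there is no cancellation. Hence 4 / (J
    + 1)^2 times the squared kernel majorizes the indicator of the arc. *)
Lemma dirichlet_arc_ge (J : nat) x t : J%:R * t <= 1 / 8 -> frac x < t ->
  J.+1%:R / 2 <= normc (dirichlet J.+1 x).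
Proof.
move=> Jt xt; apply: le_trans (le_trans (ler_norm _) (Re_le_normc _)).
rewrite Re_sum (_ : _ / 2 = \sum_(k < J.+1) (1 / 2)); last first.
  by rewrite sumr_const card_ord -[RHS]mulr_natl mulrA mulr1.
apply: ler_sum => k _; rewrite e2piM_frac; apply: Re_e2pi_ge.
have f0 := frac_ge0 x.
rewrite ger0_norm ?mulr_ge0// (le_trans _ Jt)// ler_pM// ?(ltW xt)//.
by rewrite ler_nat -ltnS.
Qed.

(* [T = D^2 (1 - |e(y) - 1|^2 / |e(t) - 1|^2)] with [y = x - t] and
   [D = |dirichlet Q y|^2] is positive only on the arc, while
   [D |e(y) - 1|^2 = |e(Q y) - 1|^2] stays bounded. *)
Lemma dirichlet_arc_minorant (Q : nat) x t : 0 < t <= 1 / 2 ->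
  normc (dirichlet Q (x - t)) ^+ 4 - 4 / t ^+ 2 * normc (dirichlet Q (x - t)) ^+ 2 <=
    Q%:R ^+ 4 * (frac x < 2 * t)%R%:R.
Proof.
move=> /andP[t0 t1]; set y := x - t; set D := normc (dirichlet Q y).
have D0 : 0 <= D by exact: normc_ge0.
have s0 : 0 <= 4 / t ^+ 2 * D ^+ 2 by rewrite mulr_ge0 ?sqr_ge0// divr_ge0// sqr_ge0.
case: ltP => [_|xt].
  rewrite mulr1 (le_trans _ (_ : D ^+ 4 <= _))//; first by lra.
  by rewrite lerXn2r ?nnegrE//; exact: normc_dirichlet_le.
rewrite mulr0 subr_le0.
have /(congr1 (fun z => normc z ^+ 2)) := geometric_sum_e2pi y Q.
rewrite normcM exprMn !normc_e2pi_subr1_sqr -/D => E.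
have le4 : 4 * sin (pi * y) ^+ 2 * D ^+ 2 <= 4.
  by rewrite E; have := sin2cos2 (pi * (Q%:R * y)); have := sqr_ge0 (cos (pi * (Q%:R * y))); lra.
have siny : (t / 2) ^+ 2 <= sin (pi * y) ^+ 2.
  have -> : sin (pi * y) ^+ 2 = sin (pi * (frac x - t)) ^+ 2.
    suff : 4 * sin (pi * y) ^+ 2 = 4 * sin (pi * (frac x - t)) ^+ 2 by lra.
    rewrite -!normc_e2pi_subr1_sqr (_ : y = (frac x - t) + (Num.floor x)%:~R) ?e2piDint//.
    by rewrite /y /Defs.frac; ring.
  have f1 := frac_lt1 x.
  have h : t / 2 <= sin (pi * (frac x - t)).
    by apply: sinpi_ge_itv; [apply/andP; split; lra|lra].
  by rewrite lerXn2r ?nnegrE ?(le_trans _ h)//; rewrite divr_ge0 ?ltW.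
have D2 := sqr_ge0 D.
have tD : t ^+ 2 * D ^+ 2 <= 4.
  apply: le_trans le4; rewrite ler_wpM2r//; move: siny.
  by rewrite expr_div_n; lra.
rewrite (_ : D ^+ 4 = D ^+ 2 * D ^+ 2); last by rewrite -exprD.
apply: ler_wpM2r => //; rewrite ler_pdivlMr ?exprn_gt0// mulrC.
exact: tD.
Qed.

End ArcMajorant.

(** Sum the minorant of [dirichlet_arc_minorant] over n. With t = 4/Q the factor 4/t^2 is Q^2/4, so
    the second moment removes Q^3/4 per point from a fourth moment worth at least Q^3/2; dividing by
    Q^4 leaves 1/(4Q). The errors S and S/4 are bounded by 2 S. *)
Lemma arc_count_ge (x : nat -> R) (a b Q : nat) (S : R) : (a <= b)%N -> (8 <= Q)%N ->
    0 <= S ->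
    (forall m, (0 < m <= Q.*2)%N -> normc (\sum_(a <= n < b) e (m%:R * x n)) <= S) ->
  (b - a)%:R / (4 * Q%:R) - 2 * S <= \sum_(a <= n < b) (frac (x n) < 8 / Q%:R)%R%:R.
Proof.
move=> ab Q8 S0 hS.
have Q0 : 0 < Q%:R :> R by rewrite ltr0n (leq_trans _ Q8).
have Q8' : 8 <= Q%:R :> R by rewrite ler_nat.
pose t : R := 4 / Q%:R; pose y n := x n - t.
have t0 : 0 < t by rewrite divr_gt0.
have t1 : t <= 1 / 2 by rewrite ler_pdivrMr//; lra.
have hy m : (0 < m <= Q.*2)%N -> normc (\sum_(a <= n < b) 1%:C%C * e (m%:R * y n)) <= S.
  move=> hm; rewrite (eq_bigr (fun n => e (- (m%:R * t)) * e (m%:R * x n))).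
    by rewrite -mulr_sumr normcM normc_e2pi mul1r hS.
  by move=> n _; rewrite mul1r /y mulrBr addrC e2piD.
pose d1 (k : 'I_Q) : nat := k; pose d2 (k : 'I_Q * 'I_Q) : nat := (k.1 + k.2)%N.
have := @diagonal_sum y (fun=> 1) a b Q.*2 S hy _ d1 S0.
have := @diagonal_sum y (fun=> 1) a b Q.*2 S hy _ d2 S0.
set lo1 := (X in X -> _); set lo2 := (X in _ -> X -> _).
have d1D k : (d1 k <= Q.*2)%N by rewrite /d1; have := ltn_ord k; lia.
have d2D k : (d2 k <= Q.*2)%N by rewrite /d2; have := ltn_ord k.1; have := ltn_ord k.2; lia.
move=> /(_ d2D) + /(_ d1D).
have -> : #|[pred p : 'I_Q * 'I_Q | d1 p.1 == d1 p.2]| = Q.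
  rewrite -[RHS]card_ord -(card_imset _ (f := fun k : 'I_Q => (k, k))); last by move=> i j [].
  apply: eq_card => -[i j]; rewrite inE/=; apply/eqP/imsetP => [/val_inj->|[k _ [-> ->]]//].
  by exists j.
set r := #|_|.
(* [r] is the additive energy of {0, ..., Q - 1}: Cauchy-Schwarz over the 2Q available sums bounds
   it below by Q^4 / (2Q). *)
have rQ : Q%:R ^+ 3 / 2 <= r%:R :> R.
  pose c (m : 'I_Q.*2) : R := \sum_(p : 'I_Q * 'I_Q) (d2 p == m)%:R.
  have -> : r%:R = \sum_m c m ^+ 2.
    rewrite /r -sum1_card natr_sum big_mkcond/=.
    under [RHS]eq_bigr do rewrite expr2 mulr_suml.
    rewrite exchange_big/= -(pair_big xpredT xpredT (fun p q => if d2 p == d2 q then 1 else 0))/=.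
    apply: eq_bigr => p _.
    have hp : (d2 p < Q.*2)%N by rewrite /d2; have := ltn_ord p.1; have := ltn_ord p.2; lia.
    rewrite (bigD1 (Ordinal hp))//= eqxx mul1r [X in _ + X]big1 ?addr0.
      by rewrite /c; apply: eq_bigr => q _; rewrite eq_sym; case: eqP.
    by move=> m hm; rewrite (_ : (d2 p == m) = false) ?mul0r//; apply: contraNF hm => /eqP h; apply/eqP/val_inj.
  have := cauchy_schwarz_sum (index_enum 'I_Q.*2) xpredT c (fun=> 1).
  have -> : \sum_m c m * 1 = Q%:R ^+ 2.
    under eq_bigr do rewrite mulr1; rewrite exchange_big/=.
    rewrite (eq_bigr (fun=> 1)) ?sumr_const ?card_prod ?card_ord ?natrM ?expr2//= => p _.
    have hp : (d2 p < Q.*2)%N by rewrite /d2; have := ltn_ord p.1; have := ltn_ord p.2; lia.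
    rewrite (bigD1 (Ordinal hp))//= eqxx big1 ?addr0//.
    by move=> m hm; rewrite (_ : (d2 p == m) = false)//; apply: contraNF hm => /eqP h; apply/eqP/val_inj.
  rewrite (_ : \sum_(m < Q.*2) 1 ^+ 2 = 2 * Q%:R); last first.
    by under eq_bigr do rewrite expr1n; rewrite sumr_const card_ord -muln2 natrM mulrC.
  set s := \sum_m _ => h.
  rewrite ler_pdivrMr// -(ler_pM2r Q0) -[leRHS]mulrA; apply: le_trans h.
  by rewrite -exprM -exprSr.
rewrite card_prod !card_ord natrM.
rewrite (_ : \sum_(a <= n < b) 1 = (b - a)%:R); last by rewrite sumr_const_nat.
rewrite !ler_norml => /andP[h2 _] /andP[_ h1].
set L : R := (b - a)%:R in h1 h2 *.
have L0 : 0 <= L by rewrite ler0n.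
have minor n : normc (dirichlet Q (y n)) ^+ 4 - 4 / t ^+ 2 * normc (dirichlet Q (y n)) ^+ 2 <=
    Q%:R ^+ 4 * (frac (x n) < 8 / Q%:R)%R%:R.
  have := @dirichlet_arc_minorant Q (x n) t; rewrite t0 t1 => /(_ isT).
  by rewrite (_ : 2 * t = 8 / Q%:R)// /t; field; rewrite gt_eqF.
have : \sum_(a <= n < b) (normc (dirichlet Q (y n)) ^+ 4 - 4 / t ^+ 2 * normc (dirichlet Q (y n)) ^+ 2) <=
    Q%:R ^+ 4 * \sum_(a <= n < b) (frac (x n) < 8 / Q%:R)%R%:R.
  by rewrite mulr_sumr; apply: ler_sum => n _; exact: minor.
rewrite sumrB -mulr_sumr.
have e1 : \sum_(a <= n < b) normc (dirichlet Q (y n)) ^+ 2 =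
   \sum_(a <= n < b) 1 * normc (\sum_i e ((d1 i)%:R * y n)) ^+ 2.
  by apply: eq_bigr => n _; rewrite mul1r.
have e2 : \sum_(a <= n < b) normc (dirichlet Q (y n)) ^+ 4 =
   \sum_(a <= n < b) 1 * normc (\sum_i e ((d2 i)%:R * y n)) ^+ 2.
  apply: eq_bigr => n _; rewrite mul1r (exprM _ 2 2).
  congr (_ ^+ 2); rewrite expr2 -normcM /dirichlet mulr_suml; congr (normc _).
  rewrite -(pair_big xpredT xpredT (fun i j : 'I_Q => e ((d2 (i, j))%:R * y n)))/=.
  apply: eq_bigr => i _; rewrite mulr_sumr; apply: eq_bigr => j _.
  by rewrite -e2piD -mulrDl /d2 natrD.
rewrite e1 e2 => h3.
set Z := \sum_(a <= n < b) _ in h3 *.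
rewrite -(ler_pM2l (_ : 0 < Q%:R ^+ 4 :> R)) ?exprn_gt0//.
apply: le_trans h3.
have tq : 4 / t ^+ 2 = Q%:R ^+ 2 / 4 by rewrite /t; field; rewrite gt_eqF.
rewrite tq.
have rL : Q%:R ^+ 3 / 2 * L <= r%:R * L by rewrite ler_wpM2r.
set q : R := Q%:R in h1 h2 tq rL Q0 Q8' *.
have q2 : 0 <= q ^+ 2 by rewrite sqr_ge0.
have h1' := ler_wpM2l (divr_ge0 q2 (ler0n _ 4)) h1.
have -> : q ^+ 4 * (L / (4 * q) - 2 * S) = q ^+ 3 / 2 * L - (q * q) ^+ 2 * S - q ^+ 2 / 4 * (q ^+ 2 * S + q * L) - 3 / 4 * q ^+ 4 * S.
  by field; rewrite gt_eqF.
have q4 : 0 <= q ^+ 4 * S by rewrite mulr_ge0// exprn_ge0// ltW.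
pose A1 : R := \sum_(a <= n < b) 1 * normc (\sum_i e ((d2 i)%:R * y n)) ^+ 2.
pose A2 : R := \sum_(a <= n < b) 1 * normc (\sum_i e ((d1 i)%:R * y n)) ^+ 2.
have h2' : - ((q * q) ^+ 2 * S) <= A1 - r%:R * L := h2.
have h1'' : q ^+ 2 / 4 * (A2 - q * L) <= q ^+ 2 / 4 * (q ^+ 2 * S) := h1'.
suff : q ^+ 3 / 2 * L - (q * q) ^+ 2 * S - q ^+ 2 / 4 * (q ^+ 2 * S + q * L) -
  3 / 4 * q ^+ 4 * S <= A1 - q ^+ 2 / 4 * A2 by [].
clearbody A1 A2; lra.
Qed.

End Sieve.

(** * Dual sums and level sets *)

Section DualSums.
Variable R : realType.
Local Notation e := (@e2pi R).
Local Notation frac := (@Defs.frac R).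

Section Dual.
Variables (M : nat) (u : 'I_M -> R[i]).
Hypothesis M0 : (0 < M)%N.
Hypothesis u1 : forall j, normc (u j) <= 1.
Let U : R := \sum_j normc (u j).

(** The adjoint of the map that sends coefficients to values on the grid [j / M]. *)
Definition dual_sum (n : nat) : R[i] := \sum_j u j * e (n%:R * (j%:R / M%:R)).
Local Notation G := dual_sum.

Let U0 : 0 <= U. Proof. by apply: sumr_ge0 => j _; exact: normc_ge0. Qed.

Lemma normc_dual_sum_le n : normc (G n) <= U.
Proof.
apply: (le_trans (ler_normc_sum _ _ _)).
by apply: ler_sum => j _; rewrite normcM normc_e2pi mulr1.
Qed.

Let expand (a b : nat) (y : nat -> R) :
  \sum_(a <= n < b) (normc (G n) ^+ 2)%:C%C * e (y n) =
  \sum_j \sum_k (u j * (u k)^*%C) *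
     \sum_(a <= n < b) e (y n + n%:R * ((j%:R - k%:R) / M%:R)).
Proof.
under eq_bigr do rewrite normc_sqr_sum mulr_suml.
rewrite exchange_big; apply: eq_bigr => j _.
under eq_bigr do rewrite mulr_suml.
rewrite exchange_big; apply: eq_bigr => k _.
rewrite mulr_sumr; apply: eq_bigr => n _.
rewrite conjcM e2piD [in RHS]mulrBl mulrBr e2piD e2piN.
by ring.
Qed.

(** Over M consecutive integers the characters are orthogonal, which gives exactly M times the sum
    of |u_j|^2; then |u_j|^2 <= |u_j|. *)
Lemma bessel (a b : nat) : (b - a <= M)%N ->
  \sum_(a <= n < b) normc (G n) ^+ 2 <= M%:R * U.
Proof.
move=> bM; apply: (@le_trans _ _ (\sum_(a <= n < a + M) normc (G n) ^+ 2)).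
  have [ab|ba] := leqP a b; last first.
    by rewrite (big_geq (ltnW ba)) sumr_ge0// => n _; exact: sqr_ge0.
  rewrite [leRHS](big_cat_nat ab) ?lerDl ?sumr_ge0//=; last by lia.
  by move=> n _; exact: sqr_ge0.
have E : \sum_(a <= n < a + M) normc (G n) ^+ 2 = M%:R * \sum_j normc (u j) ^+ 2.
  apply: complexI; rewrite realc_sum.
  have := expand a (a + M) (fun=> 0).
  under eq_bigr do rewrite e2pi0 mulr1.
  move=> ->; rewrite realcM realc_sum mulr_sumr; apply: eq_bigr => j _.
  rewrite (bigD1 j)//= [X in _ + X]big1 ?addr0.
    under eq_bigr do rewrite add0r.
    by rewrite sum_roots_of_unity_shift ?ltn_ord// eqxx mul_conjc_normc mulrC rmorph_nat.
  move=> k kj; under eq_bigr do rewrite add0r.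
  rewrite sum_roots_of_unity_shift ?ltn_ord//.
  by rewrite (_ : (j == k :> nat) = false) ?mulr0// eq_sym; apply/negbTE.
rewrite E ler_wpM2l// ler_sum// => j _.
by rewrite expr2 ler_piMr ?normc_ge0.
Qed.

(** Expanding |G|^2 produces linear phases n (j - k) / M. Uniformity of the hypothesis in [xi]
    absorbs them, and the coefficients u_j conj(u_k) add up to at most U^2. *)
Lemma dual_sum_phase (a b m : nat) (x : nat -> R) (S : R) :
    (forall xi, normc (\sum_(a <= n < b) e (m%:R * x n + n%:R * xi)) <= S) ->
  normc (\sum_(a <= n < b) (normc (G n) ^+ 2)%:C%C * e (m%:R * x n)) <= U ^+ 2 * S.
Proof.
move=> hS; rewrite (expand a b (fun n => m%:R * x n)).
rewrite /U expr2 !mulr_suml; apply: (le_trans (ler_normc_sum _ _ _)).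
apply: ler_sum => j _; rewrite mulr_sumr mulr_suml; apply: (le_trans (ler_normc_sum _ _ _)).
apply: ler_sum => k _; rewrite !normcM normc_conj ler_wpM2l//.
by rewrite mulr_ge0// normc_ge0.
Qed.

Lemma dual_sum_block (B : pred nat) (x : nat -> R) (a b : nat) (t S : R) :
    0 < t <= 1 / 2 -> 0 <= S ->
    (forall n, (a <= n < b)%N -> B n -> frac (x n) < t) ->
    (forall (m : nat) xi, (0 < m)%N -> m%:R * t <= 1 ->
       normc (\sum_(a <= n < b) e (m%:R * x n + n%:R * xi)) <= S) ->
  \sum_(a <= n < b | B n) normc (G n) ^+ 2 <=
    32 * t * \sum_(a <= n < b) normc (G n) ^+ 2 + 4 * U ^+ 2 * S.
Proof.
move=> /andP[t0 t1] S0 hB hS.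
(* Largest J with J t <= 1/8, as [dirichlet_arc_ge] requires. Conversely 1 <= 8 t (J + 1), so the
   diagonal factor 4 / (J + 1) is at most 32 t. *)
pose J := Num.truncn (1 / (8 * t)).
have t8 : 0 < 8 * t by rewrite mulr_gt0.
have Jl : J%:R * t <= 1 / 8.
  have : J%:R <= 1 / (8 * t) by have := @truncn_le R (1 / (8 * t)); rewrite divr_ge0// ltW.
  by rewrite ler_pdivlMr//; lra.
have Ju : 1 <= 8 * t * J.+1%:R.
  have : 1 / (8 * t) < J.+1%:R by rewrite truncnS_gt.
  by rewrite ltr_pdivrMr//; lra.
have J0 : 0 < J.+1%:R :> R by rewrite ltr0n.
pose P n := normc (dirichlet J.+1 (x n)).
have major : \sum_(a <= n < b | B n) normc (G n) ^+ 2 <=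
    4 / J.+1%:R ^+ 2 * \sum_(a <= n < b) normc (G n) ^+ 2 * P n ^+ 2.
  rewrite mulr_sumr big_mkcond big_nat [leRHS]big_nat; apply: ler_sum => n hn.
  have z0 := sqr_ge0 (normc (G n)); have P0 := sqr_ge0 (P n).
  case: ifPn => [Bn|_]; last by apply: mulr_ge0; [rewrite divr_ge0// sqr_ge0|exact: mulr_ge0].
  rewrite mulrCA ler_peMr// mulrAC ler_pdivlMr ?exprn_gt0// mul1r.
  have := @dirichlet_arc_ge R J (x n) t Jl (hB n hn Bn).
  by rewrite -/(P n) => h; nra.
apply: (le_trans major).
have zS m : (0 < m <= J)%N ->
    normc (\sum_(a <= n < b) (normc (G n) ^+ 2)%:C%C * e (m%:R * x n)) <= U ^+ 2 * S.
  move=> /andP[m0 mJ]; apply: dual_sum_phase => xi; apply: hS => //.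
  apply: (@le_trans _ _ (J%:R * t)); last by lra.
  by rewrite ler_wpM2r ?ler_nat// ltW.
have US0 : 0 <= U ^+ 2 * S by rewrite mulr_ge0// sqr_ge0.
have := @diagonal_sum R x (fun n => normc (G n) ^+ 2) a b J _ zS _ (fun k : 'I_J.+1 => k : nat) US0.
move=> /(_ (fun i => ltn_ord i : (i <= J)%N)); rewrite ler_norml => /andP[_].
have -> : #|[pred p : 'I_J.+1 * 'I_J.+1 | (p.1 : nat) == p.2]| = J.+1.
  rewrite -[RHS]card_ord -(card_imset _ (f := fun k : 'I_J.+1 => (k, k))); last by move=> i j [].
  apply: eq_card => -[i j]; rewrite inE/=; apply/eqP/imsetP => [/val_inj->|[k _ [-> ->]]//].
  by exists j.
rewrite card_ord -/(dirichlet _ _).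
set Z := \sum_(a <= n < b) normc (G n) ^+ 2.
set T := \sum_(a <= n < b) _ * P n ^+ 2.
have Z0 : 0 <= Z by apply: sumr_ge0 => n _; exact: sqr_ge0.
move=> h; have {h} h : T - J.+1%:R * Z <= J.+1%:R ^+ 2 * (U ^+ 2 * S) := h.
set q : R := J.+1%:R in Ju J0 h *.
rewrite mulrAC ler_pdivrMr ?exprn_gt0//.
have : q * Z * 1 <= q * Z * (8 * t * q) by rewrite ler_wpM2l// mulr_ge0// ltW.
by nra.
Qed.

End Dual.
End DualSums.

Section PowR.
Variable R : realType.
Implicit Types a r : R.

Lemma powR_gt1 a r : 1 < a -> 0 < r -> 1 < a `^ r.
Proof.
move=> a1 r0; have := @gt0_ltr_powR R r r0 1 a; rewrite powR1; apply; rewrite ?nnegrE//.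
by rewrite ltW// (lt_trans ltr01).
Qed.

End PowR.

(** * Level set estimate on the grid by summation over dyadic blocks *)

Section Restriction.
Variable R : realType.
Local Notation e := (@e2pi R).
Local Notation frac := (@Defs.frac R).

Variables (B : pred nat) (x W P : nat -> R) (n0 : nat).
Variables (K S0 sigma beta rho : R).
Hypothesis n00 : (0 < n0)%N.
Hypothesis K0 : 0 < K.
Hypothesis S00 : 0 <= S0.
Hypothesis sigma0 : 0 < sigma.
Hypothesis beta01 : 0 < beta <= 1.
Hypothesis rho01 : 0 < rho < 1.
Hypothesis W0 : forall n, (n0 <= n)%N -> 0 < W n.
(** In the application [W] is phi2 on the integers and beta lies slightly below 1/c2. Then W n
    n^(-beta) gains a fixed factor at each doubling, so the last dyadic block dominates the sum of
    all of them. *)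
Hypothesis W_doubling : forall m n, (n0 <= m)%N -> (m.*2 <= n)%N ->
  W m * m%:R `^ (- beta) <= rho * (W n * n%:R `^ (- beta)).
Hypothesis W_mono : forall m n, (n0 <= m)%N -> (m <= n)%N -> W m <= W n.
Hypothesis P_range : forall n, (n0 <= n)%N -> 0 < P n <= 1 / 2.
Hypothesis P_le : forall n, (n0 <= n)%N -> P n <= K * W n / n%:R.
Hypothesis B_arc : forall X n, (n0 <= X)%N -> (X <= n <= X.*2)%N -> B n -> frac (x n) < P X.
Hypothesis exp_sum : forall X a b m xi, (n0 <= X)%N -> (X <= a)%N -> (b <= X.*2)%N ->
  (0 < m)%N -> m%:R * P X <= 1 ->
  normc (\sum_(a <= n < b) e (m%:R * x n + n%:R * xi)) <= S0 * X%:R `^ sigma.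

Section DualBound.
Variables (M : nat) (u : 'I_M -> R[i]).
Hypothesis M0 : (0 < M)%N.
Hypothesis u1 : forall j, normc (u j) <= 1.
Let U : R := \sum_j normc (u j).
Hypothesis U0 : 0 < U.
Local Notation G := (dual_sum u).
Let A := (U / M%:R) `^ (- beta).
Let V n := W n * n%:R `^ (- beta).

(** These constants close the halving recursion of [dual_sum_le]: C1 rho + 128 K = C1 and C2
    2^(-sigma) + 4 S0 <= C2. The first entry of the maximum covers n <= 2 n0 + 1 trivially. *)
Let C1 := 128 * K / (1 - rho).
Let C2 := Num.max (n0.*2.+1%:R) (4 * S0 / (1 - 2 `^ (- sigma))).

Let MR : 0 < M%:R :> R. Proof. by rewrite ltr0n. Qed.

(* [min(M U, X U^2) = X U^2 min(1, M / (X U))] is at most the geometric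
   interpolation [X U^2 (X U / M)^(-beta)]. *)
Let main_block X n : (n0 <= X)%N -> (X <= n <= X.*2)%N -> (n <= M)%N ->
  32 * P X * \sum_(X <= k < n.+1) normc (G k) ^+ 2 <= 128 * K * U ^+ 2 * (V n * A).
Proof.
move=> nX /andP[Xn nX2] nM.
have X0 : (0 < X)%N by exact: leq_trans nX.
have XR : 0 < X%:R :> R by rewrite ltr0n.
have /andP[b0 b1] := beta01.
set Z := \sum_(X <= k < n.+1) _.
have Z0 : 0 <= Z by apply: sumr_ge0 => k _; exact: sqr_ge0.
have Z1 : Z <= M%:R * U by apply: bessel => //; clear -nM X0; lia.
have Z2 : Z <= 2 * X%:R * U ^+ 2.
  apply: (@le_trans _ _ (\sum_(X <= k < n.+1) U ^+ 2)).
    by apply: ler_sum => k _; rewrite lerXn2r ?nnegrE ?normc_ge0 ?normc_dual_sum_le ?(ltW U0).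
  rewrite sumr_const_nat -[leLHS]mulr_natl ler_wpM2r ?sqr_ge0//.
  by rewrite -natrM ler_nat; clear -Xn nX2 X0; lia.
pose r := X%:R * (U / M%:R).
have r0 : 0 < r by rewrite mulr_gt0// divr_gt0.
have Z3 : Z <= 2 * X%:R * U ^+ 2 * r `^ (- beta).
  have [r1|r1] := leP r 1.
    have rb : 1 <= r `^ (- beta).
      rewrite powRN -invr1 lef_pV2 ?posrE ?powR_gt0// -[leRHS](powRr0 r).
      by rewrite ger_powR ?r0 ?r1// ltW.
    by apply: (le_trans Z2); rewrite ler_peMr// mulr_ge0 ?sqr_ge0// mulr_ge0// ltW.
  apply: (le_trans Z1); apply: (@le_trans _ _ (2 * X%:R * U ^+ 2 * r `^ (- 1))).
    rewrite powR_inv1 ?(ltW r0)// /r.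
    rewrite (_ : 2 * X%:R * U ^+ 2 * (X%:R * (U / M%:R))^-1 = 2 * (M%:R * U)); last first.
      by field; rewrite !gt_eqF.
    have : 0 <= M%:R * U by rewrite mulr_ge0// ltW.
    by lra.
  apply: ler_wpM2l; first by rewrite mulr_ge0 ?sqr_ge0// mulr_ge0// ltW.
  by rewrite ler_powR ?lerN2// ltW.
have WX0 := W0 nX.
have Vn : W X * X%:R `^ (- beta) <= 2 * V n.
  rewrite /V mulrCA ler_pM ?powR_ge0 ?(ltW WX0)//; first exact: W_mono.
  have n0' : 0 < n%:R :> R by rewrite ltr0n (leq_trans _ Xn).
  rewrite !powRN -[2]invrK -invfM lef_pV2 ?posrE ?mulr_gt0 ?invr_gt0 ?powR_gt0//.
  apply: (@le_trans _ _ (2^-1 `^ beta * n%:R `^ beta)).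
    by apply: ler_wpM2r; [exact: powR_ge0|apply: ger1_powR => //; apply/andP; split; lra].
  rewrite -powRM// ?invr_ge0// ge0_ler_powR ?nnegrE ?mulr_ge0 ?invr_ge0// ?(ltW b0)//.
  by rewrite mulrC ler_pdivrMr// -natrM ler_nat; clear -nX2; lia.
have rA : r `^ (- beta) = X%:R `^ (- beta) * A by rewrite /r powRM// divr_ge0// ltW.
apply: (@le_trans _ _ (32 * (K * W X / X%:R) * (2 * X%:R * U ^+ 2 * r `^ (- beta)))).
  apply: ler_pM => //; first by rewrite mulr_ge0// ltW// (andP (P_range nX)).1.
  by rewrite ler_wpM2l// P_le.
rewrite rA (_ : 32 * _ * _ = 64 * K * U ^+ 2 * A * (W X * X%:R `^ (- beta))); last first.
  by field; rewrite gt_eqF.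
rewrite (_ : 128 * _ * _ * _ = 64 * K * U ^+ 2 * A * (2 * V n)); last by ring.
by rewrite ler_wpM2l// !mulr_ge0 ?sqr_ge0 ?powR_ge0// ltW.
Qed.

(** Induction by halving: the range up to n/2 has main term smaller by [rho] and error term smaller
    by 2^(-sigma), which leaves room for the single block above n/2. *)
Lemma dual_sum_le n : (0 < n)%N -> (n <= M)%N ->
  \sum_(1 <= k < n.+1 | B k) normc (G k) ^+ 2 <=
    U ^+ 2 * (C1 * (if (n0 <= n)%N then V n * A else 0) + C2 * n%:R `^ sigma).
Proof.
have rh : 0 < 1 - rho by rewrite subr_gt0; case/andP: rho01.
have s2 : 0 < 1 - 2 `^ (- sigma) :> R.
  by rewrite subr_gt0 powRN invf_lt1 ?powR_gt0// powR_gt1// ltr1n.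
have C1E : C1 * rho + 128 * K = C1 by rewrite /C1; field; rewrite gt_eqF.
have C10 : 0 <= C1 by rewrite /C1 divr_ge0 ?mulr_ge0// ltW.
have C2n : n0.*2.+1%:R <= C2 by rewrite le_max lexx.
have C2s : C2 * 2 `^ (- sigma) + 4 * S0 <= C2.
  have : 4 * S0 / (1 - 2 `^ (- sigma)) <= C2 by rewrite le_max lexx orbT.
  by rewrite ler_pdivrMr//; lra.
have C20 : 0 <= C2 by apply: le_trans C2n; rewrite ler0n.
have A0 : 0 <= A by exact: powR_ge0.
have U2 := sqr_ge0 U.
elim/ltn_ind: n => n IH n_gt0 nM.
have nR : 1 <= n%:R :> R by rewrite ler1n.
have [nn|nn] := leqP n n0.*2.+1.
  apply: (@le_trans _ _ (\sum_(1 <= k < n.+1) U ^+ 2)).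
    rewrite big_mkcond/=; apply: ler_sum => k _; case: ifP => _ //.
    by rewrite lerXn2r ?nnegrE ?normc_ge0 ?normc_dual_sum_le ?(ltW U0).
  rewrite sumr_const_nat subn1 -[leLHS]mulr_natr ler_wpM2l//.
  apply: ler_wpDl.
    by rewrite mulr_ge0//; case: ifP => // h; rewrite !mulr_ge0 ?powR_ge0// ltW// W0.
  apply: (@le_trans _ _ C2); first by rewrite (le_trans _ C2n)// ler_nat.
  by rewrite ler_peMr// -[leLHS](powRr0 n%:R) ler_powR// ltW.
have n0n : (n0 <= n)%N by clear -nn; lia.
(* The upper block starts at X = N1 + 1, so that n + 1 <= 2 X for both parities of n and the block
   fits the hypotheses on [X, 2 X]. *)
rewrite n0n; set N1 := n./2.
have n2 := odd_double_half n; rewrite -/N1 in n2.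
have N1n : (N1.*2 <= n <= N1.*2.+1)%N by rewrite -n2; clear; case: (odd n); lia.
have N10 : (n0 <= N1)%N by clear -N1n nn; lia.
have := IH N1; rewrite N10 => /(_ _ _ _) IH1.
have {IH1}IH1 : \sum_(1 <= k < N1.+1 | B k) normc (G k) ^+ 2 <=
   U ^+ 2 * (C1 * (V N1 * A) + C2 * N1%:R `^ sigma) by apply: IH1; clear -N1n N10 n00 nM n_gt0; lia.
rewrite (@big_cat_nat _ _ _ N1.+1)//=; last by clear -N1n N10 n00; lia.
have hX : (N1.+1 <= n <= N1.+1.*2)%N by clear -N1n N10 n00; lia.
have nX : (n0 <= N1.+1)%N by clear -N10; lia.
have hX2 : (n.+1 <= N1.+1.*2)%N by clear -N1n; lia.
have blk : \sum_(N1.+1 <= k < n.+1 | B k) normc (G k) ^+ 2 <=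
    32 * P N1.+1 * \sum_(N1.+1 <= k < n.+1) normc (G k) ^+ 2 + 4 * U ^+ 2 * (S0 * N1.+1%:R `^ sigma).
  apply: (@dual_sum_block _ _ u B x).
  - exact: P_range.
  - by rewrite mulr_ge0// powR_ge0.
  - by move=> k /andP[k1 k2]; apply: B_arc => //; rewrite k1 (leq_trans _ hX2)// ltnW.
  - by move=> m xi m0 mP; apply: exp_sum.
have blk2 := main_block nX hX nM.
have vr : V N1 * A <= rho * (V n * A).
  by rewrite mulrA ler_wpM2r//; apply: W_doubling => //; case/andP: N1n.
have sg : N1%:R `^ sigma <= 2 `^ (- sigma) * n%:R `^ sigma.
  rewrite powRN mulrC ler_pdivlMr ?powR_gt0// -powRM//.
  rewrite ge0_ler_powR ?nnegrE ?mulr_ge0 ?(ltW sigma0)//.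
  by rewrite -natrM ler_nat; clear -N1n; lia.
have sg2 : N1.+1%:R `^ sigma <= n%:R `^ sigma.
  by rewrite ge0_ler_powR ?nnegrE ?(ltW sigma0)// ler_nat; case/andP: hX.
apply: (le_trans (lerD IH1 blk)).
apply: (@le_trans _ _ (U ^+ 2 * (C1 * (rho * (V n * A)) + C2 * (2 `^ (- sigma) * n%:R `^ sigma)) +
  (128 * K * U ^+ 2 * (V n * A) + 4 * U ^+ 2 * (S0 * n%:R `^ sigma)))).
  apply: lerD; first by rewrite ler_wpM2l// lerD// ler_wpM2l.
  by apply: lerD => //; apply: ler_wpM2l; [rewrite mulr_ge0|exact: ler_wpM2l].
have p0 : 0 <= n%:R `^ sigma :> R by exact: powR_ge0.
have := ler_wpM2r p0 C2s; move: C1E p0.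
move: (V n * A) (n%:R `^ sigma) (2 `^ (- sigma)) => v p q C1E p0 C2q.
rewrite (_ : _ + _ = U ^+ 2 * ((C1 * rho + 128 * K) * v + (C2 * q + 4 * S0) * p)); last by ring.
by rewrite C1E ler_wpM2l// lerD2l.
Qed.

End DualBound.

Let C1 := 128 * K / (1 - rho).
Let C2 := Num.max (n0.*2.+1%:R) (4 * S0 / (1 - 2 `^ (- sigma))).

Section Level.
Variables (N : nat) (c : nat -> R[i]).
Hypothesis N0 : (n0 <= N)%N.
Hypothesis c1 : forall n, normc (c n) <= 1.
Let b : R := \sum_(1 <= n < N.+1 | B n) 1.
Let F (j : 'I_N) : R[i] := \sum_(1 <= n < N.+1 | B n) c n * e (n%:R * (j%:R / N%:R)).

Lemma level_set_le (lambda : R) : 0 < lambda ->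
  let E := [pred j | lambda < normc (F j)] in
  (0 < #|E|)%N ->
  lambda ^+ 2 <= b * (C1 * (W N * #|E|%:R `^ (- beta)) + C2 * N%:R `^ sigma).
Proof.
move=> l0 E E0.
have NN : (0 < N)%N by exact: leq_trans N0.
have NR : 0 < N%:R :> R by rewrite ltr0n.
have ER : 0 < #|E|%:R :> R by rewrite ltr0n.
(* On the level set u_j is the conjugate phase of F_j, so that pairing with F gives the sum of |F_j|
   over E, at least lambda |E|. *)
pose u (j : 'I_N) : R[i] := if E j then (F j)^*%C / (normc (F j))%:C%C else 0.
have Fj j : E j -> 0 < normc (F j) by move=> /(lt_trans l0).
have uE j : normc (u j) = (E j)%:R.
  rewrite /u; case: ifP => [Ej|_]; last exact: normc0.
  by rewrite normcM normcV normc_conj normc_real ger0_norm ?normc_ge0// divff// gt_eqF ?Fj.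
have u1 j : normc (u j) <= 1 by rewrite uE lern1 leq_b1.
have UE : \sum_j normc (u j) = #|E|%:R.
  under eq_bigr do rewrite uE.
  rewrite -sum1_card natr_sum [RHS]big_mkcond/=; apply: eq_bigr => j _.
  by rewrite inE; case: (_ < _).
have UP : 0 < \sum_j normc (u j) by rewrite UE.
have := @dual_sum_le N u NN u1 UP N NN (leqnn _); rewrite UE N0 -/C1 -/C2 => dual.
have low : lambda * #|E|%:R <= \sum_(1 <= n < N.+1 | B n) normc (dual_sum u n).
  apply: (@le_trans _ _ (normc (\sum_j u j * F j))); last first.
    under eq_bigr do rewrite mulr_sumr.
    rewrite exchange_big/=; apply: (le_trans (ler_normc_sum _ _ _)).
    apply: ler_sum => n _.
    rewrite (_ : \sum_j _ = c n * dual_sum u n); last first.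
      by rewrite mulr_sumr; apply: eq_bigr => j _; rewrite mulrCA.
    by rewrite normcM ler_piMl ?normc_ge0.
  have -> : \sum_j u j * F j = (\sum_j (E j)%:R * normc (F j))%:C%C.
    rewrite realc_sum; apply: eq_bigr => j _; rewrite /u.
    case: ifP => Ej; last by rewrite !mul0r.
    rewrite mul1r mulrAC (mulrC (_^*%C)) mul_conjc_normc expr2 realcM mulfK//.
    by apply/eqP => /(congr1 (@complex.Re R))/= /eqP; rewrite gt_eqF// Fj.
  rewrite normc_real ger0_norm; last first.
    by apply: sumr_ge0 => j _; rewrite mulr_ge0 ?normc_ge0// ler0n.
  rewrite -UE mulr_sumr; apply: ler_sum => j _; rewrite uE.
  by case Ej: (E j); rewrite ?mulr0 ?mul0r// mulr1 mul1r ltW.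
have cs := cauchy_schwarz_sum (index_iota 1 N.+1) B (fun=> 1) (fun n => normc (dual_sum u n)).
have {}cs : (lambda * #|E|%:R) ^+ 2 <= b * \sum_(1 <= n < N.+1 | B n) normc (dual_sum u n) ^+ 2.
  apply: le_trans (le_trans cs _); last by under eq_bigr do rewrite expr1n.
  under eq_bigr do rewrite mul1r.
  by rewrite lerXn2r ?nnegrE ?sumr_ge0 ?mulr_ge0 ?(ltW l0)// => n _; exact: normc_ge0.
have b0 : 0 <= b by apply: sumr_ge0.
rewrite -(ler_pM2r (exprn_gt0 2 ER)) -exprMn (le_trans cs)//.
rewrite -mulrA ler_wpM2l//.
apply: (le_trans dual); rewrite mulrC le_eqVlt; apply/orP; left; apply/eqP.
congr (_ * _ ^+ 2); congr (_ * _ + _).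
(* Here n = M = N, so the powers of N in [V N] and in (|E| / N)^(-beta) cancel and leave
   |E|^(-beta). *)
rewrite -mulrA -powRM ?divr_ge0 ?(ltW NR) ?(ltW ER)//.
by congr (_ * _ `^ _); field; rewrite gt_eqF.
Qed.

End Level.
End Restriction.

(** * From level sets to moments on the grid *)

Section GridMoments.
Variable R : realType.
Local Notation e := (@e2pi R).

(** The frequencies 1, ..., N are a complete residue system modulo N, hence orthogonal on the
    grid. *)
Lemma grid_parseval (B : pred nat) (N : nat) (c : nat -> R[i]) :
  \sum_(j < N) normc (\sum_(1 <= n < N.+1 | B n) c n * e (n%:R * (j%:R / N%:R))) ^+ 2 =
  N%:R * \sum_(1 <= n < N.+1 | B n) normc (c n) ^+ 2.
Proof.
have [->|N0] := posnP N; first by rewrite big_ord0 mul0r.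
pose g (i : 'I_N) := if B i.+1 then c i.+1 else 0.
have F j : \sum_(1 <= n < N.+1 | B n) c n * e (n%:R * (j%:R / N%:R)) =
    \sum_(i < N) g i * e (i.+1%:R * (j%:R / N%:R)).
  rewrite big_mkcond big_add1/= big_mkord; apply: eq_bigr => i _.
  by rewrite /g; case: ifP; rewrite ?mul0r.
under eq_bigr do rewrite F.
have -> : \sum_(1 <= n < N.+1 | B n) normc (c n) ^+ 2 = \sum_(i < N) normc (g i) ^+ 2.
  rewrite big_mkcond big_add1/= big_mkord; apply: eq_bigr => i _.
  by rewrite /g; case: ifP; rewrite // normc0 expr0n.
apply: complexI; rewrite realc_sum realcM realc_sum.
under eq_bigr do rewrite normc_sqr_sum.
rewrite exchange_big mulr_sumr; apply: eq_bigr => i _; rewrite exchange_big.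
have E k : \sum_(j < N) g i * e (i.+1%:R * (j%:R / N%:R)) * (g k * e (k.+1%:R * (j%:R / N%:R)))^*%C =
   g i * (g k)^*%C * (if (i : nat) == k then N%:R else 0).
  rewrite -(@sum_roots_of_unity R N i k)// mulr_sumr; apply: eq_bigr => j _.
  rewrite conjcM -e2piN.
  rewrite (_ : j%:R * ((i%:R - k%:R) / N%:R) = i.+1%:R * (j%:R / N%:R) + - (k.+1%:R * (j%:R / N%:R))); last first.
    by rewrite -!natr1; ring.
  by rewrite e2piD; ring.
under eq_bigr do rewrite E.
rewrite (bigD1 i)//= eqxx [X in _ + X]big1 ?addr0.
  by rewrite mul_conjc_normc mulrC rmorph_nat.
by move=> k ki; rewrite eq_sym (_ : (k == i :> nat) = false) ?mulr0//; apply/negbTE.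
Qed.

Lemma powR_expn (a p : R) (i : nat) : 0 <= a -> (a ^+ i) `^ p = (a `^ p) ^+ i.
Proof. by move=> a0; rewrite -powR_mulrn// powRAC powR_mulrn// powR_ge0. Qed.

Lemma geometric_sum_le (r : R) (n : nat) : 0 <= r < 1 -> \sum_(i < n) r ^+ i <= 1 / (1 - r).
Proof.
move=> /andP[r0 r1]; have h : 0 < 1 - r by rewrite subr_gt0.
rewrite ler_pdivlMr// mulrC -opprB mulNr -subrX1 opprB.
by rewrite lerBlDl lerDr exprn_ge0.
Qed.

(** If v lies in (2^(-i-1), 2^(-i)], the i-th term alone dominates v^p; a value below all I levels
    is covered by the remainder. *)
Let layer_cake (p v : R) (I : nat) : 0 <= p -> 0 <= v <= 1 ->
  v `^ p <= \sum_(i < I) (2 `^ (- p)) ^+ i * ((1 / 2) ^+ i.+1 < v)%R%:R + (2 `^ (- p)) ^+ I.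
Proof.
move=> p0 /andP[v0 v1]; have y0 : 0 <= 2 `^ (- p) :> R by exact: powR_ge0.
have vp : v `^ p <= 1.
  by have := @ge0_ler_powR R p p0 v 1; rewrite powR1 !nnegrE ler01 v0 => /(_ isT isT v1).
have hp : 2 `^ (- p) = (1 / 2) `^ p :> R by rewrite div1r -(@powR_inv1 _ 2)// -powRrM mulN1r.
have s0 I' : 0 <= \sum_(i < I') (2 `^ (- p)) ^+ i * ((1 / 2) ^+ i.+1 < v)%R%:R :> R.
  by apply: sumr_ge0 => i _; rewrite mulr_ge0 ?exprn_ge0.
elim: I => [|I IH]; first by rewrite big_ord0 add0r expr0.
rewrite big_ord_recr/=; case: ltP => [h|h].
  by rewrite mulr1 (le_trans IH)// lerDl exprn_ge0.
rewrite mulr0 addr0; apply: ler_wpDl; first exact: s0.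
rewrite hp -powR_expn; last by lra.
by rewrite ge0_ler_powR ?nnegrE// exprn_ge0//; lra.
Qed.

(** Values up to L are charged to the second moment, larger ones to the dyadic layers. At level i
    the ratio b / lambda is at most 2^(i+1), so the layers form a geometric series of ratio 2^(q -
    p) < 1. *)
Lemma moment_of_level_sets (N : nat) (f : 'I_N -> R) (b L D p q : R) :
    (0 < N)%N -> 2 < p -> 0 < q < p -> 0 < b -> 0 <= L -> 0 <= D ->
    (forall j, 0 <= f j <= b) ->
    \sum_j f j ^+ 2 <= N%:R * b ->
    (forall lambda, 0 < lambda -> L <= lambda ->
       #|[pred j | lambda < f j]|%:R <= D * (b / lambda) `^ q) ->
  \sum_j f j `^ p <= L `^ (p - 2) * N%:R * b +
    b `^ p * (D * 2 `^ q * (1 / (1 - 2 `^ (q - p))) + 1).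
Proof.
move=> N0 p2 /andP[q0 qp] b0 L0 D0 fb f2 lev.
have p0 : 0 <= p by lra.
pose h i : R := (1 / 2) ^+ i.
have h0 i : 0 < h i by rewrite exprn_gt0//; lra.
(* The level set bound is available only from L on; truncating the levels at L changes nothing at
   points where f exceeds L. *)
pose lam i := Num.max L (b * h i.+1).
pose y : R := 2 `^ (- p); pose z : R := 2 `^ q.
have y0 : 0 < y by rewrite powR_gt0.
have z0 : 0 < z by rewrite powR_gt0.
have point j : f j `^ p <= L `^ (p - 2) * f j ^+ 2 +
    b `^ p * (\sum_(i < N) y ^+ i * (lam i < f j)%R%:R + y ^+ N).
  have /andP[f0 fbj] := fb j.
  have s0 : 0 <= \sum_(i < N) y ^+ i * (lam i < f j)%R%:R + y ^+ N.
    by rewrite addr_ge0 ?sumr_ge0 ?exprn_ge0// ?ltW// => i _; rewrite mulr_ge0 ?exprn_ge0// ltW.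
  have [fL|Lf] := leP (f j) L.
    apply: ler_wpDr; first by rewrite mulr_ge0 ?powR_ge0.
    have [->|fn0] := eqVneq (f j) 0; first by rewrite powR0 ?mulr_ge0 ?powR_ge0 ?sqr_ge0// gt_eqF// (lt_trans _ p2).
    have -> : f j `^ p = f j `^ (p - 2) * f j ^+ 2.
      by rewrite -powR_mulrn// -powRD ?fn0 ?implybT//; congr (_ `^ _); ring.
    rewrite ler_wpM2r ?sqr_ge0// ge0_ler_powR ?nnegrE//; lra.
  apply: ler_wpDl; first by rewrite mulr_ge0 ?powR_ge0 ?sqr_ge0.
  rewrite [X in X `^ p](_ : _ = b * (f j / b)); last by rewrite mulrC divfK// gt_eqF.
  have v01 : 0 <= f j / b <= 1 by rewrite divr_ge0 ?(ltW b0)//= ler_pdivrMr// mul1r.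
  rewrite powRM ?(ltW b0) ?(andP v01).1// ler_wpM2l ?powR_ge0//.
  apply: (le_trans (layer_cake N p0 v01)); rewrite lerD2r; apply: ler_sum => i _.
  rewrite ler_wpM2l ?exprn_ge0 ?(ltW y0)//.
  rewrite /lam gt_max Lf/= ler_nat.
  by rewrite ltr_pdivlMr// (mulrC (h _)).
apply: (le_trans (ler_sum _ (fun j _ => point j))).
rewrite big_split/= -!mulr_sumr -mulrA lerD//.
  by rewrite ler_wpM2l ?powR_ge0.
rewrite ler_wpM2l ?powR_ge0// big_split/=; apply: lerD; last first.
  (* N layers suffice: the N remainders add up to N 2^(-p N), at most 1 since N <= 2^N and p >= 1.
     This is the [+ 1] of the conclusion. *)
  rewrite sumr_const card_ord -[leLHS]mulr_natl.
  have y2 : y <= 1 / 2.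
    rewrite /y powRN div1r lef_pV2 ?posrE ?powR_gt0// -[leLHS]powRr1//.
    by rewrite ler_powR ?ler1n//; lra.
  have yN : y ^+ N <= (1 / 2) ^+ N by rewrite lerXn2r ?nnegrE ?(ltW y0)//; lra.
  have NN : N%:R <= 2 ^+ N :> R by rewrite -natrX ler_nat ltnW// ltn_expl.
  apply: (@le_trans _ _ (2 ^+ N * (1 / 2) ^+ N)).
    by apply: ler_pM => //; rewrite exprn_ge0// ltW.
  by rewrite -exprMn mulrC divfK ?expr1n.
rewrite exchange_big/=.
apply: (@le_trans _ _ (\sum_(i < N) D * z * (2 `^ (q - p)) ^+ i)); last first.
  rewrite -mulr_sumr ler_wpM2l ?mulr_ge0 ?powR_ge0//; apply: geometric_sum_le.
  rewrite powR_ge0/= -opprB powRN invf_lt1 ?powR_gt0// powR_gt1 ?ltr1n//; lra.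
apply: ler_sum => i _; rewrite -mulr_sumr.
have -> : \sum_j (lam i < f j)%R%:R = #|[pred j | lam i < f j]|%:R :> R.
  rewrite -sum1_card natr_sum [RHS]big_mkcond/=; apply: eq_bigr => j _.
  by rewrite inE; case: (_ < _).
have bh : 0 < b * h i.+1 by rewrite mulr_gt0.
have lam0 : 0 < lam i by rewrite /lam lt_max bh orbT.
have Ll : L <= lam i by rewrite /lam le_max lexx.
apply: (@le_trans _ _ (y ^+ i * (D * (b / lam i) `^ q))).
  by rewrite ler_wpM2l ?exprn_ge0 ?(ltW y0)// lev.
have -> : D * z * 2 `^ (q - p) ^+ i = y ^+ i * (D * (2 ^+ i.+1) `^ q).
  rewrite powRD ?pnatr_eq0 ?implybT// -/y -/z powR_expn// -/z exprMn exprS; ring.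
rewrite ler_wpM2l ?exprn_ge0 ?(ltW y0)// ler_wpM2l// ge0_ler_powR ?nnegrE ?(ltW q0) ?exprn_ge0//.
  by rewrite divr_ge0// ltW.
rewrite ler_pdivrMr// (le_trans _ (_ : 2 ^+ i.+1 * (b * h i.+1) <= _))//.
  by rewrite mulrCA -exprMn (_ : 2 * (1 / 2) = 1) ?expr1n ?mulr1//; lra.
by rewrite ler_wpM2l ?exprn_ge0// /lam le_max lexx orbT.
Qed.

End GridMoments.

Section GridRestriction.
Variable R : realType.
Local Notation e := (@e2pi R).
Local Notation frac := (@Defs.frac R).

(** The last hypothesis on N says that the small values, which Plancherel bounds by L^(p-2) N b with
    L^2 of order b N^sigma, cost no more than b^p. The condition 2/beta < p is the summability of
    the level sets. *)
Lemma grid_moment (B : pred nat) (x W P : nat -> R) (n0 : nat)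
    (K S0 sigma beta rho C3 C4 p : R) :
    (0 < n0)%N -> 0 < K -> 0 <= S0 -> 0 < sigma -> 0 < beta <= 1 -> 0 < rho < 1 ->
    (forall n, (n0 <= n)%N -> 0 < W n) ->
    (forall m n, (n0 <= m)%N -> (m.*2 <= n)%N ->
       W m * m%:R `^ (- beta) <= rho * (W n * n%:R `^ (- beta))) ->
    (forall m n, (n0 <= m)%N -> (m <= n)%N -> W m <= W n) ->
    (forall n, (n0 <= n)%N -> 0 < P n <= 1 / 2) ->
    (forall n, (n0 <= n)%N -> P n <= K * W n / n%:R) ->
    (forall X n, (n0 <= X)%N -> (X <= n <= X.*2)%N -> B n -> frac (x n) < P X) ->
    (forall X a b m xi, (n0 <= X)%N -> (X <= a)%N -> (b <= X.*2)%N ->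
       (0 < m)%N -> m%:R * P X <= 1 ->
       normc (\sum_(a <= n < b) e (m%:R * x n + n%:R * xi)) <= S0 * X%:R `^ sigma) ->
    2 < p -> 2 / beta < p -> 0 < C3 -> 0 <= C4 ->
  exists2 C, 0 < C & forall N c,
    let b := \sum_(1 <= n < N.+1 | B n) 1 in
    (n0 <= N)%N -> (forall n, normc (c n) <= 1) -> W N <= C3 * b ->
    (b * N%:R `^ sigma) `^ ((p - 2) / 2) * N%:R * b <= C4 * b `^ p ->
  \sum_(j < N) normc (\sum_(1 <= n < N.+1 | B n) c n * e (n%:R * (j%:R / N%:R))) `^ p <=
     C * b `^ p.
Proof.
move=> n00 K0 S00 s0 hbeta hrho W0 W2 Wm Pr PK BP ES p2 pb C30 C40.
have /andP[beta0 beta1] := hbeta; have /andP[rho0 rho1] := hrho.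
pose C1 := 128 * K / (1 - rho).
pose C2 : R := Num.max (n0.*2.+1%:R) (4 * S0 / (1 - 2 `^ (- sigma))).
have C10 : 0 < C1 by rewrite divr_gt0 ?mulr_gt0// subr_gt0.
have C20 : 0 < C2 by rewrite lt_max ltr0n.
pose D := (2 * C1 * C3) `^ beta^-1.
pose q := 2 / beta.
have q0 : 0 < q by rewrite divr_gt0.
have r1 : 2 `^ (q - p) < 1 :> R.
  by rewrite -opprB powRN invf_lt1 ?powR_gt0// powR_gt1 ?ltr1n// subr_gt0.
have E0 : 0 < D * 2 `^ q * (1 / (1 - 2 `^ (q - p))) + 1.
  by rewrite ltr_wpDl// !mulr_ge0 ?powR_ge0// invr_ge0 subr_ge0 ltW.
exists ((2 * C2) `^ ((p - 2) / 2) * C4 + (D * 2 `^ q * (1 / (1 - 2 `^ (q - p))) + 1)).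
  by rewrite ltr_wpDl// mulr_ge0 ?powR_ge0.
move=> N c b N0 c1 Wb small.
have NN : (0 < N)%N by exact: leq_trans N0.
have WN := W0 N N0.
have CC0 : 0 <= 2 * C1 * C3 by apply: mulr_ge0; [apply: mulr_ge0|] => //; exact: ltW.
have b0 : 0 < b by rewrite -(pmulr_rgt0 _ C30) (lt_le_trans WN).
(* From L on, the error term of [level_set_le] is at most lambda^2 / 2 and can be absorbed; the main
   term, with W N <= C3 b, then yields |E| <= D (b / lambda)^(2 / beta). *)
pose L2 := 2 * C2 * (b * N%:R `^ sigma).
have L20 : 0 <= L2 by apply: mulr_ge0; apply: mulr_ge0; rewrite ?powR_ge0// ltW.
pose L := Num.sqrt L2.
pose F (j : 'I_N) := \sum_(1 <= n < N.+1 | B n) c n * e (n%:R * (j%:R / N%:R)).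
have := @moment_of_level_sets R N (fun j => normc (F j)) b L D p q NN p2.
rewrite q0 /q pb => /(_ isT b0 (sqrtr_ge0 _) (powR_ge0 _ _)) mom.
apply: le_trans (mom _ _ _) _ => {mom}.
- move=> j; rewrite normc_ge0/=; apply: (le_trans (ler_normc_sum _ _ _)).
  by apply: ler_sum => n _; rewrite normcM normc_e2pi mulr1.
- rewrite grid_parseval ler_wpM2l//; apply: ler_sum => n _.
  by rewrite expr_le1// normc_ge0.
- move=> l l0 Ll.
  have [->|E1] := posnP #|[pred j | l < normc (F j)]|.
    by rewrite mulr_ge0 ?powR_ge0.
  have := @level_set_le R B x W P n0 K S0 sigma beta rho n00 K0 S00 s0 hbeta hrho W0 W2 Wm Pr PK BP ES N c N0 c1 l l0 E1.
  rewrite -/C1 -/C2 -/b; set E : R := #|_|%:R => lev.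
  have ER : 0 < E by rewrite ltr0n.
  have Ll2 : L2 <= l ^+ 2.
    by rewrite -(sqr_sqrtr L20) lerXn2r ?nnegrE ?sqrtr_ge0 ?(ltW l0).
  have Eb : 0 < E `^ (- beta) by rewrite powR_gt0.
  have h1 : l ^+ 2 <= 2 * C1 * C3 * b ^+ 2 * E `^ (- beta).
    have : b * C1 * E `^ (- beta) * W N <= b * C1 * E `^ (- beta) * (C3 * b).
      by apply: ler_wpM2l => //; apply: mulr_ge0; [apply: mulr_ge0|]; exact: ltW.
    by move: Ll2 lev; rewrite /L2; lra.
  have h2 : E `^ beta <= 2 * C1 * C3 * (b / l) ^+ 2.
    move: h1; rewrite powRN ler_pdivlMr ?powR_gt0// => h1.
    rewrite expr_div_n mulrA ler_pdivlMr ?exprn_gt0// mulrC.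
    exact: h1.
  have -> : E = (E `^ beta) `^ beta^-1 by rewrite -powRrM mulfV ?gt_eqF// powRr1// ltW.
  apply: (@le_trans _ _ ((2 * C1 * C3 * (b / l) ^+ 2) `^ beta^-1)).
    rewrite ge0_ler_powR ?nnegrE ?powR_ge0 ?invr_ge0 ?(ltW beta0)//.
    by apply: mulr_ge0 => //; exact: sqr_ge0.
  rewrite powRM ?sqr_ge0//.
  by rewrite -powR_mulrn ?divr_ge0 ?(ltW b0) ?(ltW l0)// -powRrM.
rewrite [leRHS]mulrDl lerD//; last by rewrite mulrC.
have -> : L `^ (p - 2) = (2 * C2) `^ ((p - 2) / 2) * (b * N%:R `^ sigma) `^ ((p - 2) / 2).
  rewrite /L -powR12_sqrt// -powRrM -powRM ?mulr_ge0 ?powR_ge0 ?(ltW b0) ?(ltW C20)//.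
  by congr (_ `^ _); field.
by rewrite -!mulrA ler_wpM2l ?powR_ge0// !mulrA.
Qed.

End GridRestriction.

(** * Integration over the circle *)

Section CircleIntegral.
Variable R : realType.
Local Notation e := (@e2pi R).
Local Notation mu := (@lebesgue_measure R).
Local Open Scope ereal_scope.

(** Translation invariance: the pushforward of Lebesgue measure under a shift agrees with it on
    half-open intervals, which determine the measure. *)
Lemma integral_shift (c a b : R) (f : R -> \bar R) :
    measurable_fun [set: R] f -> (forall x, 0 <= f x) ->
  \int[mu]_(x in `[(a + c)%R, (b + c)%R[) f x = \int[mu]_(x in `[a, b[) f (x + c)%R.
Proof.
move=> mf f0; pose s : measurableTypeR R -> measurableTypeR R := fun x => (x + c)%R.
have ms : measurable_fun [set: measurableTypeR R] (s : measurableTypeR R -> measurableTypeR R).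
  by apply: measurable_funD => //; exact: measurable_cst.
have sE (b1 b2 : bool) (u v : R) :
    s @^-1` [set` Interval (BSide b1 u) (BSide b2 v)] =
    [set` Interval (BSide b1 (u - c)%R) (BSide b2 (v - c)%R)].
  apply/seteqP; split => x /=; rewrite !in_itv/= /s;
    case: b1; case: b2; rewrite /= ?lerBlDr ?ltrBlDr ?lerBrDr ?ltrBrDr//.
have msE (A : set R) : measurable A -> pushforward mu s A = mu A.
  move=> mA; apply/esym/(@lebesgue_measure_unique R (pushforward mu s)) => //= _ [[u v]] _ <-.
  rewrite /pushforward sE/= !lebesgue_measure_itv/= !lte_fin ltrD2r.
  by congr (if _ then (_)%:E else _); ring.
rewrite -[in RHS](addrK c a) -[in RHS](addrK c b) -sE.
rewrite -(ge0_integral_pushforward (phi := s))//=; last exact: measurable_funS mf.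
by apply: eq_measure_integral => //= A mA AS; exact/esym/msE.
Qed.

Lemma integral_circle (f : R -> \bar R) :
    measurable_fun [set: R] f -> (forall x, 0 <= f x) ->
  \int[circle_measure R]_x f x = \int[mu]_(x in `[0%R, 1%R[) f x.
Proof.
move=> mf f0.
have mD : measurable (`[0%R, 1%R[%classic : set (measurableTypeR R)) by exact: measurable_itv.
rewrite -(setUv `[0%R, 1%R[%classic) ge0_integral_setU//=.
- rewrite [X in _ + X](_ : _ = 0) ?adde0.
    apply: eq_measure_integral => A mA AS /=.
    by rewrite /mrestr setIidl.
  apply: null_set_integral => //.
  + exact: measurableC.
  + exact: measurable_funS mf.
  + by rewrite /= /mrestr setIC setICr measure0.
- exact: measurableC.
- by rewrite setUv.
- by rewrite disj_set2E setICr.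
Qed.

(** Tile [0, 1) by N translates of [0, 1/N). A bound on grid sums that is uniform in the offset x
    then becomes a bound on the integral. *)
Lemma integral_grid (N : nat) (f : R -> \bar R) : (0 < N)%N ->
    measurable_fun [set: R] f -> (forall x, 0 <= f x) ->
  \int[mu]_(x in `[0%R, 1%R[) f x =
  \int[mu]_(x in `[0%R, N%:R^-1%R[) \sum_(j < N) f (x + j%:R / N%:R)%R.
Proof.
move=> N0 mf f0; have NR : (0 < N%:R :> R)%R by rewrite ltr0n.
have mfs (c : R) : measurable_fun [set: R] (fun x => f (x + c)%R).
  by apply: (measurableT_comp mf); apply: measurable_funD => //; exact: measurable_cst.
rewrite ge0_integral_sum//; last first.
  by move=> j; exact: measurable_funS (mfs _).
have key k : \int[mu]_(x in `[0%R, (k%:R / N%:R)%R[) f x =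
    \sum_(j < k) \int[mu]_(x in `[0%R, N%:R^-1%R[) f (x + j%:R / N%:R)%R.
  elim: k => [|k IH]; first by rewrite mul0r big_ord0 set_itv_ge ?integral_set0// bnd_simp ltxx.
  have k0 : (0 <= k%:R / N%:R :> R)%R by rewrite divr_ge0// ler0n.
  have k1 : (k%:R / N%:R <= k.+1%:R / N%:R :> R)%R by rewrite ler_pM2r ?invr_gt0// ler_nat.
  rewrite big_ord_recr/= -IH -integral_shift// add0r.
  rewrite (_ : (N%:R^-1 + k%:R / N%:R)%R = (k.+1%:R / N%:R)%R :> R); last first.
    by rewrite -natr1 mulrDl mul1r addrC.
  rewrite -ge0_integral_setU//=; last 2 first.
  - exact: measurable_funS mf.
  - rewrite disj_set2E; apply/eqP; rewrite -subset0 => x [] /=; rewrite !in_itv/=.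
    by move=> /andP[_ h1] /andP[h2 _]; move: (lt_le_trans h1 h2); rewrite ltxx.
  by congr integral; rewrite -itv_bndbnd_setU// bnd_simp.
by rewrite -key divff// gt_eqF.
Qed.

Lemma integral_grid_le (N : nat) (g : R -> R) (A : R) : (0 < N)%N ->
    measurable_fun [set: R] g -> (forall x, 0 <= g x)%R ->
    (forall x, \sum_(j < N) g (x + j%:R / N%:R) <= A)%R ->
  \int[circle_measure R]_x (g x)%:E <= (A / N%:R)%:E.
Proof.
move=> N0 mg g0 gA; have mf : measurable_fun [set: R] (EFin \o g) by exact/measurable_EFinP.
rewrite integral_circle//; rewrite (@integral_grid N)//.
have A0 : (0 <= A)%R by apply: le_trans (gA 0%R); exact: sumr_ge0.
apply: (@le_trans _ _ (\int[mu]_(x in `[0%R, N%:R^-1%R[) (cst A%:E x))).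
  apply: ge0_le_integral => //=.
  - by move=> x _; apply: sume_ge0 => j _; rewrite lee_fin.
  - apply: emeasurable_sum => j; apply: measurable_funTS.
    apply: (measurableT_comp mf); apply: measurable_funD => //; exact: measurable_cst.
  - by move=> x _; rewrite sumEFin lee_fin.
rewrite integral_cst//= lebesgue_measure_itv/= lte_fin invr_gt0 ltr0n N0.
by rewrite oppr0 adde0 -EFinM.
Qed.

Lemma integral_grid_ge (N : nat) (g : R -> R) (A : R) : (0 < N)%N ->
    measurable_fun [set: R] g -> (forall x, 0 <= g x)%R -> (0 <= A)%R ->
    (forall x, A <= \sum_(j < N) g (x + j%:R / N%:R))%R ->
  (A / N%:R)%:E <= \int[circle_measure R]_x (g x)%:E.
Proof.
move=> N0 mg g0 A0 gA; have mf : measurable_fun [set: R] (EFin \o g) by exact/measurable_EFinP.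
rewrite integral_circle//; rewrite (@integral_grid N)//.
apply: (@le_trans _ _ (\int[mu]_(x in `[0%R, N%:R^-1%R[) (cst A%:E x))).
  rewrite integral_cst//= lebesgue_measure_itv/= lte_fin invr_gt0 ltr0n N0.
  by rewrite oppr0 adde0 -EFinM.
apply: ge0_le_integral => //=.
- apply: emeasurable_sum => j; apply: measurable_funTS.
  apply: (measurableT_comp mf); apply: measurable_funD => //; exact: measurable_cst.
- by move=> x _; rewrite sumEFin lee_fin.
Qed.

Lemma integral_near0_ge (g : R -> R) (A d : R) : (0 < d <= 1)%R ->
    measurable_fun [set: R] g -> (forall x, 0 <= g x)%R -> (0 <= A)%R ->
    (forall x, 0 <= x < d -> A <= g x)%R ->
  (A * d)%:E <= \int[circle_measure R]_x (g x)%:E.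
Proof.
move=> /andP[d0 d1] mg g0 A0 gA; have mf : measurable_fun [set: R] (EFin \o g) by exact/measurable_EFinP.
rewrite integral_circle//.
apply: (@le_trans _ _ (\int[mu]_(x in `[0%R, d[) (g x)%:E)); last first.
  apply: ge0_subset_integral => //=; first exact: measurable_funTS.
    by move=> x _; rewrite lee_fin.
  by apply: subset_itvl; rewrite bnd_simp.
apply: (@le_trans _ _ (\int[mu]_(x in `[0%R, d[) (cst A%:E x))).
  by rewrite integral_cst//= lebesgue_measure_itv/= lte_fin d0 oppr0 adde0 -EFinM.
apply: ge0_le_integral => //=.
exact: measurable_funTS.
Qed.

Lemma measurable_normc_expsum (B : pred nat) (N : nat) (a : nat -> R[i]) (p : R) :
  measurable_fun [set: R] (fun x => normc (expsum B N a x) `^ p)%R.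
Proof.
apply: (measurableT_comp (measurable_powR _)).
pose r := [seq n <- index_iota 1 N.+1 | B n].
have E x : normc (expsum B N a x) =
  Num.sqrt ((\sum_(n <- r) (complex.Re (a n) * cos (2 * pi * (n%:R * x)) - complex.Im (a n) * sin (2 * pi * (n%:R * x)))) ^+ 2 +
   (\sum_(n <- r) (complex.Re (a n) * sin (2 * pi * (n%:R * x)) + complex.Im (a n) * cos (2 * pi * (n%:R * x)))) ^+ 2)%R.
  rewrite /r !big_filter -[LHS]ger0_norm ?normc_ge0// -sqrtr_sqr normc_sqr Re_sum.
  have -> : complex.Im (expsum B N a x) = (\sum_(1 <= n < N.+1 | B n) complex.Im (a n * e (n%:R * x)))%R.
    by apply: (big_morph (@complex.Im R)) => // -[u v] [u' v'].
  congr (Num.sqrt (_ ^+ 2 + _ ^+ 2)%R); apply: eq_bigr => n _; case: (a n) => u v //=.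
under eq_fun do rewrite E.
have cl (n : nat) : continuous (fun x : R => 2 * pi * (n%:R * x))%R.
  rewrite (_ : (fun x => _) = *%R (2 * pi * n%:R)%R); first exact: mulrl_continuous.
  by apply/funext => x; rewrite mulrA.
have mc (n : nat) : measurable_fun [set: R] (fun x : R => cos (2 * pi * (n%:R * x)))%R.
  apply: continuous_measurable_fun => x.
  by apply: (continuous_comp (cl n x)); exact: continuous_cos.
have ms (n : nat) : measurable_fun [set: R] (fun x : R => sin (2 * pi * (n%:R * x)))%R.
  apply: continuous_measurable_fun => x.
  by apply: (continuous_comp (cl n x)); exact: continuous_sin.
have msq : measurable_fun [set: R] (@Num.sqrt R).
  by apply: continuous_measurable_fun; exact: sqrt_continuous.
apply: (measurableT_comp msq).
have mz (u : R) (h : R -> R) : measurable_fun [set: R] h -> measurable_fun [set: R] (fun x => u * h x)%R.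
  by move=> mh; apply: measurable_funM => //; exact: measurable_cst.
apply: measurable_funD; apply: measurable_funX; apply: measurable_sum => n.
  by apply: measurable_funB; exact: mz.
by apply: measurable_funD; exact: mz.
Qed.

End CircleIntegral.

(** * From grid estimates to norms on the circle *)

Section MajorantFromGrid.
Variable R : realType.
Local Notation e := (@e2pi R).
Variable B : pred nat.
Let b (N : nat) : R := \sum_(1 <= n < N.+1 | B n) 1.

Lemma circle_LnormE (p : R) (F : R -> R[i]) :
  circle_Lnorm p F = ((\int[circle_measure R]_x (normc (F x) `^ p)%:E) `^ p^-1)%E.
Proof.
rewrite /circle_Lnorm Lnorm.unlock; congr (_ `^ _)%E; apply: eq_integral => x _.
by rewrite /= ger0_norm ?normc_ge0.
Qed.

Lemma circle_Lnorm_le (p A : R) (F G : R -> R[i]) : 0 < p -> 0 <= A ->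
  (\int[circle_measure R]_x (normc (F x) `^ p)%:E <=
     A%:E * \int[circle_measure R]_x (normc (G x) `^ p)%:E)%E ->
  (circle_Lnorm p F <= (A `^ p^-1)%:E * circle_Lnorm p G)%E.
Proof.
move=> p0 A0 FG; rewrite !circle_LnormE.
have ige (H : R -> R[i]) : (0 <= \int[circle_measure R]_x (normc (H x) `^ p)%:E)%E.
  by apply: integral_ge0 => x _; rewrite lee_fin powR_ge0.
rewrite -poweR_EFin -poweRM//.
rewrite gt0_ler_poweR ?invr_ge0 ?(ltW p0)// in_itv/= leey andbT.
  exact: ige.
by rewrite mule_ge0.
Qed.

Let b_ge0 N : 0 <= b N. Proof. exact: sumr_ge0. Qed.

Lemma normc_expsum_le (N : nat) (a : nat -> R[i]) (x : R) :
  (forall n, normc (a n) <= 1) -> normc (expsum B N a x) <= b N.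
Proof.
move=> a1; apply: (le_trans (ler_normc_sum _ _ _)); apply: ler_sum => n _.
by rewrite normcM normc_e2pi mulr1.
Qed.

Let expsum_grid (N : nat) (a : nat -> R[i]) (x : R) (j : nat) :
  expsum B N a (x + j%:R / N%:R) =
  \sum_(1 <= n < N.+1 | B n) (a n * e (n%:R * x)) * e (n%:R * (j%:R / N%:R)).
Proof. by apply: eq_bigr => n _; rewrite mulrDr e2piD mulrA. Qed.

Let normc_coef (a : nat -> R[i]) (x : R) : (forall n, normc (a n) <= 1) ->
  forall n, normc (a n * e (n%:R * x)) <= 1.
Proof. by move=> a1 n; rewrite normcM normc_e2pi mulr1. Qed.

(** By Parseval all translates of the grid carry the same second moment, which grows with the moduli
    of the coefficients. *)
Lemma majorant_L2 (N : nat) (a : nat -> R[i]) : (forall n, normc (a n) <= 1) ->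
  (circle_Lnorm 2 (expsum B N a) <= circle_Lnorm 2 (expsum B N (fun=> 1%R)))%E.
Proof.
move=> a1.
have E1 : ((1 : R) `^ 2^-1)%:E = 1%E :> \bar R by rewrite powR1.
rewrite -[leRHS]mul1e -[in leRHS]E1; apply: circle_Lnorm_le => //; rewrite mul1e.
have [->|N0] := posnP N.
  have E (c : nat -> R[i]) : expsum B 0 c = fun=> 0.
    by apply/funext => x; rewrite /expsum big_geq.
  by rewrite !E.
have sq (c : nat -> R[i]) x : \sum_(j < N) normc (expsum B N c (x + j%:R / N%:R)) `^ 2 =
    N%:R * \sum_(1 <= n < N.+1 | B n) normc (c n) ^+ 2.
  under eq_bigr do rewrite powR_mulrn ?normc_ge0// expsum_grid.
  rewrite grid_parseval; congr (_ * _); apply: eq_bigr => n _.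
  by rewrite normcM normc_e2pi mulr1.
apply: (@le_trans _ _ (N%:R * b N / N%:R)%:E).
  apply: integral_grid_le => //; first exact: measurable_normc_expsum.
    by move=> x; rewrite powR_ge0.
  move=> x; rewrite sq ler_wpM2l// ler_sum// => n _.
  by rewrite expr_le1// normc_ge0.
apply: integral_grid_ge => //; first exact: measurable_normc_expsum.
- by move=> x; rewrite powR_ge0.
- by rewrite mulr_ge0.
- move=> x; rewrite sq ler_wpM2l// ler_sum// => n _.
  by rewrite normc1 expr1n.
Qed.

(* Near [0] all the phases have real part at least [1 / 2]. *)
Lemma Lp_expsum_ge (N : nat) (p : R) : (0 < N)%N -> 0 <= p ->
  (((b N / 2) `^ p / (8 * N%:R))%:E <=
     \int[circle_measure R]_x (normc (expsum B N (fun=> 1%R) x) `^ p)%:E)%E.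
Proof.
move=> N0 p0; have NR : 1 <= N%:R :> R by rewrite ler1n.
have N8 : 0 < 8 * N%:R :> R by rewrite mulr_gt0// ltr0n.
apply: integral_near0_ge.
- by rewrite invr_gt0 N8/= invf_le1//; lra.
- exact: measurable_normc_expsum.
- by move=> x; rewrite powR_ge0.
- by rewrite powR_ge0.
- move=> x /andP[x0 x1]; rewrite ge0_ler_powR ?nnegrE ?divr_ge0 ?normc_ge0//.
  apply: le_trans (le_trans (ler_norm _) (Re_le_normc _)).
  rewrite Re_sum /b mulr_suml [leRHS]big_nat_cond [leLHS]big_nat_cond; apply: ler_sum => n /andP[/andP[n1 n2] _].
  rewrite [X in complex.Re X]mul1r; apply: Re_e2pi_ge.
  rewrite ger0_norm ?mulr_ge0//.
  apply: (@le_trans _ _ (N%:R * x)); first by rewrite ler_wpM2r// ler_nat -ltnS.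
  move: x1; rewrite -div1r ltr_pdivlMr//; lra.
Qed.

(** In the constant, 8 * 2^p inverts the lower bound of [Lp_expsum_ge], [n0] handles N < n0 by the
    trivial bound b at each grid point, and 1 ensures positivity. *)
Lemma majorant_of_grid (n0 : nat) (p C : R) : 0 < p -> 0 <= C ->
    (forall N c, (n0 <= N)%N -> (forall n, normc (c n) <= 1) ->
       \sum_(j < N) normc (\sum_(1 <= n < N.+1 | B n) c n * e (n%:R * (j%:R / N%:R))) `^ p <=
         C * b N `^ p) ->
  exists2 K : R, 0 < K & forall (N : nat) (a : nat -> R[i]), (forall n, normc (a n) <= 1) ->
   (circle_Lnorm p (expsum B N a) <= K%:E * circle_Lnorm p (expsum B N (fun=> 1%R)))%E.
Proof.
move=> p0 C0 hgrid; pose A := 8 * 2 `^ p * (C + n0%:R + 1).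
have A0 : 0 < A by rewrite mulr_gt0 ?mulr_gt0 ?powR_gt0// ltr_wpDl// addr_ge0.
exists (A `^ p^-1); first by rewrite powR_gt0.
move=> N a a1; apply: circle_Lnorm_le => //; first exact: ltW.
have [->|N0] := posnP N.
  have E (c : nat -> R[i]) : expsum B 0 c = fun=> 0.
    by apply/funext => x; rewrite /expsum big_geq.
  rewrite !E; under eq_integral do rewrite normc0 powR0 ?gt_eqF//.
  by rewrite integral0 mule0.
have NR : 1 <= N%:R :> R by rewrite ler1n.
have NR0 : 0 < N%:R :> R by rewrite ltr0n.
have bp : 0 <= b N `^ p by exact: powR_ge0.
have up : (\int[circle_measure R]_x (normc (expsum B N a x) `^ p)%:E <=
    ((C + n0%:R) * b N `^ p / N%:R)%:E)%E.
  apply: integral_grid_le => //; first exact: measurable_normc_expsum.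
    by move=> x; rewrite powR_ge0.
  move=> x; have [Nn|nN] := leqP n0 N.
    under eq_bigr do rewrite expsum_grid.
    (* The offset x only modulates the coefficients to a_n e(n x); this is why the grid hypothesis
       ranges over all coefficients of modulus at most 1. *)
    apply: (le_trans (hgrid N _ Nn _)); first exact: normc_coef.
    by rewrite ler_wpM2r// lerDl.
  apply: (@le_trans _ _ (\sum_(j < N) b N `^ p)).
    apply: ler_sum => j _; rewrite ge0_ler_powR ?nnegrE ?normc_ge0 ?(ltW p0)//.
    exact: normc_expsum_le.
  rewrite sumr_const card_ord -[leLHS]mulr_natl ler_wpM2r// ler_wpDl// ler_nat.
  exact: ltnW.
apply: (le_trans up).
apply: (@le_trans _ _ (A%:E * ((b N / 2) `^ p / (8 * N%:R))%:E)%E); last first.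
  by apply: lee_wpmul2l; [rewrite lee_fin ltW|apply: Lp_expsum_ge => //; exact: ltW].
rewrite -EFinM lee_fin /A powRM ?invr_ge0// -(@powR_inv1 _ 2)// -powRrM mulN1r powRN.
rewrite (_ : 8 * _ * _ * _ = (C + n0%:R + 1) * b N `^ p / N%:R); last first.
  by field; rewrite !gt_eqF ?powR_gt0.
by rewrite ler_pM2r ?invr_gt0// ler_wpM2r// lerDl.
Qed.

End MajorantFromGrid.

(** * Regularly varying functions and their inverses *)

Section Derivatives.
Variable R : realType.
Implicit Types (f g : R -> R).

Lemma derivative_on_continuous (D : set R) f f1 :
  derivative_on D f f1 -> {within D, continuous f}.
Proof.
move=> df; apply/subspace_continuousP => x Dx.
apply/cvgrPdist_lt => eps eps0.
have /cvgrPdist_lt/(_ _ ltr01) := df x Dx; rewrite !near_withinE => H.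
have K0 : 0 < `|f1 x| + 1 by rewrite ltr_wpDl.
have : \forall y \near x, `|x - y| < eps / (`|f1 x| + 1).
  by apply: (@cvgr_dist_lt _ _ _ (nbhs x) _ id x); [exact: cvg_id|rewrite divr_gt0].
apply: filterS2 H => y H xy Dy.
have [->|yx] := eqVneq y x; first by rewrite subrr normr0.
have {}H := H yx Dy.
have yx0 : y - x != 0 by rewrite subr_eq0.
have -> : f x - f y = ((f y - f x) / (y - x)) * (x - y).
  by field.
rewrite normrM; move: xy; rewrite ltr_pdivlMr// mulrC; apply: le_lt_trans.
rewrite ler_wpM2r// -lerBlDl; apply: le_trans (ltW H); rewrite -normrN opprB.
exact: lerB_dist.
Qed.

Lemma derivative_on_is_derive (x0 x : R) f f1 :
  derivative_on `[x0, +oo[ f f1 -> x0 < x -> is_derive x 1 f (f1 x).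
Proof.
move=> df x0x.
have Dx : `[x0, +oo[%classic x by rewrite /= in_itv/= andbT ltW.
apply/is_derive1_caratheodory.
exists (fun z => if z == x then f1 x else (f z - f x) / (z - x)); split.
- move=> z; case: eqVneq => [->|zx]; first by rewrite !subrr mulr0.
  by rewrite divfK// subr_eq0.
- apply/continuous_withinNx; rewrite eqxx.
  apply/cvgrPdist_lt => eps eps0.
  have /cvgrPdist_lt/(_ _ eps0) := df x Dx; rewrite !near_withinE => H.
  have xn : \forall y \near x, x0 < y by exact: lt_nbhsr.
  apply: filterS2 H xn => y H xy yx; rewrite (negPf yx).
  by apply: H => //; rewrite /= in_itv/= andbT ltW.
- by rewrite eqxx.
Qed.

Lemma is_derive_homo (X : R) f df :
  (forall t, X < t -> is_derive t 1 f (df t)) -> (forall t, X < t -> 0 <= df t) ->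
  forall x y, X < x -> x <= y -> f x <= f y.
Proof.
move=> fd d0 x y Xx xy.
have cf : {within `[x, y], continuous f}.
  apply: derivable_within_continuous => t; rewrite in_itv/= => /andP[xt _].
  by apply: ex_derive; apply: fd; exact: lt_le_trans xt.
have fd' (t : R) : t \in `]x, y[ -> is_derive t 1 f (df t).
  by rewrite in_itv/= => /andP[xt _]; apply: fd; exact: lt_trans xt.
have [c] := MVT_segment xy fd' cf; rewrite in_itv/= => /andP[xc _] fE.
rewrite -subr_ge0 fE mulr_ge0 ?subr_ge0//.
by apply: d0; exact: lt_le_trans xc.
Qed.

Lemma exp_integral_rep_derive (x0 x : R) (theta l : R -> R) : 0 < x0 ->
    {within `[x0, +oo[, continuous theta} -> {for x, continuous theta} ->
    exp_integral_rep x0 theta l -> x0 < x ->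
  is_derive x 1 l (l x * (theta x / x)).
Proof.
move=> x00 ctheta cthetax lE x0x.
pose F y := (\int[lebesgue_measure]_(t in `[x0, y]) (theta t / t))%R.
have cf : {within `[x0, x + 1], continuous (fun t => theta t / t)}.
  have c1 : {within `[x0, x + 1], continuous theta}.
    by apply: continuous_subspaceW ctheta => t /=; rewrite !in_itv/= andbT => /andP[].
  apply/subspace_continuousP => t tD; apply: cvgM; first by move/subspace_continuousP: c1; apply.
  apply: cvg_within_filter; apply: inv_continuous.
  by move: tD; rewrite /= in_itv/= => /andP[tD _]; rewrite gt_eqF// (lt_le_trans x00).
have int : lebesgue_measure.-integrable `[x0, x + 1] (EFin \o (fun t => theta t / t)).
  by apply: continuous_compact_integrable => //; exact: segment_compact.
have cx : {for x, continuous (fun t => theta t / t)}.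
  by apply: cvgM => //; apply: inv_continuous; rewrite gt_eqF// (lt_trans x00).
have xx1 : x < x + 1 by rewrite ltrDl.
have FE y : F y = (\int[lebesgue_measure]_(t in `[x0, y]) (theta t / t))%R by [].
have [dF F'] : derivable F x 1 /\ derive1 F x = theta x / x.
  exact: continuous_FTC1_closed xx1 int x0x cx.
clearbody F.
have FD : is_derive x 1 F (theta x / x).
  by apply: DeriveDef => //; rewrite -derive1E.
have near_l : {near x, expR \o F =1 l}.
  near=> y; rewrite /= FE lE//; near: y.
  by apply: filterS (lt_nbhsr x0x) => y /ltW.
apply: (near_eq_is_derive near_l).
have -> : l x = expR (F x) by rewrite FE lE// ltW.
exact: is_derive1_comp.
Unshelve. all: by end_near. Qed.

End Derivatives.

Section RegularVariation.
Variable R : realType.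
Implicit Types (c x : R) (h theta l : R -> R).

Lemma near_pinftyP (P : R -> Prop) :
  (\forall x \near +oo, P x) -> forall Y, exists2 X, Y <= X & forall x, X <= x -> P x.
Proof.
move=> [M [_ PM]] Y; exists (Num.max Y (M + 1)); first by rewrite le_max lexx.
by move=> x; rewrite ge_max => /andP[_ Mx]; apply: PM; apply: lt_le_trans Mx; rewrite ltrDl.
Qed.

(** The middle quantity is x^2 h''/h for h = x^c L. For c > 1 it tends to c (c - 1) > 0, and with d
    = (c - 1) / 4 it is eventually above d. *)
Let kappa_c1 (c : R) (x0 : R) (theta : R -> R) (eps : R) : 1 < c < 2 -> 0 < eps ->
    theta x @[x --> +oo] --> (0 : R) -> x * derive1 theta x @[x --> +oo] --> (0 : R) ->
  exists2 k, 0 < k & \forall x \near +oo,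
    k * x `^ (- eps) <= (c + theta x) * (c + theta x - 1) + x * derive1 theta x <= 4.
Proof.
move=> /andP[c1 c2] e0 t0 t1; pose d := (c - 1) / 4.
have d0 : 0 < d by rewrite divr_gt0// subr_gt0.
have d4 : d <= 1 / 4 by rewrite /d; lra.
have /cvgr0Pnorm_lt/(_ _ d0) T0 := t0.
have /cvgr0Pnorm_lt/(_ _ d0) T1 := t1.
exists d => //; near=> x.
have : `|theta x| < d by near: x.
have : `|x * derive1 theta x| < d by near: x.
have x1 : 1 <= x by near: x; exact: nbhs_pinfty_ge.
have xe : x `^ (- eps) <= 1.
  by rewrite -(powRr0 x) ler_powR// oppr_le0 ltW.
have xe0 : 0 <= x `^ (- eps) by exact: powR_ge0.
move: (theta x) (x * derive1 theta x) => t u.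
rewrite !ltr_norml => /andP[u1 u2] /andP[v1 v2].
have dxe : d * x `^ (- eps) <= d by rewrite ler_piMr// ltW.
have cd : c = 1 + 4 * d by rewrite /d; lra.
apply/andP; split; last by nra.
apply: (le_trans dxe); rewrite cd; nra.
Unshelve. all: by end_near. Qed.

(** For c = 1 the quantity equals theta (1 + theta + x theta'/theta), comparable to theta, which
    tends to 0. The lower bound on theta in the class L_0 is what limits the decay to x^(-eps). *)
Let kappa_L0 (theta : R -> R) (x0 eps : R) : 0 < eps ->
    (forall x, x0 <= x -> 0 < theta x) ->
    theta x @[x --> +oo] --> (0 : R) ->
    x * derive1 theta x / theta x @[x --> +oo] --> (0 : R) ->
    (exists2 C : R, 0 < C & forall x, x0 <= x -> 1 <= C * theta x * x `^ eps) ->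
  exists2 k, 0 < k & \forall x \near +oo,
    k * x `^ (- eps) <= (1 + theta x) * (1 + theta x - 1) + x * derive1 theta x <= 4.
Proof.
move=> e0 tpos t0 t1 [C C0 HC].
have q0 : 0 < 1 / 4 :> R by lra.
have /cvgr0Pnorm_lt/(_ _ q0) T0 := t0.
have /cvgr0Pnorm_lt/(_ _ q0) T1 := t1.
exists (1 / (2 * C)); first by rewrite divr_gt0// mulr_gt0.
near=> x.
have h0 : `|theta x| < 1 / 4 by near: x.
have h1 : `|x * derive1 theta x / theta x| < 1 / 4 by near: x.
have x1 : 1 <= x by near: x; exact: nbhs_pinfty_ge.
have xx0 : x0 <= x by near: x; apply: nbhs_pinfty_ge; exact: num_real.
have tx := tpos x xx0.
have xe : 0 < x `^ eps by rewrite powR_gt0// (lt_le_trans ltr01).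
have := HC x xx0.
have -> : x * derive1 theta x = theta x * (x * derive1 theta x / theta x).
  by rewrite [RHS]mulrC divfK// gt_eqF.
move: h0 h1; rewrite powRN.
move: (theta x) tx (x * derive1 theta x / theta x) => t tx u.
rewrite !ltr_norml => /andP[_ v2] /andP[u1 u2] hC.
have -> : (1 + t) * (1 + t - 1) + t * u = t * (1 + t + u) by ring.
apply/andP; split; last first.
  by apply: (@le_trans _ _ (t * 2)); [rewrite ler_pM2l//; lra|lra].
apply: (@le_trans _ _ (t / 2)); last by rewrite ler_pM2l//; lra.
rewrite ler_pdivrMr// ler_pdivrMr ?mulr_gt0//; lra.
Unshelve. all: by end_near. Qed.

(** All that is kept of the class: x h'/h = c + theta with theta tending to 0, and two-sided control
    of x^2 h''/h. *)
Lemma class_Rc_slow_variation c x0 h : 0 < x0 -> class_Rc c x0 h ->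
  exists theta, [/\ theta x @[x --> +oo] --> (0 : R),
    forall x, x0 < x -> is_derive x 1 h (h x * (c + theta x) / x),
    forall x, x0 < x -> is_derive x 1 theta (derive1 theta x) &
    1 <= c -> forall eps, 0 < eps -> exists2 k, 0 < k & \forall x \near +oo,
      k * x `^ (- eps) <= (c + theta x) * (c + theta x - 1) + x * derive1 theta x <= 4].
Proof.
move=> x00 [/andP[c0 c2] h1 _ _ [l [lclass hE]]].
have [theta [thC2 lrep th0 kap]] : exists theta, [/\ C2_on `[x0, +oo[ theta,
    exp_integral_rep x0 theta l, theta x @[x --> +oo] --> (0 : R) &
    1 <= c -> forall eps, 0 < eps -> exists2 k, 0 < k & \forall x \near +oo,
      k * x `^ (- eps) <= (c + theta x) * (c + theta x - 1) + x * derive1 theta x <= 4].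
  move: lclass; case: eqVneq => [->|c1] lcl.
    case: lcl => _ [theta [[tC2 trep tpos _] [t0 t1 _ HC]]].
    exists theta; split => // _ eps e0.
    by apply: kappa_L0 e0 tpos t0 t1 (HC eps e0).
  case: lcl => theta [tC2 trep t0 t1 _].
  exists theta; split => // c1' eps e0.
  by apply: kappa_c1 => //; rewrite c2 lt_neqAle eq_sym c1 c1'.
case: thC2 => th1 [th2 [d1 _ _]].
have thD x : x0 < x -> is_derive x 1 theta (th1 x) by exact: derivative_on_is_derive.
exists theta; split => // x x0x.
  have xpos : 0 < x by exact: lt_trans x0x.
  have cth : {for x, continuous theta}.
    by apply: differentiable_continuous; apply/derivable1_diffP; apply: ex_derive; exact: thD.
  have lD := exp_integral_rep_derive x00 (derivative_on_continuous d1) cth lrep x0x.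
  have near_h : {near x, (fun y => y `^ c * l y) =1 h}.
    near=> y; rewrite hE//; near: y.
    by apply: filterS (lt_nbhsr x0x) => y /ltW.
  apply: (near_eq_is_derive near_h).
  have pD := is_derive1_powR c xpos.
  apply: is_derive_eq.
  rewrite hE ?(ltW x0x)// /GRing.scale/= powRB; last by apply/implyP => _; rewrite gt_eqF.
  by rewrite powRr1 ?(ltW xpos)//; field; rewrite gt_eqF.
have td := thD x x0x.
by rewrite derive1E derive_val.
Unshelve. all: by end_near. Qed.

End RegularVariation.

(** * Growth, derivative and second differences of inverse functions *)

Section InverseFunctions.
Variable R : realType.
Implicit Types (x y : R).

Lemma MVT_ray (X : R) (f df : R -> R) x y :
  (forall t, X < t -> is_derive t 1 f (df t)) -> X < x -> x < y ->
  exists2 z, x < z < y & f y - f x = df z * (y - x).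
Proof.
move=> fd Xx xy.
have cf : {within `[x, y], continuous f}.
  apply: derivable_within_continuous => t; rewrite in_itv/= => /andP[xt _].
  by apply: ex_derive; apply: fd; exact: lt_le_trans xt.
have fd' (t : R) : t \in `]x, y[ -> is_derive t 1 f (df t).
  by rewrite in_itv/= => /andP[xt _]; apply: fd; exact: lt_trans xt.
by have [z] := MVT xy fd' cf; rewrite in_itv/= => h ->; exists z.
Qed.

(** Eliminating d = 1/u gives De = D2 / (u^2 w). Here u and w are values of h', D2 is a value of
    h'', and De is the second difference of phi up to sign. *)
Let increment_quotient_bounds (l r u w d De D2 L M : R) : 0 < l ->
    l <= u -> u <= r -> l <= w -> w <= r ->
    1 = u * d -> w * De = D2 * d * d -> 0 < L -> L <= D2 -> D2 <= M ->
  L / r ^+ 3 <= De /\ De <= M / l ^+ 3.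
Proof.
move=> l0 u1 u2 w1 w2 ud wDe L0 LD DM.
have u0 : 0 < u by exact: lt_le_trans u1.
have w0 : 0 < w by exact: lt_le_trans w1.
have r0 : 0 < r by exact: lt_le_trans w2.
have D0 : 0 < D2 by exact: lt_le_trans LD.
have -> : De = D2 / (u * u * w).
  have -> : De = D2 * d * d / w by rewrite -wDe mulrC mulKf// gt_eqF.
  have -> : d = 1 / u by rewrite ud mulrC mulKf// gt_eqF.
  by field; rewrite !gt_eqF.
have p0 : 0 < u * u * w by rewrite !mulr_gt0.
have cube t : t ^+ 3 = t * t * t by rewrite !exprS expr0 mulr1 mulrA.
have p1 : u * u * w <= r ^+ 3.
  by rewrite cube; apply: ler_pM => //; [rewrite mulr_ge0// ltW|exact: ltW|apply: ler_pM => //; exact: ltW].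
have p2 : l ^+ 3 <= u * u * w.
  by rewrite cube; apply: ler_pM => //; [rewrite mulr_ge0// ltW|exact: ltW|apply: ler_pM => //; exact: ltW].
split.
  apply: (ler_pM (ltW L0) _ LD); first by rewrite invr_ge0 exprn_ge0// ltW.
  by rewrite lef_pV2// posrE exprn_gt0.
apply: (ler_pM (ltW D0) _ DM); first by rewrite invr_ge0 ltW.
by rewrite lef_pV2// posrE exprn_gt0.
Qed.

Variables (x0 c : R) (h theta phi : R -> R).
Hypothesis x00 : 0 < x0.
Hypothesis h_gt0 : forall x, x0 <= x -> 0 < h x.
Hypothesis h_incr : forall x y, x0 <= x -> x < y -> h x < h y.
Hypothesis h_derive : forall x, x0 < x -> is_derive x 1 h (h x * (c + theta x) / x).
Hypothesis phiP : inverse_on x0 h phi.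

Let dh x := h x * (c + theta x) / x.

(** Potter-type bound: ln h - a ln has derivative (c + theta - a) / x >= 0. *)
Lemma h_growth (X a : R) : x0 <= X -> (forall x, X < x -> a <= c + theta x) ->
  forall x y, X < x -> x <= y -> (y / x) `^ a <= h y / h x.
Proof.
move=> x0X ha x y Xx xy.
have xp t : X < t -> 0 < t by move=> Xt; rewrite (lt_trans x00)// (le_lt_trans x0X).
have xh t : X < t -> 0 < h t by move=> Xt; rewrite h_gt0// ltW// (le_lt_trans x0X).
have Xy : X < y by exact: lt_le_trans xy.
have fd t : X < t -> is_derive t 1 (fun t => ln (h t) - a * ln t) ((c + theta t - a) / t).
  move=> Xt; have hD := h_derive (le_lt_trans x0X Xt).
  have l1 := is_derive1_ln (xh t Xt).
  have l2 := is_derive1_ln (xp t Xt).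
  have l3 : is_derive t 1 (@ln R \o h) ((h t)^-1 * (h t * (c + theta t) / t)) by exact: is_derive1_comp.
  apply: is_derive_eq; rewrite /GRing.scale/=.
  by field; rewrite !gt_eqF ?xh ?xp.
have d0 t : X < t -> 0 <= (c + theta t - a) / t.
  by move=> Xt; rewrite divr_ge0 ?subr_ge0 ?ha// ltW// xp.
have := is_derive_homo fd d0 Xx xy => /= H.
rewrite -[leRHS]lnK ?posrE ?divr_gt0 ?xh// /powR gt_eqF ?divr_gt0 ?xp// ler_expR.
by rewrite !ln_div ?posrE ?xh ?xp//; lra.
Qed.

Lemma h_growth_le (X b : R) : x0 <= X -> (forall x, X < x -> c + theta x <= b) ->
  forall x y, X < x -> x <= y -> h y / h x <= (y / x) `^ b.
Proof.
move=> x0X hb x y Xx xy.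
have xp t : X < t -> 0 < t by move=> Xt; rewrite (lt_trans x00)// (le_lt_trans x0X).
have xh t : X < t -> 0 < h t by move=> Xt; rewrite h_gt0// ltW// (le_lt_trans x0X).
have Xy : X < y by exact: lt_le_trans xy.
have fd t : X < t -> is_derive t 1 (fun t => b * ln t - ln (h t)) ((b - (c + theta t)) / t).
  move=> Xt; have hD := h_derive (le_lt_trans x0X Xt).
  have l1 := is_derive1_ln (xh t Xt).
  have l2 := is_derive1_ln (xp t Xt).
  have l3 : is_derive t 1 (@ln R \o h) ((h t)^-1 * (h t * (c + theta t) / t)) by exact: is_derive1_comp.
  apply: is_derive_eq; rewrite /GRing.scale/=.
  by field; rewrite !gt_eqF ?xh ?xp.
have d0 t : X < t -> 0 <= (b - (c + theta t)) / t.
  by move=> Xt; rewrite divr_ge0 ?subr_ge0 ?hb// ltW// xp.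
have := is_derive_homo fd d0 Xx xy => /= H.
rewrite -[leLHS]lnK ?posrE ?divr_gt0 ?xh// /powR gt_eqF ?divr_gt0 ?xp// ler_expR.
by rewrite !ln_div ?posrE ?xh ?xp//; lra.
Qed.

Lemma phi_gt (X y : R) : x0 <= X -> h X < y -> X < phi y /\ h (phi y) = y.
Proof.
move=> x0X hXy; have [phi0 phiK] : x0 <= phi y /\ h (phi y) = y.
  apply: phiP.2; apply: le_trans (ltW hXy); move: x0X.
  by rewrite le_eqVlt => /predU1P[<-//|] /(h_incr (lexx _))/ltW.
split => //; rewrite ltNge; apply/negP; rewrite le_eqVlt => /predU1P[E|L].
  by move: hXy; rewrite -phiK E ltxx.
by have := h_incr phi0 L; rewrite phiK ltNge (ltW hXy).
Qed.

Lemma phi_lt (X y y' : R) : x0 <= X -> h X < y -> y < y' -> phi y < phi y'.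
Proof.
move=> x0X hy yy'; have [p1 p2] := phi_gt x0X hy.
have [p3 p4] := phi_gt x0X (lt_trans hy yy').
rewrite ltNge; apply/negP; rewrite le_eqVlt => /predU1P[E|L].
  by move: yy'; rewrite -p2 -p4 E ltxx.
have := h_incr (ltW (le_lt_trans x0X p3)) L.
by rewrite p2 p4 ltNge (ltW yy').
Qed.

Lemma phi_le (X y y' : R) : x0 <= X -> h X < y -> y <= y' -> phi y <= phi y'.
Proof.
move=> x0X hy; rewrite le_eqVlt => /predU1P[<-//|yy'].
by rewrite ltW// (phi_lt x0X hy).
Qed.

Lemma phi_growth (X b : R) : x0 <= X -> 0 < b -> (forall x, X < x -> c + theta x <= b) ->
  forall y y', h X < y -> y <= y' -> (y' / y) `^ b^-1 <= phi y' / phi y.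
Proof.
move=> x0X b0 hb y y' hy yy'; have [p1 p2] := phi_gt x0X hy.
have [p3 p4] := phi_gt x0X (lt_le_trans hy yy').
have := h_growth_le x0X hb p1 (phi_le x0X hy yy').
rewrite p2 p4 => H.
have X0 : 0 < X by exact: lt_le_trans x0X.
have q0 : 0 <= phi y' / phi y by rewrite divr_ge0// ltW// (lt_trans X0).
have yp : 0 < y by apply: lt_trans hy; exact: h_gt0.
have y0 : 0 <= y' / y by rewrite divr_ge0 ?(ltW yp)// (le_trans (ltW yp)).
apply: (@le_trans _ _ (((phi y' / phi y) `^ b) `^ b^-1)).
  by rewrite ge0_ler_powR ?nnegrE ?powR_ge0// invr_ge0 ltW.
by rewrite -powRrM mulfV ?gt_eqF// powRr1.
Qed.

Lemma phi_growth_le (X a : R) : x0 <= X -> 0 < a -> (forall x, X < x -> a <= c + theta x) ->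
  forall y y', h X < y -> y <= y' -> phi y' / phi y <= (y' / y) `^ a^-1.
Proof.
move=> x0X a0 ha y y' hy yy'; have [p1 p2] := phi_gt x0X hy.
have [p3 p4] := phi_gt x0X (lt_le_trans hy yy').
have := h_growth x0X ha p1 (phi_le x0X hy yy').
rewrite p2 p4 => H.
have X0 : 0 < X by exact: lt_le_trans x0X.
have q0 : 0 <= phi y' / phi y by rewrite divr_ge0// ltW// (lt_trans X0).
have yp : 0 < y by apply: lt_trans hy; exact: h_gt0.
have y0 : 0 <= y' / y by rewrite divr_ge0 ?(ltW yp)// (le_trans (ltW yp)).
apply: (@le_trans _ _ (((phi y' / phi y) `^ a) `^ a^-1)).
  by rewrite -powRrM mulfV ?gt_eqF// powRr1.
by rewrite ge0_ler_powR ?nnegrE ?powR_ge0// invr_ge0 ltW.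
Qed.

Lemma phi_derive (X y : R) : x0 <= X -> (forall x, X < x -> 0 < c + theta x) -> h X < y ->
  derive1 phi y = phi y / (y * (c + theta (phi y))).
Proof.
move=> x0X hc hy; have [p1 p2] := phi_gt x0X hy.
have x0p : x0 < phi y by exact: le_lt_trans p1.
have pp : 0 < phi y by exact: lt_trans x0p.
have yp : 0 < y by rewrite -p2 h_gt0// ltW.
have cp := hc _ p1.
have D := h_derive x0p.
have dn0 : h (phi y) * (c + theta (phi y)) / phi y != 0.
  by rewrite gt_eqF// divr_gt0// mulr_gt0// p2.
have n1 : {near phi y, cancel h phi}.
  near=> t; apply: phiP.1; near: t.
  by apply: filterS (lt_nbhsr x0p) => t /ltW.
have n2 : {near phi y, continuous h}.
  near=> t; apply: differentiable_continuous; apply/derivable1_diffP.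
  apply: ex_derive; apply: h_derive; near: t; exact: lt_nbhsr.
have := is_derive_inverse n1 n2 D dn0; rewrite p2 => D'.
rewrite derive1E derive_val; field.
by rewrite !gt_eqF.
Unshelve. all: by end_near. Qed.

Hypothesis theta_derive : forall x, x0 < x -> is_derive x 1 theta (derive1 theta x).
Let kap x := (c + theta x) * (c + theta x - 1) + x * derive1 theta x.

Let dh_derive x : x0 < x -> is_derive x 1 dh (h x * kap x / x ^+ 2).
Proof.
move=> x0x; have hD := h_derive x0x; have tD := theta_derive x0x.
have xp : 0 < x by exact: lt_trans x0x.
have iD : is_derive x 1 (fun t : R => t^-1) (- x ^- 2 *: 1).
  by apply: (@is_deriveV R id) => //; rewrite gt_eqF.
rewrite /dh; apply: is_derive_eq.
rewrite /kap /GRing.scale/=; field.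
by rewrite gt_eqF.
Qed.

(* With [d] and [d'] consecutive increments of [phi] at [x1 = phi (y + 1)],
   [h (x1 + d) - 2 h x1 + h (x1 - d) = h'' d^2] and the left side is
   [h (x1 + d) - h (x1 + d') = h' (d - d')]. *)
Lemma phi_second_difference (X k eps : R) : x0 <= X -> 1 <= X -> 0 < k -> 0 <= eps ->
    (forall x, X < x -> 1 / 2 <= c + theta x <= 3) ->
    (forall x, X < x -> k * x `^ (- eps) <= kap x <= 4) ->
  exists2 k1, 0 < k1 & exists2 C, 0 < C & forall y, h X < y -> 1 <= y ->
    k1 * (phi y * phi y `^ (- eps)) / y ^+ 2 <=
      (phi (y + 1) - phi y) - (phi (y + 2) - phi (y + 1)) <= C * phi y / y ^+ 2.
Proof.
move=> x0X X1 k0 e0 hc hk.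
have [A A0 AE] : exists2 A : R, 0 < A & 7 ^+ 3 = A by exists (7 ^+ 3) => //; rewrite exprn_gt0.
exists (k * 7 `^ (- eps) / (49 * (3 * A) ^+ 3)).
  by rewrite divr_gt0 ?mulr_gt0 ?powR_gt0// exprn_gt0// mulr_gt0.
exists (4 * A * 14 ^+ 3); first by rewrite mulr_gt0 ?mulr_gt0// exprn_gt0.
move=> y hy y1.
have yp : 0 < y by exact: lt_le_trans y1.
have y1y : y <= y + 1 by rewrite lerDl.
have y2y : y + 1 <= y + 2 by lra.
have [Xx hx] := phi_gt x0X hy.
have [Xx1 hx1] := phi_gt x0X (lt_le_trans hy y1y).
have [Xx2 hx2] := phi_gt x0X (lt_le_trans hy (le_trans y1y y2y)).
have xx1 : phi y < phi (y + 1) by apply: (phi_lt x0X hy); rewrite ltrDl.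
have x1x2 : phi (y + 1) < phi (y + 2).
  by apply: (phi_lt x0X (lt_le_trans hy y1y)); rewrite ltrD2l; lra.
have half0 : 0 < 1 / 2 :> R by lra.
have := phi_growth_le x0X half0 (fun x Xx => proj1 (andP (hc x Xx))) hy y1y.
set x := phi y in Xx hx xx1 *; set x1 := phi (y + 1) in Xx1 hx1 xx1 x1x2 *.
set x2 := phi (y + 2) in Xx2 hx2 x1x2 *.
have xp : 0 < x by rewrite (lt_trans _ Xx)// (lt_le_trans ltr01).
have -> : (1 / 2)^-1 = 2%:R :> R by field.
rewrite powR_mulrn; last by rewrite divr_ge0 ?(ltW yp)// addr_ge0// ltW.
(* Since (y + 1) / y <= 2, the growth exponent 2 of phi gives 4. Then d <= 3 x, every point met
   below is at most x1 + d <= 7 x, and the growth exponent 3 of h accounts for A = 7^3. *)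
move=> gr; have x14 : x1 <= 4 * x.
  rewrite -ler_pdivrMr//; apply: (le_trans gr).
  have : (y + 1) / y <= 2 by rewrite ler_pdivrMr//; lra.
  have : 0 <= (y + 1) / y by rewrite divr_ge0 ?(ltW yp)// addr_ge0// ltW.
  by move: ((y + 1) / y) => t; nra.
pose d := x1 - x.
have d0 : 0 < d by rewrite subr_gt0.
have X0 : x0 < x by exact: le_lt_trans Xx.
have rng t : x <= t -> t <= x1 + d -> [/\ X < t, t <= 7 * x, y <= h t & h t <= A * y].
  move=> xt tx; have Xt : X < t by exact: lt_le_trans xt.
  have t7 : t <= 7 * x by rewrite (le_trans tx)// /d; lra.
  split => //.
    rewrite -hx; move: xt; rewrite le_eqVlt => /predU1P[->//|xt].
    by rewrite ltW// h_incr// ltW.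
  have := h_growth_le x0X (fun x Xx => proj2 (andP (hc x Xx))) Xx xt.
  rewrite hx powR_mulrn; last by rewrite divr_ge0// ltW// (lt_le_trans xp).
  move=> H; rewrite -ler_pdivrMr//; apply: (le_trans H).
  have t7' : t / x <= 7 by rewrite ler_pdivrMr.
  rewrite -AE lerXn2r ?nnegrE//.
  by rewrite divr_ge0// ltW// (lt_le_trans xp).
have dh_rng t : x <= t -> t <= x1 + d -> y / (14 * x) <= dh t /\ dh t <= 3 * A * y / x.
  move=> xt tx; have [Xt t7 h1 h2] := rng t xt tx.
  have /andP[c1 c2] := hc t Xt.
  have tp : 0 < t by exact: lt_le_trans xt.
  split.
    rewrite /dh ler_pdivrMr ?mulr_gt0// mulrAC ler_pdivlMr//.
    have : y * (1 / 2) <= h t * (c + theta t).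
      by apply: ler_pM => //; exact: ltW.
    by move: (h t * (c + theta t)) => z; nra.
  rewrite /dh ler_pdivrMr// mulrAC ler_pdivlMr//.
  have z1 : h t * (c + theta t) <= A * y * 3.
    apply: ler_pM => //; last by lra.
    by rewrite (le_trans _ h1)// ltW.
  have z0 : 0 <= h t * (c + theta t) by rewrite mulr_ge0//; [rewrite (le_trans _ h1)// ltW|lra].
  by move: (h t * (c + theta t)) z0 z1 => z; nra.
have ddh_rng t : x <= t -> t <= x1 + d ->
    y * (k * (7 * x) `^ (- eps)) / (49 * x ^+ 2) <= h t * kap t / t ^+ 2 /\
    h t * kap t / t ^+ 2 <= 4 * A * y / x ^+ 2.
  move=> xt tx; have [Xt t7 h1 h2] := rng t xt tx.
  have /andP[k1 k2] := hk t Xt.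
  have tp : 0 < t by exact: lt_le_trans xt.
  have te : (7 * x) `^ (- eps) <= t `^ (- eps).
    rewrite !powRN lef_pV2 ?posrE ?powR_gt0 ?mulr_gt0//.
    by rewrite ge0_ler_powR ?nnegrE ?mulr_ge0// ltW.
  have z0 : 0 <= k * (7 * x) `^ (- eps) by rewrite mulr_ge0 ?powR_ge0// ltW.
  have z1 : k * (7 * x) `^ (- eps) <= kap t by apply: le_trans k1; rewrite ler_pM2l.
  have z2 : y * (k * (7 * x) `^ (- eps)) <= h t * kap t by apply: ler_pM => //; exact: ltW.
  have z3 : h t * kap t <= A * y * 4.
    apply: ler_pM => //; first by rewrite (le_trans _ h1)// ltW.
    exact: le_trans z1.
  have z4 : 0 <= y * (k * (7 * x) `^ (- eps)) by rewrite mulr_ge0// ltW.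
  have t2 : x ^+ 2 <= t ^+ 2 by rewrite lerXn2r ?nnegrE// ltW.
  have t3 : t ^+ 2 <= 49 * x ^+ 2.
    by rewrite (_ : 49 * _ = (7 * x) ^+ 2); [rewrite lerXn2r ?nnegrE// ?mulr_ge0// ltW|ring].
  have t0 : 0 < t ^+ 2 by rewrite exprn_gt0.
  have s0 : 0 < x ^+ 2 by rewrite exprn_gt0.
  split.
    apply: ler_pM => //; first by rewrite invr_ge0 mulr_ge0// ltW.
    by rewrite lef_pV2 ?posrE ?mulr_gt0.
  apply: ler_pM => //; first exact: le_trans z2.
    by rewrite invr_ge0 ltW.
    by lra.
  by rewrite lef_pV2.
have [xi /andP[xi1 xi2]] := MVT_ray h_derive X0 xx1.
rewrite hx hx1 -/(dh xi) -/d (_ : y + 1 - y = 1); last by ring.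
move=> dE.
have [dh1 dh2] : y / (14 * x) <= dh xi /\ dh xi <= 3 * A * y / x.
  by apply: dh_rng; [exact: ltW|rewrite (le_trans (ltW xi2))// lerDl ltW].
(* The second difference of h is v (x1 + d) - v x1; the mean value theorem for v, and then for h',
   turns it into h''(eta) d^2. *)
pose v t := h t - h (t - d).
have vD t : x0 + d < t -> is_derive t 1 v (dh t - dh (t - d)).
  move=> xt; have ht : x0 < t by apply: lt_trans xt; rewrite ltrDl.
  have htd : x0 < t - d by rewrite ltrBrDr.
  have D1 := h_derive ht; have D2 := h_derive htd.
  have D3 : is_derive t 1 (h \o (fun t => t - d)) (dh (t - d) * 1).
    apply: is_derive1_comp; have := @is_deriveB _ _ _ id (cst d) t 1 1 0.
    by rewrite subr0; apply.
  rewrite -[X in _ - X]mulr1; exact: is_deriveB.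
have x0d : x0 + d < x1 by rewrite /d; lra.
have [tau /andP[tau1 tau2]] := MVT_ray vD x0d (ltr_pwDr d0 (lexx x1)).
have x0td : x0 < tau - d by rewrite ltrBrDr (lt_trans x0d).
have tdt : tau - d < tau by rewrite ltrBlDr ltrDl.
have [eta /andP[eta1 eta2] etaE] := MVT_ray dh_derive x0td tdt.
rewrite etaE /v (_ : x1 + d - d = x1); last by ring.
rewrite (_ : x1 - d = x); last by rewrite /d; ring.
rewrite (_ : tau - (tau - d) = d); last by ring.
rewrite (_ : x1 + d - x1 = d); last by ring.
rewrite hx hx1 => sE.
have [dd1 dd2] : y * (k * (7 * x) `^ (- eps)) / (49 * x ^+ 2) <= h eta * kap eta / eta ^+ 2 /\
    h eta * kap eta / eta ^+ 2 <= 4 * A * y / x ^+ 2.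
  by apply: ddh_rng; move: tau1 tau2 eta1 eta2; rewrite /d; lra.
set D2 := h eta * kap eta / eta ^+ 2 in sE dd1 dd2.
have L0 : 0 < y * (k * (7 * x) `^ (- eps)) / (49 * x ^+ 2).
  by rewrite divr_gt0 ?mulr_gt0 ?powR_gt0 ?mulr_gt0// exprn_gt0.
have D20 : 0 < D2 by exact: lt_le_trans dd1.
(* h (x1 + d) equals y + 2 + h''(eta) d^2, so the value y + 2 is attained before x1 + d. *)
have hd : h x2 < h (x1 + d).
  rewrite hx2; have : 0 < D2 * d * d by do 2?apply: mulr_gt0.
  by lra.
have x2d : x2 < x1 + d.
  rewrite ltNge; apply/negP; rewrite le_eqVlt => /predU1P[E|L].
    by move: hd; rewrite E ltxx.
  have : x0 <= x1 + d by rewrite ltW// (lt_trans X0)// (lt_trans xx1)// ltrDl.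
  by move=> /h_incr/(_ L)/lt_trans/(_ hd); rewrite ltxx.
have [zeta /andP[ze1 ze2] zeE] := MVT_ray h_derive (le_lt_trans x0X Xx2) x2d.
have [dz1 dz2] : y / (14 * x) <= dh zeta /\ dh zeta <= 3 * A * y / x.
  by apply: dh_rng; [rewrite ltW// (lt_trans xx1)// (lt_trans x1x2)|exact: ltW].
have -> : d - (x2 - x1) = x1 + d - x2 by ring.
set De := x1 + d - x2.
have DeE : dh zeta * De = D2 * d * d.
  by rewrite -[LHS]zeE hx2; move: sE; lra.
have yx14 : 0 < y / (14 * x) by rewrite divr_gt0// mulr_gt0.
have [lo up] := increment_quotient_bounds yx14 dh1 dh2 dz1 dz2 dE DeE L0 dd1 dd2.
apply/andP; split.
  apply: le_trans lo; rewrite powRM ?(ltW xp)// le_eqVlt; apply/orP; left; apply/eqP.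
  by field; rewrite !gt_eqF// mulr_gt0.
apply: (le_trans up); rewrite le_eqVlt; apply/orP; left; apply/eqP.
by field; rewrite !gt_eqF.
Qed.

End InverseFunctions.

(** * Exponential sums along inverse functions *)

Section ExponentialSums.
Variable R : realType.
Local Notation e := (@e2pi R).
Local Notation frac := (@Defs.frac R).

Lemma powR_small (K a : R) : 0 <= K -> 0 < a ->
  exists X : nat, forall n : nat, (X <= n)%N -> (0 < n)%N /\ K * n%:R `^ (- a) <= 1.
Proof.
move=> K0 a0; exists (Num.truncn (K `^ a^-1)).+1 => n Xn.
have n0 : (0 < n)%N by exact: leq_trans Xn.
split => //; rewrite powRN ler_pdivrMr ?powR_gt0 ?ltr0n// mul1r.
have -> : K = (K `^ a^-1) `^ a by rewrite -powRrM mulVf ?gt_eqF// powRr1.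
rewrite ge0_ler_powR ?nnegrE ?powR_ge0 ?(ltW a0)//.
rewrite (le_trans (ltW (truncnS_gt _)))//.
by rewrite ler_nat.
Qed.

Section Concave.
Variables (u : nat -> R) (n1 : nat) (k1 C1 eps : R).
Hypothesis n10 : (0 < n1)%N.
Hypothesis k10 : 0 < k1.
Hypothesis C10 : 0 < C1.
Hypothesis eps01 : 0 <= eps <= 1.
Hypothesis u1 : forall n, (n1 <= n)%N -> 0 < u n.
Hypothesis u_mono : forall m n, (n1 <= m)%N -> (m <= n)%N -> u m <= u n.
Hypothesis u_double : forall n, (n1 <= n)%N -> u n.*2 <= 4 * u n.
Hypothesis u_diff : forall n, (n1 <= n)%N ->
  k1 * (u n * u n `^ (- eps)) / n%:R ^+ 2 <= (u n.+1 - u n) - (u n.+2 - u n.+1) <=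
    C1 * u n / n%:R ^+ 2.

Let powR_split (y : R) : 0 < y -> y * y `^ (- eps) = y `^ (1 - eps).
Proof.
move=> y0; rewrite powRD; last by rewrite (gt_eqF y0) implybT.
by rewrite powRr1// ltW.
Qed.

(** The minus sign makes the phase convex, the linear term n xi does not affect second differences,
    and on a dyadic block these lie between [l] and [L], up to constants m phi1(X)^(1 - eps) / X^2
    and m phi1(X) / X^2. *)
Let concave_neg (X a b m : nat) (xi : R) : (n1 <= X)%N -> (X <= a)%N -> (b <= X.*2)%N ->
    (0 < m)%N -> m%:R * k1 * (u X * u X `^ (- eps)) / (4 * X%:R ^+ 2) <= 1 ->
  normc (\sum_(a <= n < b) e (- (m%:R * u n) + n%:R * xi)) <=
    (4 * m%:R * C1 * u X / X%:R + 3) *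
    (11 / Num.sqrt (m%:R * k1 * (u X * u X `^ (- eps)) / (4 * X%:R ^+ 2))).
Proof.
move=> nX Xa bX m0 l1; have /andP[e0 e1] := eps01.
set l := (m%:R * k1 * _ / _) in l1 *.
have X0 : (0 < X)%N by exact: leq_trans nX.
have XR : 0 < X%:R :> R by rewrite ltr0n.
have mR : 0 < m%:R :> R by rewrite ltr0n.
have Y0 := u1 nX.
have l0 : 0 < l by rewrite divr_gt0 ?mulr_gt0 ?powR_gt0// exprn_gt0.
have s0 : 0 <= 11 / Num.sqrt l by rewrite divr_ge0 ?sqrtr_ge0.
have q0 : 0 <= 4 * m%:R * C1 * u X / X%:R.
  by apply: divr_ge0; [do 3?apply: mulr_ge0|]; rewrite ?(ltW C10) ?(ltW Y0)//.
have [ba|ab] := leqP b a.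
  by rewrite big_geq// normc0; apply: mulr_ge0 => //; apply: addr_ge0.
pose L := 4 * m%:R * C1 * u X / X%:R ^+ 2.
have L0 : 0 <= L.
  by apply: divr_ge0; [do 3?apply: mulr_ge0|rewrite sqr_ge0]; rewrite ?(ltW C10) ?(ltW Y0)//.
apply: (@le_trans _ _ ((L * (b - a)%:R + 3) * (11 / Num.sqrt l))); last first.
  apply: ler_wpM2r => //; rewrite lerD2r.
  have -> : 4 * m%:R * C1 * u X / X%:R = L * X%:R by rewrite /L; field; rewrite gt_eqF.
  apply: ler_wpM2l => //; rewrite ler_nat; clear -Xa bX; lia.
apply: second_difference_test => //; [by rewrite l0|exact: ltnW|] => n an nb.
have nn : (n1 <= n)%N by rewrite (leq_trans nX)// (leq_trans Xa).
have Xn : (X <= n)%N by exact: leq_trans an.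
have nR : 0 < n%:R :> R by rewrite ltr0n (leq_trans X0).
have -> : (- (m%:R * u n.+2) + n.+2%:R * xi - (- (m%:R * u n.+1) + n.+1%:R * xi) -
   (- (m%:R * u n.+1) + n.+1%:R * xi - (- (m%:R * u n) + n%:R * xi))) =
   m%:R * ((u n.+1 - u n) - (u n.+2 - u n.+1)).
  by rewrite -[n.+2%:R]natr1 -[n.+1%:R]natr1; ring.
have /andP[d1 d2] := u_diff nn.
have uXn := u_mono nX Xn.
have Un := u1 nn.
have n2X : n%:R <= 2 * X%:R :> R by rewrite -natrM ler_nat; clear -nb bX; lia.
apply/andP; split.
  rewrite /l -2!mulrA ler_pM2l//; apply: le_trans d1.
  rewrite mulrA; apply: ler_pM.
  - by rewrite mulr_ge0 ?(ltW k10)// mulr_ge0 ?powR_ge0// ltW.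
  - by rewrite invr_ge0 mulr_ge0// sqr_ge0.
  - rewrite ler_pM2l// !powR_split//.
    by rewrite ge0_ler_powR ?nnegrE ?subr_ge0 ?(ltW Un) ?(ltW Y0).
  - rewrite lef_pV2 ?posrE ?mulr_gt0 ?exprn_gt0//.
    by rewrite (_ : 4 * _ = (2 * X%:R) ^+ 2); [rewrite lerXn2r ?nnegrE// ?mulr_ge0// ltW|ring].
rewrite (_ : L = m%:R * (C1 * (4 * u X) / X%:R ^+ 2)); last by rewrite /L; field; rewrite gt_eqF.
rewrite ler_pM2l//; apply: (le_trans d2).
apply: ler_pM.
- by rewrite mulr_ge0// ltW.
- by rewrite invr_ge0 sqr_ge0.
- rewrite ler_pM2l//; apply: le_trans (u_double nX); apply: u_mono => //; clear -nb bX; lia.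
- by rewrite lef_pV2 ?posrE ?exprn_gt0// lerXn2r ?nnegrE ?ler_nat.
Qed.

(** The sign needed for B_+ is recovered from the other one by conjugation, with xi replaced by its
    opposite. *)
Lemma concave_exp_sum (s : bool) (X a b m : nat) (xi : R) :
    (n1 <= X)%N -> (X <= a)%N -> (b <= X.*2)%N ->
    (0 < m)%N -> m%:R * k1 * (u X * u X `^ (- eps)) / (4 * X%:R ^+ 2) <= 1 ->
  normc (\sum_(a <= n < b) e (m%:R * ((-1) ^+ s * u n) + n%:R * xi)) <=
    (4 * m%:R * C1 * u X / X%:R + 3) *
    (11 / Num.sqrt (m%:R * k1 * (u X * u X `^ (- eps)) / (4 * X%:R ^+ 2))).
Proof.
case: s => nX Xa bX m0 l1.
  under eq_bigr do rewrite expr1 mulN1r mulrN.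
  exact: concave_neg.
rewrite -normc_conj conjc_sum.
rewrite (eq_bigr (fun n => e (- (m%:R * u n) + n%:R * (- xi)))); first exact: concave_neg.
by move=> n _; rewrite -e2piN expr0 mul1r opprD mulrN.
Qed.

Variables (W : nat -> R) (g g2 sigma A cY CY cW : R).
Hypothesis A0 : 0 < A.
Hypothesis cY0 : 0 < cY.
Hypothesis CY0 : 0 < CY.
Hypothesis cW0 : 0 < cW.
Hypothesis u_lo : forall n, (n1 <= n)%N -> cY * n%:R `^ (g - eps) <= u n.
Hypothesis u_hi : forall n, (n1 <= n)%N -> u n <= CY * n%:R `^ (g + eps).
Hypothesis W_lo : forall n, (n1 <= n)%N -> cW * n%:R `^ (g2 - eps) <= W n.
Hypothesis sigma1 : (1 - g2 + eps) / 2 + (g + eps) * (1 + eps) / 2 <= sigma.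
Hypothesis sigma2 : 1 - (g - eps) * (1 - eps) / 2 <= sigma.
Hypothesis small_exponent : (1 - g2 + eps) + (g + eps) * (1 - eps) < 2.

(** With Y = u X the bound is sqrt m Y^((1+eps)/2) + X / (sqrt m Y^((1-eps)/2)) up to constants. The
    first term is worst for the largest m, about X^(1 - g2 + eps), and gives [sigma1]; the second is
    worst at m = 1 and gives [sigma2]. [small_exponent] keeps the second differences below 1 for
    large X. *)
Lemma exp_sum_power_saving (s : bool) : exists n2 : nat, exists2 S0 : R, 0 <= S0 &
  forall X a b m xi, (n2 <= X)%N -> (X <= a)%N -> (b <= X.*2)%N ->
  (0 < m)%N -> m%:R * W X <= A * X%:R ->
  normc (\sum_(a <= n < b) e (m%:R * ((-1) ^+ s * u n) + n%:R * xi)) <= S0 * X%:R `^ sigma.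
Proof.
have /andP[e0 e1] := eps01.
pose Am := A / cW.
have Am0 : 0 < Am by rewrite divr_gt0.
pose t := 1 - g2 + eps.
pose dlt := 2 - (t + (g + eps) * (1 - eps)).
have dlt0 : 0 < dlt by rewrite subr_gt0.
have K0 : 0 <= Am * k1 * CY `^ (1 - eps) by rewrite mulr_ge0 ?powR_ge0// mulr_ge0// ltW.
have [n2 Hn2] := powR_small K0 dlt0.
pose S0 := 88 * C1 / Num.sqrt k1 * (Num.sqrt Am * CY `^ ((1 + eps) / 2)) +
           66 / Num.sqrt k1 * cY `^ (- ((1 - eps) / 2)).
have sk0 : 0 < Num.sqrt k1 by rewrite sqrtr_gt0.
have S00 : 0 <= S0.
  by rewrite addr_ge0 ?mulr_ge0 ?powR_ge0 ?invr_ge0 ?sqrtr_ge0// ltW.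
exists (maxn n1 n2), S0 => // X a b m xi; rewrite geq_max => /andP[nX n2X] Xa bX m0 mW.
have [X0 small] := Hn2 X n2X.
have XR : 0 < X%:R :> R by rewrite ltr0n.
have X1 : 1 <= X%:R :> R by rewrite ler1n.
have mR : 0 < m%:R :> R by rewrite ltr0n.
have m1 : 1 <= m%:R :> R by rewrite ler1n.
have Y0 := u1 nX.
pose Y := u X; rewrite -/Y in Y0.
have Xn0 r r' : X%:R `^ (r + r') = X%:R `^ r * X%:R `^ r' :> R.
  by rewrite powRD// (gt_eqF XR) implybT.
have mt : m%:R <= Am * X%:R `^ t.
  have WX := W_lo nX.
  have : m%:R * (cW * X%:R `^ (g2 - eps)) <= A * X%:R by apply: le_trans mW; rewrite ler_pM2l.
  have -> : X%:R `^ t = X%:R / X%:R `^ (g2 - eps).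
    rewrite -powRN -[X in _ = X * _](@powRr1 _ X%:R) ?ler0n// -Xn0; congr (_ `^ _).
    by rewrite /t; ring.
  move=> h; rewrite mulrA ler_pdivlMr ?powR_gt0// /Am mulrAC ler_pdivlMr//.
  by apply: le_trans h; rewrite le_eqVlt; apply/orP; left; apply/eqP; ring.
have l1 : m%:R * k1 * (u X * u X `^ (- eps)) / (4 * X%:R ^+ 2) <= 1.
  rewrite powR_split// ler_pdivrMr ?mulr_gt0 ?exprn_gt0// mul1r.
  have Yp : Y `^ (1 - eps) <= CY `^ (1 - eps) * X%:R `^ ((g + eps) * (1 - eps)).
    rewrite powRrM -powRM ?powR_ge0 ?(ltW CY0)//.
    by rewrite ge0_ler_powR ?nnegrE ?subr_ge0 ?mulr_ge0 ?powR_ge0 ?(ltW Y0) ?(ltW CY0)// u_hi.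
  apply: (@le_trans _ _ (X%:R ^+ 2)); last by rewrite ler_peMl ?sqr_ge0//; lra.
  apply: (@le_trans _ _ ((Am * X%:R `^ t) * k1 * (CY `^ (1 - eps) * X%:R `^ ((g + eps) * (1 - eps))))).
    apply: ler_pM => //; [by rewrite mulr_ge0// ltW|exact: powR_ge0|].
    by rewrite ler_wpM2r// ltW.
  have -> : (Am * X%:R `^ t) * k1 * (CY `^ (1 - eps) * X%:R `^ ((g + eps) * (1 - eps))) =
     Am * k1 * CY `^ (1 - eps) * X%:R `^ (- dlt) * X%:R ^+ 2.
    rewrite -[X%:R ^+ 2]powR_mulrn ?ler0n// -[RHS]mulrA -Xn0.
    have -> : - dlt + 2%:R = t + (g + eps) * (1 - eps) by rewrite /dlt; ring.
    by rewrite (Xn0 t); ring.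
  by rewrite ler_piMl ?sqr_ge0.
apply: (le_trans (concave_exp_sum s xi nX Xa bX m0 l1)).
set l := m%:R * k1 * _ / _ in l1 *.
pose q := Y `^ ((1 - eps) / 2).
have q0 : 0 < q by rewrite powR_gt0.
pose sm : R := Num.sqrt m%:R.
have sm0 : 0 < sm by rewrite sqrtr_gt0.
have sm1 : 1 <= sm by rewrite -[leLHS]sqrtr1 ler_sqrt.
have smE : m%:R = sm * sm by rewrite -expr2 sqr_sqrtr// ltW.
have skE : k1 = Num.sqrt k1 * Num.sqrt k1 by rewrite -expr2 sqr_sqrtr// ltW.
have lE : Num.sqrt l = sm * Num.sqrt k1 * q / (2 * X%:R).
  have r0 : 0 <= sm * Num.sqrt k1 * q / (2 * X%:R).
    by apply: divr_ge0; [do 2?apply: mulr_ge0; exact: ltW|rewrite mulr_ge0// ltW].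
  rewrite -[RHS](ger0_norm r0) -sqrtr_sqr; congr Num.sqrt.
  have qE : q ^+ 2 = Y * Y `^ (- eps).
    by rewrite -powR_mulrn ?powR_ge0// -powRrM powR_split//; congr (_ `^ _); lra.
  rewrite expr_div_n 2!exprMn qE /l -/Y (sqr_sqrtr (ler0n _ m)) (sqr_sqrtr (ltW k10)).
  by field; rewrite gt_eqF.
rewrite lE.
have YqE : Y / q = Y `^ ((1 + eps) / 2).
  rewrite /q -powRN -[X in X * _](@powRr1 _ Y) ?(ltW Y0)// -powRD; last by rewrite (gt_eqF Y0) implybT.
  by congr (_ `^ _); field.
have -> : (4 * m%:R * C1 * u X / X%:R + 3) * (11 / (sm * Num.sqrt k1 * q / (2 * X%:R))) =
   88 * C1 / Num.sqrt k1 * (sm * (Y / q)) + 66 / Num.sqrt k1 * (X%:R / q) / sm.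
  by rewrite [m%:R]smE -/Y; field; rewrite !gt_eqF.
rewrite /S0 [leRHS]mulrDl; apply: lerD.
  rewrite -[leRHS]mulrA; apply: ler_wpM2l.
    by rewrite mulr_ge0 ?invr_ge0 ?sqrtr_ge0// mulr_ge0// ltW.
  have smt : sm <= Num.sqrt Am * X%:R `^ (t / 2).
    have -> : X%:R `^ (t / 2) = Num.sqrt (X%:R `^ t) :> R by rewrite powRrM powR12_sqrt// powR_ge0.
    by rewrite -sqrtrM ?(ltW Am0)// ler_sqrt// mulr_ge0 ?powR_ge0// ltW.
  have Yh : Y / q <= CY `^ ((1 + eps) / 2) * X%:R `^ ((g + eps) * ((1 + eps) / 2)).
    rewrite YqE [X in _ <= _ * X]powRrM -powRM ?powR_ge0 ?(ltW CY0)//.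
    rewrite ge0_ler_powR ?nnegrE ?mulr_ge0 ?powR_ge0 ?(ltW Y0) ?(ltW CY0) ?u_hi//.
    by lra.
  apply: (le_trans (ler_pM (ltW sm0) _ smt Yh)); first by rewrite divr_ge0// ltW.
  rewrite mulrACA ler_wpM2l ?mulr_ge0 ?powR_ge0 ?sqrtr_ge0// -Xn0 ler_powR//.
  by apply: le_trans sigma1; rewrite /t le_eqVlt; apply/orP; left; apply/eqP; field.
apply: (@le_trans _ _ (66 / Num.sqrt k1 * (X%:R / q))).
  rewrite ler_pdivrMr// ler_peMr// mulr_ge0// ?divr_ge0// ?(ltW q0)// ltW//.
rewrite -[leRHS]mulrA; apply: ler_wpM2l; first by rewrite divr_ge0// sqrtr_ge0.
have ql : cY `^ ((1 - eps) / 2) * X%:R `^ ((g - eps) * ((1 - eps) / 2)) <= q.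
  rewrite [X in _ * X <= _]powRrM -powRM ?powR_ge0 ?(ltW cY0)//.
  rewrite ge0_ler_powR ?nnegrE ?mulr_ge0 ?powR_ge0 ?(ltW Y0) ?(ltW cY0) ?u_lo//.
  by lra.
rewrite ler_pdivrMr// (le_trans _ (ler_wpM2l _ ql))//; last by rewrite mulr_ge0 ?powR_ge0.
rewrite mulrACA -powRD; last by rewrite (gt_eqF cY0) implybT.
rewrite addNr powRr0 mul1r -Xn0 -[leLHS](@powRr1 _ X%:R) ?ler0n// ler_powR//.
by have := sigma2; lra.
Qed.

End Concave.

(** Counting only the upper half of [1, N] suffices, because W N <= 4 W X there. The main term of
    [arc_count_ge] is at least kap W X / 72, and the last hypothesis makes its error at most half of
    that. *)
Lemma count_lower_bound (B : pred nat) (x W : nat -> R) (n2 : nat) (S0 sigma kap : R) :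
    0 < kap -> 0 <= S0 -> (2 <= n2)%N ->
    (forall n, (n2 <= n)%N -> 0 < W n) ->
    (forall n, (n2 <= n)%N -> kap * W n <= n%:R) ->
    (forall m n, (n2 <= m)%N -> (m <= n <= m.*2)%N -> W n <= 4 * W m) ->
    (forall X n, (n2 <= X)%N -> (X <= n <= X.*2)%N -> frac (x n) < kap * W X / X%:R -> B n) ->
    (forall X a b m xi, (n2 <= X)%N -> (X <= a)%N -> (b <= X.*2)%N ->
      (0 < m)%N -> m%:R * W X <= 18 / kap * X%:R ->
      normc (\sum_(a <= n < b) e (m%:R * x n + n%:R * xi)) <= S0 * X%:R `^ sigma) ->
    (forall X, (n2 <= X)%N -> 4 * S0 * X%:R `^ sigma <= kap / 72 * W X) ->
  exists2 C, 0 < C & forall N, (n2.*2 <= N)%N -> W N <= C * \sum_(1 <= n < N.+1 | B n) 1.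
Proof.
move=> k0 S00 n22 W0 Wk W2 WB ES small.
exists (4 * (144 / kap)); first by rewrite mulr_gt0// divr_gt0.
move=> N nN; pose X := N./2.+1.
have NE := odd_double_half N.
have hX : [/\ (n2 <= X)%N, (N.+1 <= X.*2)%N, (X <= N)%N & (X <= (N.+1 - X).*2)%N].
  by rewrite /X; clear -NE nN n22; case: (odd N) NE => /=; split; lia.
have [nX N2X XN lenX] := hX.
have X0 : (0 < X)%N by rewrite (leq_trans _ nX)// (leq_trans _ n22).
have XR : 0 < X%:R :> R by rewrite ltr0n.
have WX := W0 X nX.
have kWX : 0 < kap * W X by rewrite mulr_gt0.
(* Q > r makes the arc 8/Q shorter than kap W X / X, so its points lie in B. From r >= 8 one gets Q
   <= 9 r / 8, and the frequencies up to 2 Q meet the bound 18 / kap. *)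
pose r := 8 * X%:R / (kap * W X).
have r8 : 8 <= r by rewrite /r ler_pdivlMr// ler_pM2l// Wk.
pose Q := (Num.truncn r).+1.
have Qr : r < Q%:R by exact: truncnS_gt.
have rQ : Q%:R <= r + 1.
  by rewrite /Q -natr1 lerD2r truncn_le (le_trans _ r8).
have Q8 : (8 <= Q)%N by rewrite -(ler_nat R) (le_trans r8)// ltW.
have Q0 : 0 < Q%:R :> R by rewrite ltr0n.
have Q98 : Q%:R <= 9 / 8 * r.
  by apply: (le_trans rQ); move: r8; move: (r) => r' r8'; lra.
have QW : Q%:R * W X <= 9 / kap * X%:R.
  apply: (@le_trans _ _ (9 / 8 * r * W X)); first by rewrite ler_pM2r.
  by rewrite /r le_eqVlt; apply/orP; left; apply/eqP; field; rewrite !gt_eqF.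
have S1 : 0 <= S0 * X%:R `^ sigma by rewrite mulr_ge0// powR_ge0.
have hS m : (0 < m <= Q.*2)%N -> normc (\sum_(X <= n < N.+1) e (m%:R * x n)) <= S0 * X%:R `^ sigma.
  move=> /andP[m0 mQ].
  rewrite (eq_bigr (fun n : nat => e (m%:R * x n + n%:R * 0))); last by move=> n _; rewrite mulr0 addr0.
  apply: ES => //; apply: (@le_trans _ _ (2 * Q%:R * W X)); last by lra.
  by rewrite ler_pM2r// -natrM ler_nat mul2n.
have cnt := arc_count_ge (leqW XN) Q8 S1 hS.
have cntB : \sum_(X <= n < N.+1) (frac (x n) < 8 / Q%:R)%R%:R <= \sum_(1 <= n < N.+1 | B n) 1 :> R.
  rewrite [leRHS]big_mkcond/= [leRHS](@big_cat_nat _ _ _ X)//=; last exact: leqW.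
  apply: ler_wpDl; first by apply: sumr_ge0 => n _; case: ifP.
  rewrite big_nat [leRHS]big_nat; apply: ler_sum => n /andP[Xn nN1].
  case: ltP => [xn|_]; last by case: ifP.
  rewrite (WB X n nX)//=; first by rewrite Xn ltnW// (leq_trans nN1).
  apply: (lt_le_trans xn); rewrite ler_pdivrMr// mulrAC ler_pdivlMr//.
  by move: Qr; rewrite /r ltr_pdivrMr// [ltRHS]mulrC => /ltW.
have WN : W N <= 4 * W X by apply: W2 => //; rewrite XN ltnW.
apply: (le_trans WN); rewrite -mulrA ler_pM2l//.
have len : X%:R <= 2 * (N.+1 - X)%:R :> R by rewrite -natrM ler_nat mul2n.
have main : kap / 72 * W X <= (N.+1 - X)%:R / (4 * Q%:R).
  rewrite ler_pdivlMr ?mulr_gt0//.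
  have : kap * (Q%:R * W X) <= kap * (9 / kap * X%:R) by rewrite ler_pM2l.
  rewrite (_ : kap * (9 / kap * X%:R) = 9 * X%:R); last by field; rewrite gt_eqF.
  by move: len; move: (Q%:R : R) (W X) ((N.+1 - X)%:R : R) (X%:R : R) => q w l xx; lra.
rewrite [leRHS]mulrAC ler_pdivlMr//; move: main cnt cntB.
have := small X nX; rewrite -[4 * S0 * _]mulrA.
set cc := \sum_(X <= n < N.+1) _; set bb := \sum_(1 <= n < N.+1 | B n) _.
by move: ((N.+1 - X)%:R / (4 * Q%:R)) (S0 * X%:R `^ sigma) => v w; lra.
Qed.

End ExponentialSums.

(** * Choice of exponents and assembly *)

Section Assembly.
Variable R : realType.
Local Notation e := (@e2pi R).
Local Notation frac := (@Defs.frac R).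

Lemma inverse_regular (c x0 eta : R) (h phi : R -> R) : 0 < x0 -> 1 <= c < 2 ->
    0 < eta <= 1 / 8 -> class_Rc c x0 h -> inverse_on x0 h phi ->
  exists2 Y, h x0 <= Y & [/\ 1 <= Y,
    (forall y, Y <= y -> 0 < phi y),
    (forall y y', Y <= y -> y <= y' ->
      [/\ phi y <= phi y', (y' / y) `^ (c^-1 - eta) <= phi y' / phi y &
          phi y' / phi y <= (y' / y) `^ (c^-1 + eta)]),
    (forall y, Y <= y -> phi y / (3 * y) <= derive1 phi y <= 2 * phi y / y) &
    exists2 k1, 0 < k1 & exists2 C1, 0 < C1 & forall y, Y <= y ->
      k1 * (phi y * phi y `^ (- eta)) / y ^+ 2 <=
        (phi (y + 1) - phi y) - (phi (y + 2) - phi (y + 1)) <= C1 * phi y / y ^+ 2].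
Proof.
move=> x00 hc /andP[e0 e8] hh hphi; have /andP[c1 c2] := hc.
have [_ h1 hincr _ _] := hh.
have c0 : 0 < c by exact: lt_le_trans c1.
have hpos x : x0 <= x -> 0 < h x by move=> /h1; exact: lt_le_trans.
have [theta [th0 hD tD kap]] := class_Rc_slow_variation x00 hh.
have [k k0 kapE] := kap c1 eta e0.
pose g := c^-1.
have g1 : g <= 1 by rewrite invf_le1.
have g2 : 1 / 2 < g by rewrite div1r ltf_pV2 ?posrE.
have ge0 : 0 < g - eta by lra.
have cE : c = g^-1 by rewrite invrK.
(* Growth exponents of h between a and b become exponents between g - eta and g + eta for its
   inverse. *)
pose b := (g - eta)^-1; pose a := (g + eta)^-1.
have a0 : 0 < a by rewrite invr_gt0; lra.
have b0 : 0 < b by rewrite invr_gt0.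
have cb : c < b by rewrite cE ltf_pV2 ?posrE//; lra.
have ac : a < c by rewrite cE ltf_pV2 ?posrE//; lra.
pose d := Num.min (1 / 2) (Num.min (b - c) (c - a)).
have d0 : 0 < d by rewrite !lt_min !subr_gt0 cb ac !andbT; lra.
have /cvgr0Pnorm_lt/(_ _ d0) T0 := th0.
have [X X01 HX] := near_pinftyP (filterI T0 kapE) (Num.max x0 1).
move: X01; rewrite ge_max => /andP[x0X X1].
have thX x : X < x -> `|theta x| < d by move=> /ltW/HX[].
have dE t : `|t| < d -> [/\ - (1/2) < t, t < 1/2, t < b - c & a - c < t].
  by rewrite !lt_min !ltr_norml => /and3P[/andP[? ?] /andP[? ?] /andP[? ?]]; split; lra.
have r1 x : X < x -> 1 / 2 <= c + theta x <= 3.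
  by move=> /thX/dE[? ? _ _]; apply/andP; split; lra.
have r2 x : X < x -> a <= c + theta x by move=> /thX/dE[_ _ _ ?]; lra.
have r3 x : X < x -> c + theta x <= b by move=> /thX/dE[_ _ ? _]; lra.
have r4 x : X < x -> k * x `^ (- eta) <= (c + theta x) * (c + theta x - 1) + x * derive1 theta x <= 4.
  by move=> /ltW/HX[].
have [k1 k10 [C1 C10 sd]] := phi_second_difference x00 hpos hincr hD hphi tD x0X X1 k0 (ltW e0) r1 r4.
have hX1 : 1 <= h X by exact: h1.
exists (h X + 1).
  apply: (@le_trans _ _ (h X)); last by rewrite lerDl.
  by move: x0X; rewrite le_eqVlt => /predU1P[->//|/(hincr _ _ (lexx _))/ltW].
have hY y : h X + 1 <= y -> h X < y by apply: lt_le_trans; rewrite ltrDl.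
have X0 : 0 < X by exact: lt_le_trans x0X.
have ph y : h X + 1 <= y -> 0 < phi y.
  by move=> /hY/(phi_gt hincr hphi x0X)[h' _]; exact: lt_trans h'.
split => //.
- by rewrite (le_trans hX1)// lerDl.
- move=> y y' /hY hy yy'; split; first exact: (phi_le hincr hphi x0X hy).
    by have := phi_growth x00 hpos hincr hD hphi x0X b0 r3 hy yy'; rewrite invrK.
  by have := phi_growth_le x00 hpos hincr hD hphi x0X a0 r2 hy yy'; rewrite invrK.
- move=> y Yy; have hy := hY _ Yy.
  have r0 x : X < x -> 0 < c + theta x by move=> /r1/andP[? _]; lra.
  rewrite (phi_derive x00 hpos hincr hD hphi x0X r0 hy).
  have [/r1/andP[q1 q2] _] := phi_gt hincr hphi x0X hy.
  have pp := ph _ Yy.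
  have yp : 0 < y by rewrite (lt_trans _ hy)// (lt_le_trans ltr01).
  set q := c + theta (phi y) in q1 q2 *.
  have q0 : 0 < q by lra.
  apply/andP; split.
    by rewrite ler_pM2l// lef_pV2 ?posrE ?mulr_gt0// (mulrC 3) ler_pM2l.
  rewrite ler_pdivrMr ?mulr_gt0//.
  have -> : 2 * phi y / y * (y * q) = phi y * (2 * q) by field; rewrite gt_eqF.
  by rewrite ler_peMr ?(ltW pp)//; lra.
- exists k1 => //; exists C1 => // y Yy; apply: sd; first exact: hY.
  by rewrite (le_trans _ Yy)// (le_trans hX1)// lerDl.
Qed.

(** [s0] is the van der Corput exponent without losses and [sst] the largest one that p_crit
    tolerates. The gap sst - s0 dictates e1, the gap g2 p - 2 dictates e2, and sigma = s0 + 2 eta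
    covers the losses in both van der Corput terms. *)
Lemma exponent_choice (g1 g2 p : R) : 1 / 2 < g1 <= 1 -> 5 / 6 < g2 <= 1 -> 2 < p ->
    12 * (1 - g2) <= (p - 2) * (g1 + 3 * g2 - 3) ->
  exists eta sigma : R, [/\ 0 < eta <= 1 / 8, 0 < sigma,
    (1 - g2 + eta) / 2 + (g1 + eta) * (1 + eta) / 2 <= sigma,
    1 - (g1 - eta) * (1 - eta) / 2 <= sigma &
    (1 - g2 + eta) + (g1 + eta) * (1 - eta) < 2] /\
    [/\ 0 < g2 - 2 * eta <= 1, 2 / (g2 - 2 * eta) < p,
    sigma * ((p - 2) / 2) + 1 <= (g2 - eta) * (p / 2) & sigma < g2 - eta].
Proof.
move=> /andP[g10 g11] /andP[g20 g21] p2 hp.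
pose s0 := Num.max (1 - g1 / 2) ((1 - g2 + g1) / 2).
pose sst := 1 / 2 + g2 / 2 - g1 / 6.
have s0lt : s0 < sst by rewrite /s0 gt_max /sst; apply/andP; split; lra.
have s01 : 1 - g1 / 2 <= s0 by rewrite le_max lexx.
have s02 : (1 - g2 + g1) / 2 <= s0 by rewrite le_max lexx orbT.
have p0 : 0 < p by lra.
have gp : 2 < g2 * p by nra.
pose e1 := (sst - s0) * (p - 2) / (4 * p); pose e2 := (g2 * p - 2) / (4 * p).
have e10 : 0 < e1 by rewrite divr_gt0 ?mulr_gt0 ?subr_gt0.
have e20 : 0 < e2 by rewrite divr_gt0 ?mulr_gt0 ?subr_gt0.
pose eta := Num.min (1 / 8) (Num.min e1 e2).
have eta0 : 0 < eta by rewrite !lt_min e10 e20; lra.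
have eta8 : eta <= 1 / 8 by rewrite ge_min lexx.
have etae1 : eta <= e1 by rewrite !ge_min lexx orbT.
have etae2 : eta <= e2 by rewrite !ge_min lexx !orbT.
have h1 : eta * (4 * p) <= (sst - s0) * (p - 2).
  by rewrite -ler_pdivlMr// mulr_gt0.
have h2 : eta * (4 * p) <= g2 * p - 2.
  by rewrite -ler_pdivlMr// mulr_gt0.
clearbody eta s0; move: h1; rewrite /sst => h1.
have et2 : 0 <= eta * eta by rewrite mulr_ge0// ltW.
have et3 : eta * eta <= eta by rewrite ler_piMr//; lra.
have g1e : 0 <= g1 * eta <= eta by rewrite mulr_ge0 ?ler_piMl//; lra.
have main : (s0 + 2 * eta) * ((p - 2) / 2) + 1 <= (g2 - eta) * (p / 2) by nra.
exists eta, (s0 + 2 * eta); split; split; rewrite ?eta0 ?eta8//.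
- by lra.
- by lra.
- by lra.
- by lra.
- by apply/andP; split; lra.
- by rewrite ltr_pdivrMr; lra.
(* The affordability inequality already forces sigma < g2 - eta, since g2 - eta < 1; this is what
   makes the error negligible in the count of B. *)
- have : (g2 - eta - (s0 + 2 * eta)) * ((p - 2) / 2) > 0 by nra.
  by rewrite pmulr_lgt0 ?subr_gt0//; lra.
Qed.

End Assembly.

Theorem theorem2 (R : realType) (c1 c2 : R)
    (hc1 : 1 <= c1 < 2) (hc2 : 1 <= c2 < 6 / 5)
    (x1 x2 x3 : R) (hx1 : 0 < x1) (hx2 : 0 < x2) (hx3 : 0 < x3)
    (h1 h2 phi1 phi2 psi : R -> R)
    (hh1 : class_Rc c1 x1 h1) (hh2 : class_Rc c2 x2 h2)
    (hphi1 : inverse_on x1 h1 phi1) (hphi2 : inverse_on x2 h2 phi2)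
    (psi_range : forall x, x3 <= x -> 0 < psi x <= 1 / 2)
    (psi_diff : twice_differentiable_on `[x3, +oo[ psi)
    (psi_lim0 : psi x / derive1 phi2 x @[x --> +oo] --> (1 : R))
    (psi_lim1 : derive1 psi x / derive1n 2 phi2 x @[x --> +oo] --> (1 : R))
    (psi_lim2 : derive1n 2 psi x / derive1n 3 phi2 x @[x --> +oo] --> (1 : R))
    (p : R) (hp : p_crit c1 c2 <= p) :
  exists2 C : R, 0 < C &
    forall (s : bool) (N : nat) (a : nat -> R[i]),
      (forall n, normc (a n) <= 1) ->
      (circle_Lnorm p (expsum (Bset s (h1 x1) x3 phi1 psi) N a) <=
         C%:E * circle_Lnorm p
                  (expsum (Bset s (h1 x1) x3 phi1 psi) N (fun=> 1%R)))%E.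
Proof.
have /andP[c11 c12] := hc1; have /andP[c21 c22] := hc2.
pose g1 := c1^-1; pose g2 := c2^-1.
have c10 : 0 < c1 by lra.
have c20 : 0 < c2 by lra.
have hg1 : 1 / 2 < g1 <= 1 by rewrite invf_le1// c11 div1r ltf_pV2 ?posrE// c12.
have hg2 : 5 / 6 < g2 <= 1.
  rewrite invf_le1// c21 andbT (_ : 5 / 6 = (6 / 5)^-1); last by field.
  by rewrite ltf_pV2 ?posrE//; lra.
have hp' : 12 * (1 - g2) <= (p - 2) * (g1 + 3 * g2 - 3).
  move: hp; rewrite /p_crit -/g1 -/g2 div1r -/g1 => hp0.
  have den : 0 < g1 + 3 * g2 - 3 by lra.
  by move: hp0; rewrite ler_pdivrMr//; lra.
have p2 : 2 <= p by rewrite leNgt; apply/negP => p2; nra.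
(* The case p = 2 is separate because the level set argument needs p > 2. *)
move: p2; rewrite le_eqVlt => /predU1P[p2|p2].
  exists 1 => // s N a a1; rewrite mul1e -p2.
  exact: majorant_L2.
have p0 : 0 < p by lra.
have [eta [sigma [[he sig0 sg1 sg2 smex] [hbeta pbeta pexp sgt]]]] := exponent_choice hg1 hg2 p2 hp'.
have /andP[e0 e8] := he.
have [Y1 hY1 [Y11 u0 umono uder [k1 k10 [C1 C10 udiff]]]] := inverse_regular hx1 hc1 he hh1 hphi1.
have c2lt : 1 <= c2 < 2 by rewrite c21/=; lra.
have [Y2 hY2 [Y21 w0 wmono wder _]] := inverse_regular hx2 c2lt he hh2 hphi2.
have half : 0 < 1 / 2 :> R by rewrite divr_gt0.
have /cvgrPdist_lt/(_ _ half) psi_near := psi_lim0.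
have [Y3 Y3ge psiY] := near_pinftyP psi_near (Num.max (Num.max Y1 Y2) x3).
move: Y3ge; rewrite !ge_max => /andP[/andP[Y13 Y23] x33].
(* psi / phi2' lies between 1/2 and 3/2 here, and phi2' lies between phi2 / (3 y) and 2 phi2 / y. *)
have psi_b y : Y3 <= y -> phi2 y / (6 * y) <= psi y <= 3 * phi2 y / y.
  move=> Yy; have Y2y : Y2 <= y by exact: le_trans Yy.
  have y0 : 0 < y by rewrite (lt_le_trans _ Y2y)// (lt_le_trans ltr01).
  have wp := w0 y Y2y.
  have := psiY y Yy; have /andP[d1 d2] := wder y Y2y.
  have L0 : 0 < phi2 y / (3 * y) by rewrite divr_gt0 ?mulr_gt0.
  have d0 : 0 < derive1 phi2 y by exact: lt_le_trans d1.
  rewrite ltr_norml => /andP[q1 q2].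
  have q3 : 1 / 2 * derive1 phi2 y <= psi y.
    by rewrite -ler_pdivlMr//; move: q2; clear; lra.
  have q4 : psi y <= 3 / 2 * derive1 phi2 y.
    by rewrite -ler_pdivrMr//; move: q1; clear; lra.
  have -> : phi2 y / (6 * y) = 1 / 2 * (phi2 y / (3 * y)) by field; rewrite gt_eqF.
  have -> : 3 * phi2 y / y = 3 / 2 * (2 * phi2 y / y) by field; rewrite gt_eqF.
  by move: d1 d2 q3 q4; clear; move=> *; apply/andP; split; lra.
pose n1 := (Num.truncn Y3).+1.
have n1Y n : (n1 <= n)%N -> Y3 <= n%:R.
  by move=> nn; rewrite (le_trans (ltW (truncnS_gt _)))// ler_nat.
have n10 : (0 < n1)%N by [].
pose u (n : nat) := phi1 n%:R; pose W (n : nat) := phi2 n%:R.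
have u_pos n : (n1 <= n)%N -> 0 < u n by move=> /n1Y nn; apply: u0; exact: le_trans nn.
have W_pos n : (n1 <= n)%N -> 0 < W n by move=> /n1Y nn; apply: w0; exact: le_trans nn.
have nR n : (n1 <= n)%N -> 1 <= n%:R :> R by move=> nn; rewrite ler1n (leq_trans _ nn).
have nR0 n : (n1 <= n)%N -> 0 < n%:R :> R by move=> nn; rewrite ltr0n (leq_trans _ nn).
have u_le m n : (n1 <= m)%N -> (m <= n)%N ->
    [/\ u m <= u n, (n%:R / m%:R) `^ (g1 - eta) <= u n / u m & u n / u m <= (n%:R / m%:R) `^ (g1 + eta)].
  by move=> nm mn; apply: umono; rewrite ?ler_nat// (le_trans Y13)// n1Y.
have W_le m n : (n1 <= m)%N -> (m <= n)%N ->
    [/\ W m <= W n, (n%:R / m%:R) `^ (g2 - eta) <= W n / W m & W n / W m <= (n%:R / m%:R) `^ (g2 + eta)].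
  by move=> nm mn; apply: wmono; rewrite ?ler_nat// (le_trans Y23)// n1Y.
have ratio2 (f : nat -> R) (g : R) m n : 0 <= g + eta -> g + eta <= 2 -> (n1 <= m)%N -> (m <= n <= m.*2)%N ->
    0 < f m -> f n / f m <= (n%:R / m%:R) `^ (g + eta) -> f n <= 4 * f m.
  move=> ge0 ge2 nm /andP[mn n2m] fm; rewrite ler_pdivrMr// => /le_trans; apply.
  rewrite ler_wpM2r// ?(ltW fm)//.
  have r1 : 1 <= n%:R / m%:R :> R by rewrite ler_pdivlMr ?nR0// mul1r ler_nat.
  have r2 : n%:R / m%:R <= 2 :> R by rewrite ler_pdivrMr ?nR0// -natrM ler_nat mul2n.
  apply: (@le_trans _ _ ((n%:R / m%:R) `^ 2)); first by rewrite ler_powR.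
  rewrite powR_mulrn ?(le_trans ler01 r1)//.
  by move: r1 r2; clear; move: (n%:R / m%:R) => r r1 r2; nra.
have gp e : 0 <= e <= 1 -> 0 <= e + eta /\ e + eta <= 2.
  by move: e0 e8; clear; move=> ? ? /andP[? ?]; split; lra.
have [g1p g1q] : 0 <= g1 + eta /\ g1 + eta <= 2 by apply: gp; move: hg1; clear; lra.
have [g2p g2q] : 0 <= g2 + eta /\ g2 + eta <= 2 by apply: gp; move: hg2; clear; lra.
have u_double n : (n1 <= n)%N -> u n.*2 <= 4 * u n.
  move=> nn; have n2 : (n <= n.*2)%N by rewrite -addnn leq_addr.
  have [_ _ h] := u_le n n.*2 nn n2.
  by apply: (ratio2 u g1 n n.*2) => //; [rewrite leqnn n2|exact: u_pos].
have W_four m n : (n1 <= m)%N -> (m <= n <= m.*2)%N -> W n <= 4 * W m.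
  move=> nm mn; have [_ _ h] := W_le m n nm (proj1 (andP mn)).
  by apply: (ratio2 W g2 m n) => //; exact: W_pos.
have u_diff n : (n1 <= n)%N ->
    k1 * (u n * u n `^ (- eta)) / n%:R ^+ 2 <= (u n.+1 - u n) - (u n.+2 - u n.+1) <= C1 * u n / n%:R ^+ 2.
  move=> /n1Y nn; have := udiff n%:R (le_trans Y13 nn).
  by rewrite /u -[n.+2]addn2 -[n.+1]addn1 !natrD.
pose cY := u n1 / n1%:R `^ (g1 - eta); pose CY := u n1 / n1%:R `^ (g1 + eta).
pose cW := W n1 / n1%:R `^ (g2 - eta).
have cY0 : 0 < cY by rewrite divr_gt0 ?u_pos ?powR_gt0 ?nR0.
have CY0 : 0 < CY by rewrite divr_gt0 ?u_pos ?powR_gt0 ?nR0.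
have cW0 : 0 < cW by rewrite divr_gt0 ?W_pos ?powR_gt0 ?nR0.
have powR_div n r : (n1 <= n)%N -> (n%:R / n1%:R) `^ r = n%:R `^ r / n1%:R `^ r :> R.
  move=> nn; rewrite powRM ?invr_ge0 ?ler0n//; congr (_ * _).
  by rewrite -powR_inv1 ?ler0n// powRAC powR_inv1 ?powR_ge0.
have u_lo n : (n1 <= n)%N -> cY * n%:R `^ (g1 - eta) <= u n.
  move=> nn; have [_ + _] := u_le n1 n (leqnn _) nn.
  rewrite powR_div// ler_pdivlMr ?u_pos// => /(le_trans _); apply.
  by rewrite le_eqVlt; apply/orP; left; apply/eqP; rewrite /cY; ring.
have u_hi n : (n1 <= n)%N -> u n <= CY * n%:R `^ (g1 + eta).
  move=> nn; have [_ _] := u_le n1 n (leqnn _) nn.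
  by rewrite powR_div// ler_pdivrMr ?u_pos// /CY => /le_trans; apply; rewrite le_eqVlt; apply/orP; left; apply/eqP; ring.
have W_lo n : (n1 <= n)%N -> cW * n%:R `^ (g2 - eta) <= W n.
  move=> nn; have [_ + _] := W_le n1 n (leqnn _) nn.
  by rewrite powR_div// ler_pdivlMr ?W_pos// => /(le_trans _); apply; rewrite le_eqVlt; apply/orP; left; apply/eqP; rewrite /cW; ring.
(* For X <= n <= 2 X one has psi n >= W n / (6 n) >= W X / (12 X), so arcs of length kap W X / X lie
   inside B. *)
pose kap : R := 1 / 12.
have kap0 : 0 < kap by rewrite divr_gt0.
have A0 : 0 < 18 / kap by rewrite divr_gt0.
have eps01 : 0 <= eta <= 1 by move: e0 e8; clear; lra.
have u_mono m n : (n1 <= m)%N -> (m <= n)%N -> u m <= u n.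
  by move=> nm mn; have [] := u_le m n nm mn.
have W_mono m n : (n1 <= m)%N -> (m <= n)%N -> W m <= W n.
  by move=> nm mn; have [] := W_le m n nm mn.
have psi_W n : (n1 <= n)%N -> W n / (6 * n%:R) <= psi n%:R <= 3 * W n / n%:R.
  by move=> /n1Y; exact: psi_b.
have W3n n : (n1 <= n)%N -> W n <= 3 * n%:R.
  move=> nn; have /andP[h _] := psi_W n nn.
  have /psi_range/andP[_ h'] : x3 <= n%:R by rewrite (le_trans x33)// n1Y.
  have n0 := nR0 n nn; have := le_trans h h'; rewrite ler_pdivrMr ?mulr_gt0//.
  by clear; move: (n%:R : R) (W n) => nr w; lra.
(* W grows at least like the power g2 - eta, so W n n^(-beta) gains a factor 2^eta at each
   doubling. *)
pose beta := g2 - 2 * eta; pose rho : R := 2 `^ (- eta).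
have hrho : 0 < rho < 1.
  by rewrite powR_gt0//= /rho powRN invf_lt1 ?powR_gt0// powR_gt1// ltr1n.
have W_doubling m n : (n1 <= m)%N -> (m.*2 <= n)%N ->
    W m * m%:R `^ (- beta) <= rho * (W n * n%:R `^ (- beta)).
  move=> nm m2n; have mn : (m <= n)%N by rewrite (leq_trans _ m2n)// -addnn leq_addr.
  have [_ h _] := W_le m n nm mn.
  have m0 := nR0 m nm; have n0 := nR0 n (leq_trans nm mn).
  have r0 : 0 < n%:R / m%:R :> R by rewrite divr_gt0.
  have r2 : 2 <= n%:R / m%:R :> R by rewrite ler_pdivlMr// -natrM ler_nat mul2n.
  have E : (n%:R / m%:R) `^ (g2 - eta) = (n%:R / m%:R) `^ beta * (n%:R / m%:R) `^ eta :> R.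
    by rewrite -powRD ?(gt_eqF r0) ?implybT//; congr (_ `^ _); rewrite /beta; ring.
  have hb : 2 `^ eta <= (n%:R / m%:R) `^ eta :> R.
    by rewrite ge0_ler_powR ?nnegrE// ltW.
  have hc : (n%:R / m%:R) `^ beta * 2 `^ eta <= W n / W m.
    by apply: le_trans h; rewrite E ler_wpM2l// powR_ge0.
  rewrite /rho !powRN.
  have pm : 0 < m%:R `^ beta :> R by rewrite powR_gt0.
  have pn : 0 < n%:R `^ beta :> R by rewrite powR_gt0.
  have pe : 0 < 2 `^ eta :> R by rewrite powR_gt0.
  have Em : (n%:R / m%:R) `^ beta = n%:R `^ beta / m%:R `^ beta :> R.
    rewrite powRM ?invr_ge0 ?ler0n//; congr (_ * _).
    by rewrite -powR_inv1 ?ler0n// powRAC powR_inv1 ?powR_ge0.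
  move: hc; rewrite Em ler_pdivlMr ?W_pos//.
  move: (n%:R `^ beta) (m%:R `^ beta) (2 `^ eta) pm pn pe => q1 q2 q3 pm pn pe hc.
  rewrite [leRHS]mulrA ler_pdivlMr// mulrC ler_pdivlMl//.
  by apply: le_trans hc; rewrite le_eqVlt; apply/orP; left; apply/eqP; ring.
suff per_sign s : exists2 C : R, 0 < C & forall (N : nat) (a : nat -> R[i]),
    (forall n, normc (a n) <= 1) ->
    (circle_Lnorm p (expsum (Bset s (h1 x1) x3 phi1 psi) N a) <=
       C%:E * circle_Lnorm p (expsum (Bset s (h1 x1) x3 phi1 psi) N (fun=> 1%R)))%E.
  have [Cf Cf0 Hf] := per_sign false; have [Ct Ct0 Ht] := per_sign true.
  exists (Cf + Ct); first exact: addr_gt0.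
  move=> [] N a a1; [apply: le_trans (Ht N a a1) _|apply: le_trans (Hf N a a1) _];
    by apply: lee_wpmul2r; [exact: Lnorm_ge0|rewrite lee_fin ?lerDl ?lerDr ltW].
set B := Bset _ _ _ _ _.
pose x (n : nat) := (-1) ^+ s * u n.
have [n2 [S0 S00 HS]] : exists n2 : nat, exists2 S0 : R, 0 <= S0 &
    forall X a b m xi, (n2 <= X)%N -> (X <= a)%N -> (b <= X.*2)%N ->
    (0 < m)%N -> m%:R * W X <= 18 / kap * X%:R ->
    normc (\sum_(a <= n < b) e2pi (m%:R * x n + n%:R * xi)) <= S0 * X%:R `^ sigma.
  exact: (exp_sum_power_saving n10 k10 C10 eps01 u_pos u_mono
    u_double u_diff A0 cY0 CY0 cW0 u_lo u_hi W_lo sg1 sg2 smex s).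
(* Chosen so that D X^(-(g2 - eta - sigma)) <= 1 is the required smallness of the error in the
   count. *)
pose D := 4 * S0 * 72 / (kap * cW).
have D0 : 0 <= D by apply: divr_ge0; [do 2?apply: mulr_ge0|apply: ltW; exact: mulr_gt0].
have sgt0 : 0 < g2 - eta - sigma by rewrite subr_gt0.
have [n3 Hn3] := powR_small D0 sgt0.
pose n4 := (maxn (maxn n1 n2) (maxn n3 2)).
have n41 n : (n4 <= n)%N -> [/\ (n1 <= n)%N, (n2 <= n)%N & (n3 <= n)%N].
  by rewrite !geq_max => /andP[/andP[-> ->] /andP[-> _]].
have B_frac n : (n1 <= n)%N -> B n = (Defs.frac (x n) < psi n%:R).
  move=> nn; rewrite /B /Bset (leq_trans n10 nn)/= (le_trans x33 (n1Y _ nn)).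
  by rewrite (le_trans (le_trans hY1 Y13) (n1Y _ nn)).
have small X : (n4 <= X)%N -> 4 * S0 * X%:R `^ sigma <= kap / 72 * W X.
  move=> /n41[X1 _ X3]; have [X0 h] := Hn3 X X3.
  have XR := nR0 X X1.
  apply: (@le_trans _ _ (kap / 72 * (cW * X%:R `^ (g2 - eta)))); last first.
    by rewrite ler_wpM2l ?W_lo// divr_ge0// ltW.
  have -> : 4 * S0 * X%:R `^ sigma = D * X%:R `^ (- (g2 - eta - sigma)) * (kap / 72 * (cW * X%:R `^ (g2 - eta))).
    have -> : X%:R `^ sigma = X%:R `^ (- (g2 - eta - sigma)) * X%:R `^ (g2 - eta) :> R.
      by rewrite -powRD ?(gt_eqF XR) ?implybT//; congr (_ `^ _); ring.
    by rewrite /D; field; rewrite !gt_eqF.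
  apply: ler_piMl h; apply: mulr_ge0; first by rewrite divr_ge0// ltW.
  by apply: mulr_ge0; [exact: ltW|exact: powR_ge0].
have [C3 C30 HC3] : exists2 C, 0 < C & forall N, (n4.*2 <= N)%N -> W N <= C * \sum_(1 <= n < N.+1 | B n) 1.
  apply: (@count_lower_bound R B x W n4 S0 sigma kap) => //.
  - by rewrite !leq_max leqnn !orbT.
  - by move=> n /n41[n1n _ _]; exact: W_pos.
  - by move=> n /n41[n1n _ _]; have := W3n n n1n; have := nR n n1n; rewrite /kap; clear; move: (n%:R : R) (W n) => nr w; lra.
  - by move=> m n /n41[n1n _ _]; exact: W_four.
  - move=> X n /n41[X1 _ _] /andP[Xn nX2] h; have nn : (n1 <= n)%N by exact: leq_trans Xn.
    rewrite B_frac//; apply: (lt_le_trans h).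
    have /andP[h1' _] := psi_W n nn; apply: le_trans h1'.
    have WXn := W_mono X n X1 Xn; have WX := W_pos X X1.
    have Xr := nR0 X X1; have nr := nR0 n nn.
    have nX : n%:R <= 2 * X%:R :> R by rewrite -natrM ler_nat mul2n.
    rewrite ler_pdivrMr// [leRHS]mulrAC ler_pdivlMr ?mulr_gt0//.
    move: WXn WX Xr nr nX; rewrite /kap; clear; move: (W X) (W n) (n%:R : R) (X%:R : R) => w w' nr' xr.
    by move=> ? ? ? ? ?; nra.
  - by move=> X a b m xi /n41[_ X2 _]; exact: HS.
(* On [X, 2 X] psi is at most 3 W n / n <= 12 W X / X, below the second entry, and at most 1/2 by
   hypothesis. *)
pose P (n : nat) := Num.min (1 / 2) (16 * W n / n%:R).
pose C4 := (C3 / cW) `^ (p / 2).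
have n4d n : (n4.*2 <= n)%N -> (n4 <= n)%N by apply: leq_trans; rewrite -addnn leq_addr.
have [C C0 HC] : exists2 C, 0 < C & forall N c,
    let b := \sum_(1 <= n < N.+1 | B n) 1 in
    (n4.*2 <= N)%N -> (forall n, normc (c n) <= 1) -> W N <= C3 * b ->
    (b * N%:R `^ sigma) `^ ((p - 2) / 2) * N%:R * b <= C4 * b `^ p ->
  \sum_(j < N) normc (\sum_(1 <= n < N.+1 | B n) c n * e2pi (n%:R * (j%:R / N%:R))) `^ p <=
     C * b `^ p.
  apply: (@grid_moment R B x W P n4.*2 16 S0 sigma beta rho C3 C4 p) => //.
  - by rewrite double_gt0 !leq_max !orbT.
  - by move=> n /n4d/n41[n1n _ _]; exact: W_pos.
  - by move=> m n /n4d/n41[n1n _ _]; exact: W_doubling.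
  - by move=> m n /n4d/n41[n1n _ _]; exact: W_mono.
  - move=> n /n4d/n41[n1n _ _]; rewrite lt_min ge_min lexx andbT half divr_gt0 ?nR0//.
    by rewrite mulr_gt0// W_pos.
  - by move=> n _; rewrite ge_min lexx orbT.
  - move=> X n /n4d/n41[X1 _ _] /andP[Xn nX2]; have nn : (n1 <= n)%N by exact: leq_trans Xn.
    rewrite B_frac// => h; rewrite lt_min; apply/andP; split.
      apply: (lt_le_trans h); have /psi_range/andP[] // : x3 <= n%:R.
      by rewrite (le_trans x33)// n1Y.
    apply: (lt_le_trans h); have /andP[_ h'] := psi_W n nn; apply: (le_trans h').
    have Wn4 : W n <= 4 * W X by apply: W_four; rewrite ?Xn.
    have WX := W_pos X X1; have Wn := W_pos n nn.
    apply: ler_pM.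
    + by rewrite mulr_ge0// ltW.
    + by rewrite invr_ge0 ler0n.
    + by move: Wn4 WX; clear; lra.
    + by rewrite lef_pV2 ?posrE ?nR0// ler_nat.
  - move=> X a b m xi /n4d/n41[X1 X2 _] Xa bX m0 mP; apply: HS => //.
    have XR := nR0 X X1; have Xr1 := nR X X1; have WX := W_pos X X1; have W3 := W3n X X1.
    have mr : 1 <= m%:R :> R by rewrite ler1n.
    have -> : 18 / kap = 216 by rewrite /kap; field.
    (* If P X = 1/2 then m <= 2 and W X <= 3 X bound m W X by 6 X; otherwise 16 m W X <= X. Both are
       within 216 X. *)
    move: mP; rewrite /P /Order.min; case: ifP => _ mP.
      have mW : m%:R * W X <= 2 * (3 * X%:R).
        by apply: ler_pM => //; [exact: ltW|move: mP; clear; lra].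
      by apply: (le_trans mW); move: XR; clear; lra.
    move: mP; rewrite mulrA ler_pdivrMr// mul1r => mP.
    apply: (@le_trans _ _ X%:R); last by rewrite ler_peMl ?ler0n//; clear; lra.
    apply: le_trans mP; have : 0 <= m%:R * W X by rewrite mulr_ge0// ltW.
    by clear; move: (m%:R : R) (W X) => v w; lra.
  - by rewrite powR_ge0.
have C0' := ltW C0.
apply: (@majorant_of_grid R B n4.*2 p C p0 C0') => N c nN c1le.
apply: HC => //; first exact: HC3.
have WN := HC3 N nN; set b := \sum_(1 <= n < N.+1 | B n) 1 in WN *.
have [N1 _ _] := n41 N (n4d N nN).
have NR := nR0 N N1.
have b0 : 0 < b by rewrite -(pmulr_rgt0 _ C30) (lt_le_trans (W_pos N N1)).
have Npow : N%:R `^ (g2 - eta) <= C3 / cW * b.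
  rewrite mulrAC ler_pdivlMr// mulrC; apply: le_trans WN; exact: W_lo.
have -> : b `^ p = b `^ ((p - 2) / 2) * b * b `^ (p / 2).
  rewrite -[X in _ * X * _](@powRr1 _ b) ?(ltW b0)//.
  by rewrite -!powRD ?(gt_eqF b0) ?implybT//; congr (_ `^ _); clear; lra.
rewrite powRM ?powR_ge0 ?(ltW b0)// -powRrM.
(* The affordability inequality bounds the power of N by N^((g2 - eta) p / 2), and N^(g2 - eta) is
   at most a constant times b by the count of B. *)
have key : N%:R `^ (sigma * ((p - 2) / 2)) * N%:R <= C4 * b `^ (p / 2).
  have CcW : 0 <= C3 / cW by apply: divr_ge0; exact: ltW.
  rewrite /C4 -powRM ?(ltW b0)//.
  rewrite -[X in _ * X <= _](@powRr1 _ N%:R) ?ler0n// -powRD ?(gt_eqF NR) ?implybT//.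
  apply: (@le_trans _ _ (N%:R `^ ((g2 - eta) * (p / 2)))).
    by rewrite ler_powR// nR.
  have Cb0 : 0 <= C3 / cW * b by apply: mulr_ge0 => //; exact: ltW.
  rewrite [leLHS]powRrM; apply: ge0_ler_powR; rewrite ?nnegrE ?powR_ge0//.
  by rewrite divr_ge0// ltW.
have bp : 0 <= b `^ ((p - 2) / 2) * b by rewrite mulr_ge0 ?powR_ge0// ltW.
have := ler_wpM2l bp key; rewrite le_eqVlt.
move: (b `^ ((p - 2) / 2)) (N%:R `^ (sigma * ((p - 2) / 2))) (b `^ (p / 2)) => v1 v2 v3.
by rewrite -le_eqVlt; clear; lra.
Qed.
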